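(* Suppose (A1) each $f_t(\cdot)=f(\cdot;\boldsymbol\xi_t)$ has $L_g$-Lipschitz continuous gradient and (A3) each $f_t$ is $L_c$-Lipschitz continuous. Run ZO-AdaMM with $\mathcal X=\mathbb R^d$, $\hat{\mathbf v}_0^{1/2}\ge c\mathbf 1$ ($c>0$), $\beta_{1,t}=\beta_1$ for all $t$, $\gamma:=\beta_1/\beta_2<1$, $\mu=1/\sqrt{Td}$, $\alpha_t=1/\sqrt{Td}$, assume $f_\mu(\mathbf x_1)-\min_{\mathbf x}f_\mu(\mathbf x)\le D_f$ and $\max\{d,T\}\ge3$, and let $\mathbf x_R$ be picked uniformly at random from $\{\mathbf x_t\}_{t=1}^T$. Then with probability at least $1-1/(T\sqrt d)$, \[ \mathbb E\big[\|\hat{\mathbf V}_R^{-1/4}\nabla f(\mathbf x_R)\|^2\big]=O\big(\sqrt d/\sqrt T+d^{1.5}/T\big). \]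
   Context: Problem: $\min_{\mathbf x}f(\mathbf x)=\mathbb E_{\boldsymbol\xi}[f(\mathbf x;\boldsymbol\xi)]$, $f(\cdot;\boldsymbol\xi)$ differentiable, $\boldsymbol\xi_t$ independent samples. ZO gradient estimate: $\hat\nabla h(\mathbf x)=(d/\mu)[h(\mathbf x+\mu\mathbf u)-h(\mathbf x)]\mathbf u$, $\mathbf u$ uniform on the unit sphere of $\mathbb R^d$, independent across iterations. Smoothed function: $f_\mu(\mathbf x)=\mathbb E_{\mathbf u\sim U_B}[f(\mathbf x+\mu\mathbf u)]$, $U_B$ uniform on the unit Euclidean ball. ZO-AdaMM: given $\mathbf x_1$, $\alpha_t$, $\beta_{1,t},\beta_2\in(0,1]$, $\mathbf m_0=\mathbf 0$, $\mathbf v_0=\mathbf 0$, $\hat{\mathbf v}_0$, for $t=1,\dots,T$: $\hat{\mathbf g}_t=\hat\nabla f_t(\mathbf x_t)$; $\mathbf m_t=\beta_{1,t}\mathbf m_{t-1}+(1-\beta_{1,t})\hat{\mathbf g}_t$; $\mathbf v_t=\beta_2\mathbf v_{t-1}+(1-\beta_2)\hat{\mathbf g}_t^2$; $\hat{\mathbf v}_t=\max(\hat{\mathbf v}_{t-1},\mathbf v_t)$, $\hat{\mathbf V}_t=\mathrm{diag}(\hat{\mathbf v}_t)$; $\mathbf x_{t+1}=\mathbf x_t-\alpha_t\hat{\mathbf V}_t^{-1/2}\mathbf m_t$ (the unconstrained case of the Mahalanobis-projected update), all operations elementwise. The expectation is over all randomness (samples, directions, $R$); the probability statement refers to an event of the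 random directions on which the expectation is taken (conditionally). $\|\cdot\|$ is the Euclidean norm; the $O(\cdot)$ hides constants depending on $L_g,L_c,c,D_f,\beta_1,\beta_2$. *)

(* Defs.v *)
From HB Require Import structures.
From mathcomp Require Import all_boot all_order all_algebra.
From mathcomp Require Import all_classical all_reals all_analysis.
Set Implicit Arguments. Unset Strict Implicit. Unset Printing Implicit Defensive.
Import Order.TTheory GRing.Theory Num.Theory.
Import numFieldNormedType.Exports.
Local Open Scope classical_set_scope.
Local Open Scope ring_scope.

Section Defs.
Variables (R : realType) (d : nat).
Local Notation vec := 'rV[R]_d.

Definition enorm (x : vec) : R := Num.sqrt (\sum_(i < d) x 0 i ^+ 2).

Definition ebasis (i : 'I_d) : vec := delta_mx 0 i.

Definition grad (h : vec -> R) (x : vec) : vec := \row_i ('D_(ebasis i) h x).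

Definition borel_rV : set (set vec) := <<s open >>.

(* iterated Lebesgue integral over R^d (Fubini/Tonelli form) *)
Definition coord_vec (k : nat) : vec := \row_(i < d) (if (i : nat) == k then 1 else 0).
Fixpoint iint (k : nat) (g : vec -> \bar R) : \bar R :=
  match k with
  | 0 => g 0
  | k'.+1 => (\int[@lebesgue_measure R]_(a in setT)
                 iint k' (fun y => g (y + (a : R) *: coord_vec k')%R))%E
  end.
Definition lebesgue_rV (A : set vec) : \bar R := iint d (fun v => (\1_A v)%:E).

Definition unit_ball : set vec := [set v | enorm v <= 1].
Definition unit_sphere : set vec := [set v | enorm v = 1].
Definition cone01 (A : set vec) : set vec :=
  [set v | exists (r : R) (a : vec), 0 < r <= 1 /\ A a /\ v = r *: a].

Definition E_ball (h : vec -> R) : R :=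
  fine (iint d (fun v => (\1_unit_ball v * h v)%:E)) / fine (lebesgue_rV unit_ball).

Definition smoothed (h : vec -> R) (mu : R) (x : vec) : R := E_ball (fun v => h (x + mu *: v)).

Definition zo_grad (h : vec -> R) (mu : R) (x u : vec) : vec :=
  (d%:R / mu * (h (x + mu *: u) - h x)) *: u.

Record adamm_state := AdammState { st_x : vec; st_m : vec; st_v : vec; st_vh : vec }.

Definition adamm_step (alpha beta1 beta2 : R) (g : vec) (s : adamm_state) : adamm_state :=
  let m := beta1 *: st_m s + (1 - beta1) *: g in
  let v := beta2 *: st_v s + (1 - beta2) *: map_mx (fun a => a ^+ 2) g in
  let vh := \row_i Num.max (st_vh s 0 i) (v 0 i) in
  let x := st_x s - alpha *: \row_i ((vh 0 i) `^ (- 2^-1) * m 0 i) in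
  AdammState x m v vh.

(* zo_adamm ... t = (x_{t+1}, m_t, v_t, vhat_t); zo_adamm ... 0 = (x_1, 0, 0, vhat_0) *)
Fixpoint zo_adamm (Xi : Type) (f : vec -> Xi -> R) (x1 vh0 : vec)
    (alpha beta1 : nat -> R) (beta2 mu : R) (xi : nat -> Xi) (u : nat -> vec)
    (t : nat) : adamm_state :=
  match t with
  | 0 => AdammState x1 0 0 vh0
  | t'.+1 =>
      let s := zo_adamm f x1 vh0 alpha beta1 beta2 mu xi u t' in
      adamm_step (alpha t) (beta1 t) beta2
        (zo_grad (fun x => f x (xi t)) mu (st_x s) (u t)) s
  end.

Definition wnorm2 (vh g : vec) : R := enorm (\row_i ((vh 0 i) `^ (- 4^-1) * g 0 i)) ^+ 2.

End Defs.

(* Random elements of the algorithm: xi_t (samples), u_t (directions), R (index).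
   Index type: Some (inl t) = xi_t, Some (inr t) = u_t, None = R. *)
Definition rv_index := option (nat + nat).

Definition generated_events {dO} {Omega : measurableType dO} {R : realType} {d : nat}
    {dX} {Xi : measurableType dX} (xi : nat -> Omega -> Xi) (u : nat -> Omega -> 'rV[R]_d)
    (Ridx : Omega -> nat) (j : rv_index) : set (set Omega) :=
  match j with
  | Some (inl t) => [set xi t @^-1` B | B in [set B | measurable B]]
  | Some (inr t) => [set u t @^-1` B | B in borel_rV (R:=R) (d:=d)]
  | None => [set Ridx @^-1` B | B in [set: set nat]]
  end.

Definition mutually_independent {dO} {Omega : measurableType dO} {R : realType}
    (P : probability Omega R) (ev : rv_index -> set (set Omega)) : Prop :=
  forall (J : seq rv_index), uniq J ->
  forall A : rv_index -> set Omega, (forall j, j \in J -> ev j (A j)) ->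
  fine (P (\bigcap_(j in [set j | j \in J]) A j)) = \prod_(j <- J) fine (P (A j)).

(* u is uniformly distributed on the unit sphere of R^d: normalized surface
   measure, given by the cone measure  sigma(B) = lambda_d(cone(B)) / lambda_d(ball) *)
Definition uniform_on_sphere {dO} {Omega : measurableType dO} {R : realType} {d : nat}
    (P : probability Omega R) (u : Omega -> 'rV[R]_d) : Prop :=
  forall B, borel_rV B ->
  P (u @^-1` B) = (fine (lebesgue_rV (cone01 (B `&` unit_sphere (R:=R) (d:=d))))
                   / fine (lebesgue_rV (unit_ball (R:=R) (d:=d))))%:E.

Definition depends_only_on_directions {Omega R : Type} {d : nat}
    (u : nat -> Omega -> 'rV[R]_d) (T : nat) (E : set Omega) : Prop :=
  forall w w', (forall t, (1 <= t <= T)%N -> u t w = u t w') -> (E w <-> E w').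

(* Main.v *)
(* Let z_t = x_t - b alpha V_t^(-1/2) m_t with b = beta1 / (1 - beta1). One step moves z by
   -alpha V_t^(-1/2) g_t plus a term in the decrease V_(t-1)^(-1/2) - V_t^(-1/2) of the weights.
   The products of this decrease with g_t and m_t are split by Young's inequality with a
   parameter eta = T^(1/4): the part linear in the decrease telescopes and is put into a
   potential, the rest is a fourth moment of a coordinate of g_t or m_t, which is O(1) because
   the eighth moment of <a, u> is O(|a|^8 / d^4) on the sphere. Given the past, g_t has mean
   grad f(x_t) up to d mu L_g; f and f_mu differ by at most L_c mu. The bound holds with
   probability 1: the event only asks that the directions up to T have norm one, so that they
   may be replaced by exactly normalised ones.
   Moments of <a, u> come from the rotation invariance of Lebesgue measure, a planar rotation
   being a product of three shears. *)

Require Import Defs.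
From HB Require Import structures.
From mathcomp Require Import all_boot all_order all_algebra.
From mathcomp Require Import all_classical all_reals all_analysis.
From mathcomp Require Import ring lra measurable_realfun.
Import Order.TTheory GRing.Theory Num.Theory.
Import numFieldNormedType.Exports.
Local Open Scope classical_set_scope.
Local Open Scope ring_scope.

Set Implicit Arguments.
Unset Strict Implicit.
Unset Printing Implicit Defensive.

(** The weights after a step contain the new estimate g, so their product with g has no tractable
    mean given the past. The weights before the step take their place, and the decrease of the
    weights has to be paid for. The sure bound |g_i| <= d L_c would make it cost d^2/T in the
    average, above the claimed d^1.5/T. Cutting |g_i| at a level eta costs d eta / T for the
    telescoping part and d E|g_i|^p / eta^(p-1) for the rest, about d T^(1/p - 1) at best. For p = 4
    this is d T^(-3/4), the geometric mean of the two terms of the rate; a smaller p already fails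
    at d = sqrt T. A coordinate of g is close to d <a, u> u_i, a product of two linear forms, so its
    fourth moment calls for eighth moments on the sphere. Conditional expectations never appear: the
    state, the next sample and the next direction are shown to be independent, and averaging given
    the past is Fubini's theorem with the earlier variables frozen. *)

(** * The Euclidean inner product and norm *)

Section Euclid.
Context {R : realType} {d : nat}.
Local Notation vec := 'rV[R]_d.
Implicit Types (a b x y : vec) (k : R).

Definition dot a b : R := \sum_i a 0 i * b 0 i.

Lemma dotC a b : dot a b = dot b a.
Proof. by apply: eq_bigr => i _; rewrite mulrC. Qed.

Lemma dotDr a b x : dot a (b + x) = dot a b + dot a x.
Proof. by rewrite -big_split; apply: eq_bigr => i _; rewrite mxE mulrDr. Qed.

Lemma dotZr k a b : dot a (k *: b) = k * dot a b.
Proof. by rewrite mulr_sumr; apply: eq_bigr => i _; rewrite mxE mulrCA. Qed.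

Lemma dotNr a b : dot a (- b) = - dot a b.
Proof. by rewrite -scaleN1r dotZr mulN1r. Qed.

Lemma dotBr a b x : dot a (b - x) = dot a b - dot a x.
Proof. by rewrite dotDr dotNr. Qed.

Lemma dotDl a b x : dot (a + b) x = dot a x + dot b x.
Proof. by rewrite ![dot _ x]dotC dotDr. Qed.

Lemma dotZl k a b : dot (k *: a) b = k * dot a b.
Proof. by rewrite ![dot _ b]dotC dotZr. Qed.

Lemma dotBl a b x : dot (a - b) x = dot a x - dot b x.
Proof. by rewrite ![dot _ x]dotC dotBr. Qed.

Lemma enorm_ge0 a : 0 <= enorm a. Proof. exact: sqrtr_ge0. Qed.

Lemma sqr_enorm a : enorm a ^+ 2 = \sum_i a 0 i ^+ 2.
Proof. by rewrite sqr_sqrtr// sumr_ge0// => i _; rewrite sqr_ge0. Qed.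

Lemma dotE a : dot a a = enorm a ^+ 2.
Proof. by rewrite sqr_enorm; apply: eq_bigr => i _; rewrite expr2. Qed.

Lemma dot_sqr_le a b : dot a b ^+ 2 <= enorm a ^+ 2 * enorm b ^+ 2.
Proof.
have := enorm_ge0 b; rewrite le_eqVlt => /orP[/eqP b0|b0].
  have bi i : b 0 i = 0.
    have /eqP : enorm b ^+ 2 = 0 by rewrite -b0 expr0n.
    rewrite sqr_enorm psumr_eq0; last by move=> ? _; rewrite sqr_ge0.
    by move=> /allP/(_ i); rewrite mem_index_enum sqrf_eq0 => /(_ isT)/eqP.
  have -> : dot a b = 0 by rewrite /dot big1// => i _; rewrite bi mulr0.
  by rewrite expr0n mulr_ge0// sqr_ge0.
set B := enorm b ^+ 2; set D := dot a b.
have B0 : 0 < B by rewrite exprn_gt0.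
have : 0 <= enorm (B *: a - D *: b) ^+ 2 by rewrite sqr_ge0.
rewrite -dotE dotBr !dotBl !dotZr !dotZl [dot b a]dotC -/D !dotE -/B.
move=> h; have : 0 <= B * (enorm a ^+ 2 * B - D ^+ 2) by lra.
by rewrite pmulr_rge0// subr_ge0.
Qed.

Lemma normr_dot_le a b : `|dot a b| <= enorm a * enorm b.
Proof.
rewrite -(@ler_pXn2r _ 2)// ?nnegrE ?mulr_ge0 ?enorm_ge0//.
by rewrite real_normK ?num_real// exprMn dot_sqr_le.
Qed.

Lemma dot_le a b : dot a b <= enorm a * enorm b.
Proof. exact: le_trans (ler_norm _) (normr_dot_le a b). Qed.

Lemma enormZ k a : enorm (k *: a) = `|k| * enorm a.
Proof.
rewrite /enorm -sqrtr_sqr -sqrtrM ?sqr_ge0//; congr Num.sqrt.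
by rewrite mulr_sumr; apply: eq_bigr => i _; rewrite mxE exprMn.
Qed.

Lemma enorm_coord a i : `|a 0 i| <= enorm a.
Proof.
rewrite -(@ler_pXn2r _ 2)// ?nnegrE ?enorm_ge0//.
rewrite real_normK ?num_real// sqr_enorm (bigD1 i)//= lerDl sumr_ge0// => j _.
by rewrite sqr_ge0.
Qed.

Lemma dot_basis a i : dot a (ebasis R i) = a 0 i.
Proof.
rewrite /dot (bigD1 i)//= mxE !eqxx mulr1 big1 ?addr0// => j ji.
by rewrite mxE eqxx (negbTE ji) mulr0.
Qed.

Lemma enorm_basis i : enorm (ebasis R i : vec) = 1.
Proof.
apply/eqP; rewrite -(@eqrXn2 _ 2)// ?enorm_ge0// -dotE dot_basis mxE !eqxx.
by rewrite expr1n.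
Qed.

(** The crude factor d is enough to carry the density of rational vectors from the sup norm to the
    Euclidean norm. *)
Lemma enorm_le_mx_norm a : enorm a <= d%:R * `|a|.
Proof.
have a0 : 0 <= `|a| by [].
have h i : `|a 0 i| <= `|a|.
  by rewrite [leRHS]/Num.norm/= mx_normrE (le_bigmax _ (fun i => `|a i.1 i.2|) (0, i)).
rewrite -(@ler_pXn2r _ 2)// ?nnegrE ?enorm_ge0 ?mulr_ge0//.
rewrite sqr_enorm (@le_trans _ _ (\sum_(i < d) `|a| ^+ 2))//.
  by apply: ler_sum => i _; rewrite -[leLHS]real_normK ?num_real// lerXn2r ?nnegrE.
rewrite sumr_const card_ord exprMn -[leLHS]mulr_natl ler_wpM2r ?sqr_ge0//.
by rewrite -natrX ler_nat; case: (d) => // n; rewrite leq_pmull.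
Qed.

End Euclid.

(** * Borel sets and Lebesgue measure on R^d *)

(** An alias of the row vectors whose measurable sets are those of [borel_rV] by conversion. *)
Definition rVB (R : realType) (d : nat) := g_sigma_algebraType (@open 'rV[R]_d).
HB.instance Definition _ R d := Measurable.on (rVB R d).
HB.instance Definition _ R d := Pointed.on (rVB R d).

Section BorelRV.
Context {R : realType} {d : nat}.
Local Notation vec := 'rV[R]_d.
Local Notation B := (rVB R d).

Lemma open_measurable_rV (A : set vec) : open A -> measurable (A : set B).
Proof. by move=> oA; apply: sub_sigma_algebra. Qed.

Lemma measurable_fun_ltP d1 (T : measurableType d1) (f : T -> R) :
  (forall r, measurable [set x | f x < r]) -> measurable_fun setT f.
Proof.
move=> h; apply: (measurability _ (measurable_realfun.RGenInftyO.measurableE R)).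
move=> _ [_ [r ->] <-]; rewrite setTI.
suff -> : f @^-1` `]-oo, r[ = [set x | f x < r] by exact: h.
by apply/seteqP; split => x /=; rewrite in_itv.
Qed.

Lemma measurable_lt d1 (T : measurableType d1) (f : T -> R) r :
  measurable_fun setT f -> measurable [set x | f x < r].
Proof.
move=> mf; have := mf measurableT `]-oo, r[%classic (measurable_itv _).
by rewrite setTI; congr measurable.
Qed.

Lemma continuous_measurable_rV (h : vec -> R) :
  continuous h -> measurable_fun setT (h : B -> R).
Proof.
move=> ch; apply: measurable_fun_ltP => r; apply: open_measurable_rV.
rewrite (_ : [set x | h x < r] = h @^-1` [set y | y < r]) //.
by apply: open_comp; [move=> x _; exact: ch|exact: open_lt].
Qed.

Lemma measurable_coord (i : 'I_d) : measurable_fun setT ((fun x : vec => x 0 i) : B -> R).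
Proof. by apply: continuous_measurable_rV; exact: coord_continuous. Qed.

Definition rat_vec (q : 'rV[rat]_d) : vec := map_mx ratr q.

Lemma rat_vec_dense (x : vec) (e : R) : 0 < e -> exists q, ball x e (rat_vec q).
Proof.
move=> e0.
have /(_ _)/cid-/all_sig[q qP] (i : 'I_d) : exists q : rat, x 0 i - e < ratr q < x 0 i + e.
  have /rat_in_itvoo[q qP] : x 0 i - e < x 0 i + e by lra.
  by exists q; move: qP; rewrite in_itv.
exists (\row_i q i); split=> // i j.
rewrite ord1 !mxE /ball/= distrC lter_distl; exact: qP.
Qed.

(** An open set is a countable union of sup-norm balls with rational centres and radii 1/(n+1), and
    the preimage of such a ball is a finite intersection of conditions on coordinates. *)
Lemma measurable_fun_rV d1 (T : measurableType d1) (f : T -> vec) :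
  (forall i, measurable_fun setT (fun t => f t 0 i)) ->
  measurable_fun setT (f : T -> B).
Proof.
move=> mf; apply: (@measurability _ _ T B setT f (@open vec)) => // _ [U oU <-].
rewrite setTI.
have mball q (n : nat) : measurable (f @^-1` ball (rat_vec q) n.+1%:R^-1).
  have -> : f @^-1` ball (rat_vec q) n.+1%:R^-1 =
    \bigcap_(i in [set: 'I_d]) [set t | `|rat_vec q 0 i - f t 0 i| < n.+1%:R^-1].
    apply/seteqP; split => t /=.
      by move=> [_ h] i _ /=; exact: h.
    move=> h; split => [|i j]; rewrite ?invr_gt0// ord1.
    exact: h.
  apply: fin_bigcap_measurable => // i _; apply: measurable_lt.
  by apply: measurableT_comp => //; apply: measurable_funB.
have -> : f @^-1` U = \bigcup_(p in [set p : 'rV[rat]_d * nat |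
    ball (rat_vec p.1) p.2.+1%:R^-1 `<=` U]) f @^-1` ball (rat_vec p.1) p.2.+1%:R^-1.
  apply/seteqP; split => t /=; last by move=> [[q n]] /= qn /qn.
  move=> Uft; have /nbhs_ballP[e /= e0 eU] := open_nbhs_nbhs (conj oU Uft).
  have [n ne] : exists n : nat, n.+1%:R^-1 < e / 2.
    have e20 : 0 < e / 2 by lra.
    by have [n] := ltr_add_invr e20; rewrite add0r => ?; exists n.
  have [q qb] := @rat_vec_dense (f t) n.+1%:R^-1 ltac:(by rewrite invr_gt0).
  exists (q, n) => /=; last exact: ball_sym.
  move=> y hy; apply: eU; rewrite (splitr e).
  apply: ball_triangle (le_ball (ltW ne) qb) _.
  exact: (le_ball (ltW ne)).
rewrite bigcup_mkcond; apply: countable_bigcupT_measurable => [|p].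
  exact: countableP.
by case: ifPn => // _; exact: mball.
Qed.

Lemma measurable_fun_rVP d1 (T : measurableType d1) (f : T -> vec) :
  measurable_fun setT (f : T -> B) -> forall i, measurable_fun setT (fun t => f t 0 i).
Proof. by move=> mf i; exact: (measurableT_comp (measurable_coord i) mf). Qed.

End BorelRV.

(** * Translation invariance of Lebesgue measure on the line *)

Section LebesgueTranslation.
Context {R : realType}.
Local Notation mu := (@lebesgue_measure R).

Lemma lebesgue_translation (c : R) (A : set R) : measurable A ->
  pushforward mu ((fun x => x + c) : _ -> measurableTypeR R) A = mu A.
Proof.
move=> mA; apply/esym/lebesgue_measure_unique => //=.
  exact: measurable_funD.
move=> mf _ [[a b]] _ <-; rewrite /pushforward.
have -> : (fun x => x + c) @^-1` `]a, b] = `](a - c)%R, (b - c)%R]%classic.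
  by apply/seteqP; split => x /=; rewrite !in_itv/= ltrBlDr lerBrDr.
rewrite !lebesgue_measure_itv/= !lte_fin ltrD2r -!EFinB.
by rewrite (_ : b - c - (a - c) = b - a)//; ring.
Qed.

Lemma integral_translation (c : R) (f : R -> \bar R) :
  measurable_fun setT f -> (forall x, 0 <= f x)%E ->
  (\int[mu]_x f (x + c)%R = \int[mu]_x f x)%E.
Proof.
move=> mf f0.
transitivity (\int[pushforward mu ((fun x => x + c)%R : _ -> measurableTypeR R)]_x f x)%E.
  rewrite ge0_integral_pushforward//; exact: measurable_funD.
apply: eq_measure_integral; first exact: measurable_funD.
by move=> ? A mA _; exact: lebesgue_translation.
Qed.

End LebesgueTranslation.

(** * Tonelli for the iterated integral, and invariance under shears *)

Section IteratedIntegral.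
Context {R : realType} {d : nat}.
Local Notation vec := 'rV[R]_d.
Local Notation B := (rVB R d).
Local Notation mu := (@lebesgue_measure R).
Local Open Scope ereal_scope.
Implicit Types (g : vec -> \bar R) (k : nat) (y e : vec).

Lemma measurable_shift d1 (T : measurableType d1) (a : T -> R) (f : T -> vec) e :
  measurable_fun setT a -> measurable_fun setT (f : T -> B) ->
  measurable_fun setT ((fun t => (f t + a t *: e)%R) : T -> B).
Proof.
move=> ma mf; apply: measurable_fun_rV => i.
under eq_fun do rewrite !mxE.
apply: measurable_funD; first exact: (measurable_fun_rVP mf).
exact: measurable_funM.
Qed.

Lemma iint_ge0 k g : (forall v, 0 <= g v) -> 0 <= iint k g.
Proof.
elim: k g => [|k IH] g g0 /=; first exact: g0.
by apply: integral_ge0 => a _; exact: IH.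
Qed.

(** The base point [y] stands for the coordinates not yet integrated; with it the induction step is
    Tonelli's measurability statement for one more variable. *)
Lemma measurable_iint k g : measurable_fun setT (g : B -> \bar R) ->
  (forall v, 0 <= g v) ->
  measurable_fun setT ((fun y => iint k (fun v => g (v + y)%R)) : B -> \bar R).
Proof.
elim: k g => [|k IH] g mg g0 /=.
  by under eq_fun do rewrite add0r.
pose F := fun p : B * measurableTypeR R =>
  iint k (fun v => g (v + ((p.1 : vec) + p.2 *: coord_vec R d k))%R).
have mF : measurable_fun setT F.
  apply: (measurableT_comp (IH g mg g0)).
  apply: (@measurable_shift _ (B * measurableTypeR R)%type snd (fun p => p.1 : vec)).
    exact: measurable_snd.
  exact: measurable_fst.
have F0 p : 0 <= F p by apply: iint_ge0 => v.
have := @measurable_fun_fubini_tonelli_F _ _ B _ R mu _ mF F0.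
congr measurable_fun; apply/funext => y; apply: eq_integral => a _ /=.
rewrite /F; congr iint; apply/funext => v /=.
by rewrite -addrA [(y + _)%R]addrC.
Qed.

Lemma iint_integralC k g e y : measurable_fun setT (g : B -> \bar R) ->
  (forall v, 0 <= g v) ->
  iint k (fun v => \int[mu]_a g (v + y + a *: e)%R) =
  \int[mu]_a iint k (fun v => g (v + y + a *: e)%R).
Proof.
elim: k g y => [|k IH] g y mg g0 //=.
pose F := fun p : measurableTypeR R * measurableTypeR R =>
  iint k (fun v => g (v + (y + p.1 *: coord_vec R d k + p.2 *: e))%R).
have mF : measurable_fun setT F.
  apply: (measurableT_comp (measurable_iint k mg g0)).
  apply: (@measurable_shift _ (measurableTypeR R * measurableTypeR R)%type snd
    (fun p => y + p.1 *: coord_vec R d k)%R); first exact: measurable_snd.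
  by apply: (@measurable_shift _ _ fst (fun p => y)); first exact: measurable_fst.
have F0 p : 0 <= F p by apply: iint_ge0 => v.
have := @fubini_tonelli _ _ _ _ R mu mu _ mF F0.
rewrite /F /= => FT.
transitivity (\int[mu]_x \int[mu]_y0 F (x, y0)).
  apply: eq_integral => b _; rewrite /F /=.
  transitivity (iint k (fun v =>
      \int[mu]_a g (v + (y + (b : R) *: coord_vec R d k) + (a : R) *: e)%R)).
    congr iint; apply/funext => v; apply: eq_integral => a _; congr g.
    by rewrite -!addrA; congr (_ + _)%R; rewrite addrCA !addrA.
  apply: etrans (IH g (y + (b : R) *: coord_vec R d k)%R mg g0) _.
  apply: eq_integral => a _; congr iint; apply/funext => v; congr g.
  by rewrite -!addrA.
apply: etrans FT _; apply: eq_integral => a _; apply: eq_integral => b _.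
congr iint; apply/funext => v; congr g.
by rewrite -!addrA; congr (_ + _)%R; rewrite addrCA !addrA.
Qed.

(* Tonelli makes the [k]-th coordinate the innermost one, so that a shift along it by an
   amount [phi] independent of it is a translation of the inner integral. *)
Lemma iint_shear k g (phi : vec -> R) n y :
  (k < n)%N -> measurable_fun setT (phi : B -> R) ->
  (forall v a, phi (v + a *: coord_vec R d k)%R = phi v) ->
  measurable_fun setT (g : B -> \bar R) -> (forall v, 0 <= g v) ->
  iint n (fun v => g (v + y + phi (v + y) *: coord_vec R d k)%R) =
  iint n (fun v => g (v + y)%R).
Proof.
move=> kn mphi phiE mg g0.
(* For an outermost coordinate above [k], the integration variable only shifts the base point, which
   is why [y] is generalised; the content is the case n = k + 1. *)
elim: n kn y => [//|n IH]; rewrite ltnS leq_eqVlt => /orP[/eqP <-|kn] y; last first.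
  apply: eq_integral => a _ /=.
  have H := IH kn ((a : R) *: coord_vec R d n + y)%R.
  apply: etrans (etrans H _); congr iint; apply/funext => v; first by rewrite !addrA.
  by rewrite addrA.
have E h : measurable_fun setT (h : B -> \bar R) -> (forall v, 0 <= h v) ->
    iint k.+1 (fun v => h (v + y)%R) =
    iint k (fun v => \int[mu]_a h (v + y + a *: coord_vec R d k)%R).
  move=> mh h0; rewrite iint_integralC//=; apply: eq_integral => a _.
  by congr iint; apply/funext => v; congr h; rewrite addrAC.
have mg' : measurable_fun setT ((fun v => g (v + phi v *: coord_vec R d k)%R) : B -> \bar R).
  by apply: (measurableT_comp mg); apply: measurable_shift.
rewrite (E (fun v => g (v + phi v *: coord_vec R d k)%R))// E//.
congr iint; apply/funext => v.
under eq_integral do rewrite phiE -addrA -scalerDl.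
rewrite (@integral_translation _ _ (fun a => g (v + y + a *: coord_vec R d k)%R))//.
by apply: (measurableT_comp mg); apply: (measurable_shift (f := fun=> (v + y)%R)).
Qed.

Lemma coord_vecE (i : 'I_d) : coord_vec R d i = ebasis R i.
Proof. by apply/rowP => j; rewrite !mxE eqxx/= val_eqE; case: eqP. Qed.

Lemma measurable_indic_EFin (A : set vec) : measurable (A : set B) ->
  measurable_fun setT ((fun v => (\1_A v)%:E) : B -> \bar R).
Proof. by move=> mA; apply/measurable_EFinP; exact: measurable_indic. Qed.

Definition shear (i j : 'I_d) (p : R) (v : vec) : vec := (v + (p * v 0 j) *: ebasis R i)%R.

Lemma measurable_shear i j p : measurable_fun setT (shear i j p : B -> B).
Proof.
apply: (@measurable_shift _ B (fun v : vec => p * v 0 j)%R id) => //.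
by apply: measurable_funM => //; exact: measurable_coord.
Qed.

Lemma lebesgue_rV_shear i j p (A : set vec) : i != j -> measurable (A : set B) ->
  lebesgue_rV (shear i j p @^-1` A) = lebesgue_rV A.
Proof.
move=> ij mA; rewrite /lebesgue_rV.
pose phi := fun v : vec => (p * v 0 j)%R.
have H : iint d (fun v => (\1_A (v + 0 + phi (v + 0) *: coord_vec R d i))%R%:E) =
         iint d (fun v => (\1_A (v + 0))%R%:E).
  apply: (@iint_shear i (fun v => (\1_A v)%:E) phi d 0 (ltn_ord i)).
  - by apply: measurable_funM => //; exact: measurable_coord.
  - move=> v a; rewrite coord_vecE /phi !mxE eqxx (eq_sym j) (negbTE ij) /=.
    by rewrite mulr0 addr0.
  - exact: measurable_indic_EFin.
  - by move=> v; rewrite lee_fin.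
apply: etrans (etrans H _); congr iint; apply/funext => v; last by rewrite addr0.
by rewrite coord_vecE !addr0 !indicE.
Qed.

End IteratedIntegral.

(** * Planar rotations as products of shears *)

Section Rotation.
Context {R : realType} {d : nat}.
Local Notation vec := 'rV[R]_d.
Local Notation B := (rVB R d).
Variables (i j : 'I_d) (c s : R).
Hypotheses (ij : i != j) (cs1 : c ^+ 2 + s ^+ 2 = 1) (c1 : 1 + c != 0).

(** For c = cos t and s = sin t the outer shears have the factor - tan (t/2); [c1] excludes the half
    turn, where this factor blows up. *)
Definition rotation : vec -> vec :=
  shear i j (- s / (1 + c)) \o shear j i s \o shear i j (- s / (1 + c)).

Lemma rotationE v : rotation v =
  v + ((c - 1) * v 0 i - s * v 0 j) *: ebasis R i
    + (s * v 0 i + (c - 1) * v 0 j) *: ebasis R j.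
Proof.
have ji : (j == i) = false by rewrite eq_sym (negbTE ij).
have s2 : s ^+ 2 = (1 - c) * (1 + c) by have := cs1; lra.
have e1 : s * (s / (1 + c)) = 1 - c by rewrite mulrA -expr2 s2 mulfK.
apply/rowP => k; rewrite /rotation /shear /= !mxE !eqxx ?(negbTE ij) ?ji /=.
rewrite !(mulr0, mulr1, addr0) -!addrA; congr (_ + _).
have -> : - s / (1 + c) = - (s / (1 + c)) by rewrite mulNr.
(* With p = tan (t/2), everything follows from the half-angle identities s p = 1 - c and (1 + c) p =
   s. *)
set p := s / (1 + c) in e1 *.
have e2 : p + c * p = s by rewrite -[X in X + _]mul1r -mulrDl mulrC divfK.
have e3 a b : s * (a + - p * b) = s * a + (c - 1) * b.
  by transitivity (s * a - (s * p) * b); [ring|rewrite e1; ring].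
have e4 a b : - p * b + - p * (b + s * (a + - p * b)) = (c - 1) * a - s * b.
  transitivity (- (s * p) * a - b * (2 * p - p * (s * p))); first ring.
  by rewrite e1 -e2; ring.
case: (k == i); case: (k == j); rewrite /= !(mulr0, mulr1, addr0, add0r)//.
by rewrite addrCA e4 e3 addrC.
Qed.

Lemma enorm_rotation v : enorm (rotation v) = enorm v.
Proof.
apply/eqP; rewrite -(@eqrXn2 _ 2)// ?enorm_ge0// rotationE.
rewrite -!dotE !(dotDl, dotDr, dotZl, dotZr) !dot_basis ![dot (ebasis _ _) v]dotC.
have ji : (j == i) = false by rewrite eq_sym (negbTE ij).
rewrite !dot_basis !mxE !eqxx ?(negbTE ij) ?ji /=.
apply/eqP; rewrite !(mulr0, mulr1, addr0, add0r).
have s2 : s ^+ 2 = 1 - c ^+ 2 by have := cs1; lra.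
set a := v 0 i; set b := v 0 j.
transitivity (dot v v + (c ^+ 2 + s ^+ 2 - 1) * (a ^+ 2 + b ^+ 2)); first ring.
by rewrite cs1 subrr mul0r addr0.
Qed.

Lemma rotationZ r v : rotation (r *: v) = r *: rotation v.
Proof.
rewrite !rotationE !scalerDr !scalerA !mxE; congr (_ + _ *: _ + _ *: _); ring.
Qed.

Lemma measurable_rotation : measurable_fun setT (rotation : B -> B).
Proof.
have ms i' j' p : measurable_fun setT (shear i' j' p : B -> B).
  exact: measurable_shear.
exact: (measurableT_comp (measurableT_comp (ms _ _ _) (ms _ _ _)) (ms _ _ _)).
Qed.

Lemma lebesgue_rV_rotation (A : set vec) : measurable (A : set B) ->
  lebesgue_rV (rotation @^-1` A) = lebesgue_rV A.
Proof.
move=> mA.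
have ms i' j' p (A' : set vec) : measurable (A' : set B) ->
    measurable (shear i' j' p @^-1` A' : set B).
  by move=> mA'; rewrite -[X in measurable X]setTI; exact: measurable_shear.
have ji : j != i by rewrite eq_sym.
set p := - s / (1 + c).
change (lebesgue_rV (shear i j p @^-1` (shear j i s @^-1` (shear i j p @^-1` A))) =
        lebesgue_rV A).
apply: etrans (lebesgue_rV_shear p ij (ms _ _ _ _ (ms _ _ _ _ mA))) _.
by apply: etrans (lebesgue_rV_shear s ji (ms _ _ _ _ mA)) (lebesgue_rV_shear p ij mA).
Qed.

End Rotation.

(** * Cones over subsets of the sphere *)

Section Sphere.
Context {R : realType} {d : nat}.
Local Notation vec := 'rV[R]_d.
Local Notation B := (rVB R d).

Lemma measurable_enorm : measurable_fun setT ((@enorm R d) : B -> R).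
Proof.
apply: (measurableT_comp (continuous_measurable_fun (@sqrt_continuous R))).
apply: measurable_sum => i; apply: measurable_funX; exact: measurable_coord.
Qed.

(** The polar form replaces the existential by conditions on |v| and v / |v|, from which both
    measurability and rotation invariance can be read off. *)
Lemma cone01E (A : set vec) : cone01 (A `&` unit_sphere (d:=d)) =
  [set v | 0 < enorm v <= 1] `&` (fun v => (enorm v)^-1 *: v) @^-1` A.
Proof.
apply/seteqP; split => v /=.
  move=> [r [a [/andP[r0 r1] [[Aa a1] ->]]]].
  rewrite enormZ a1 mulr1 gtr0_norm// r0 r1; split => //.
  by rewrite scalerA mulVf ?gt_eqF// scale1r.
move=> [/andP[v0 v1] Av]; exists (enorm v), ((enorm v)^-1 *: v).
rewrite v0 v1; split => //; split; last by rewrite scalerA mulfV ?gt_eqF// scale1r.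
split => //; rewrite /unit_sphere/= enormZ gtr0_norm ?invr_gt0// mulVf ?gt_eqF//.
Qed.

Lemma measurable_cone01 (A : set vec) : measurable (A : set B) ->
  measurable (cone01 (A `&` unit_sphere (d:=d)) : set B).
Proof.
move=> mA; rewrite cone01E; apply: measurableI.
  rewrite (_ : mkset _ = (@enorm R d) @^-1` `]0, 1]).
    by rewrite -[X in measurable X]setTI; apply: measurable_enorm.
  by apply/seteqP; split => v /=; rewrite in_itv.
rewrite -[X in measurable X]setTI.
have mn : measurable_fun setT ((fun v => (enorm v)^-1 *: v) : B -> B).
  apply: measurable_fun_rV => i; under eq_fun do rewrite mxE.
  apply: measurable_funM; last exact: measurable_coord.
  under eq_fun do rewrite -powR_inv1 ?enorm_ge0//.
  exact: (measurableT_comp (@measurable_powR R (-1)) measurable_enorm).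
exact: mn.
Qed.

End Sphere.

(** * Expectation of bounded random variables *)

Section Expectation.
Context {d0} {T : measurableType d0} {R : realType}.
Implicit Types (X Y : T -> R).

(** The bound holds at every outcome and the class is closed under sums and products, so
    integrability side conditions become algebra. *)
Definition bounded_rv X := measurable_fun setT X /\ exists M, forall w, `|X w| <= M.

Lemma bounded_integrable (mu : {measure set T -> \bar R}) X :
  (mu setT < +oo)%E -> bounded_rv X -> mu.-integrable setT (EFin \o X).
Proof.
move=> mufin [mX [M XM]]; apply: measurable_bounded_integrable => //.
exists M; split; first exact: num_real.
by move=> N MN w _ /=; apply: le_trans (XM w) (ltW MN).
Qed.

Lemma brv_cst k : bounded_rv (fun=> k).
Proof. by split; [exact: measurable_cst|exists `|k|]. Qed.

Lemma brvD X Y : bounded_rv X -> bounded_rv Y -> bounded_rv (fun w => X w + Y w).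
Proof.
move=> [mX [M XM]] [mY [N YN]]; split; first exact: measurable_funD.
by exists (M + N) => w; rewrite (le_trans (ler_normD _ _))// lerD.
Qed.

Lemma brvM X Y : bounded_rv X -> bounded_rv Y -> bounded_rv (fun w => X w * Y w).
Proof.
move=> [mX [M XM]] [mY [N YN]]; split; first exact: measurable_funM.
by exists (M * N) => w; rewrite normrM ler_pM.
Qed.

Lemma brvZ k X : bounded_rv X -> bounded_rv (fun w => k * X w).
Proof. by move=> bX; apply: brvM => //; exact: brv_cst. Qed.

Lemma brvN X : bounded_rv X -> bounded_rv (fun w => - X w).
Proof.
move=> /(brvZ (-1)); congr bounded_rv.
by apply/funext => w; rewrite mulN1r.
Qed.

Lemma brvB X Y : bounded_rv X -> bounded_rv Y -> bounded_rv (fun w => X w - Y w).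
Proof. by move=> bX bY; apply: brvD => //; exact: brvN. Qed.

Lemma brvX n X : bounded_rv X -> bounded_rv (fun w => X w ^+ n).
Proof.
move=> [mX [M XM]]; split; first exact: measurable_funX.
by exists (M ^+ n) => w; rewrite normrX lerXn2r ?nnegrE ?(le_trans _ (XM w)).
Qed.

Lemma brv_sum (I : Type) (r : seq I) (X : I -> T -> R) :
  (forall i, bounded_rv (X i)) -> bounded_rv (fun w => \sum_(i <- r) X i w).
Proof.
move=> bX; elim: r => [|i r IH].
  by under eq_fun do rewrite big_nil; exact: brv_cst.
by under eq_fun do rewrite big_cons; exact: brvD.
Qed.

Variable P : probability T R.

Definition Ex X : R := \int[P]_w X w.

Lemma brv_integrable X : bounded_rv X -> P.-integrable setT (EFin \o X).
Proof. by apply: bounded_integrable; have := ltry (1 : R); rewrite -(probability_setT P). Qed.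

Lemma EFin_Ex X : bounded_rv X -> (Ex X)%:E = (\int[P]_w (X w)%:E)%E.
Proof.
by move=> bX; rewrite fineK//; apply: integrable_fin_num => //; exact: brv_integrable.
Qed.

Lemma Ex_cst k : Ex (fun=> k) = k.
Proof.
rewrite /Ex Rintegral_cst// [X in fine X](_ : _ = 1%E) ?mulr1//.
exact: probability_setT.
Qed.

Lemma ExD X Y : bounded_rv X -> bounded_rv Y -> Ex (fun w => X w + Y w) = Ex X + Ex Y.
Proof. by move=> bX bY; apply: RintegralD => //; exact: brv_integrable. Qed.

Lemma ExB X Y : bounded_rv X -> bounded_rv Y -> Ex (fun w => X w - Y w) = Ex X - Ex Y.
Proof. by move=> bX bY; apply: RintegralB => //; exact: brv_integrable. Qed.

Lemma ExZ k X : bounded_rv X -> Ex (fun w => k * X w) = k * Ex X.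
Proof. by move=> bX; apply: RintegralZl => //; exact: brv_integrable. Qed.

Lemma ExN X : bounded_rv X -> Ex (fun w => - X w) = - Ex X.
Proof.
move=> bX; rewrite -[RHS]mulN1r -ExZ//.
by congr Ex; apply/funext => w; rewrite mulN1r.
Qed.

Lemma le_Ex X Y : bounded_rv X -> bounded_rv Y -> (forall w, X w <= Y w) -> Ex X <= Ex Y.
Proof. by move=> bX bY XY; apply: le_Rintegral => //; exact: brv_integrable. Qed.

Lemma Ex_ge0 X : (forall w, 0 <= X w) -> 0 <= Ex X.
Proof. by move=> X0; exact: Rintegral_ge0. Qed.

Lemma Ex_sum (I : Type) (r : seq I) (X : I -> T -> R) : (forall i, bounded_rv (X i)) ->
  Ex (fun w => \sum_(i <- r) X i w) = \sum_(i <- r) Ex (X i).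
Proof.
move=> bX; elim: r => [|i r IH].
  by rewrite big_nil; under eq_fun do rewrite big_nil; exact: Ex_cst.
rewrite big_cons -IH -ExD//; last exact: brv_sum.
by congr Ex; apply/funext => w; rewrite big_cons.
Qed.

End Expectation.

(** * Equality of laws and independent pairs *)

Section EqualLaws.
Context {d1 d2 d3} {T1 : measurableType d1} {T2 : measurableType d2} {S : measurableType d3}.
Context {R : realType} (P1 : probability T1 R) (P2 : probability T2 R).

Lemma eq_law_Ex (X : T1 -> S) (Y : T2 -> S) (h : S -> R) :
  measurable_fun setT X -> measurable_fun setT Y ->
  (forall A, measurable A -> P1 (X @^-1` A) = P2 (Y @^-1` A)) ->
  measurable_fun setT h -> bounded_rv (h \o X) -> bounded_rv (h \o Y) ->
  Ex P1 (h \o X) = Ex P2 (h \o Y).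
Proof.
move=> mX mY XY mh bX bY; rewrite /Ex /Rintegral; congr fine.
have mh' : measurable_fun setT (EFin \o h) by exact/measurable_EFinP.
transitivity (\int[pushforward P1 X]_s (EFin \o h) s)%E.
  by rewrite integral_pushforward// ?preimage_setT//; exact: (brv_integrable P1 bX).
transitivity (\int[pushforward P2 Y]_s (EFin \o h) s)%E; last first.
  by rewrite integral_pushforward// ?preimage_setT//; exact: (brv_integrable P2 bY).
by apply: eq_measure_integral => A mA _; exact: XY.
Qed.

End EqualLaws.

Section ProductPiSystem.
Context {d1 d2} {S1 : measurableType d1} {S2 : measurableType d2} {R : realType}.

Lemma eq_measure_prod (m1 m2 : {measure set (S1 * S2) -> \bar R}) :
  (forall A B, measurable A -> measurable B -> m1 (A `*` B) = m2 (A `*` B)) ->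
  (m1 setT < +oo)%E -> forall E, measurable E -> m1 E = m2 E.
Proof.
move=> m12 fin E mE.
pose C : set (set (S1 * S2)) :=
  [set A `*` B | A in measurable & B in measurable].
apply: (measure_unique C (fun=> setT)) => //.
- by rewrite measurable_prod_measurableType.
- move=> _ _ [A1 mA1 [B1 mB1 <-]] [A2 mA2 [B2 mB2 <-]].
  exists (A1 `&` A2); first exact: measurableI.
  by exists (B1 `&` B2); [exact: measurableI|rewrite setXI].
- by move=> _; exists setT => //; exists setT => //; rewrite setXTT.
- by rewrite bigcup_const//; exists 0%N.
- by move=> _ [A mA [B mB <-]]; exact: m12.
Qed.

End ProductPiSystem.

Section Law.
Context {d1 d2} {T : measurableType d1} {S : measurableType d2} {R : realType}.
Variables (P : {measure set T -> \bar R}) (X : T -> S) (mX : measurable_fun setT X).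

Definition law : {measure set S -> \bar R} :=
  measure_function_pushforward__canonical__measure_function_Measure P mX.

Lemma lawE A : law A = P (X @^-1` A). Proof. by []. Qed.

End Law.

Section IndependentPair.
Context {d0 d1 d2} {T : measurableType d0} {S1 : measurableType d1} {S2 : measurableType d2}.
Context {R : realType} (P : probability T R) (X : T -> S1) (Z : T -> S2).
Hypotheses (mX : measurable_fun setT X) (mZ : measurable_fun setT Z).

(** Both sides are finite measures in [E] that agree on rectangles. This joins a fresh variable [Z]
    to the past [X] while keeping independence from a later event [G]. *)
Lemma indep_pair_event (G : set T) : measurable G ->
  (forall A B, measurable A -> measurable B ->
    P (X @^-1` A `&` Z @^-1` B) = P (X @^-1` A) * P (Z @^-1` B))%E ->
  (forall A B, measurable A -> measurable B ->
    P (X @^-1` A `&` Z @^-1` B `&` G) = P (X @^-1` A) * P (Z @^-1` B) * P G)%E ->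
  forall E, measurable E ->
  P ((fun w => (X w, Z w)) @^-1` E `&` G) = (P ((fun w => (X w, Z w)) @^-1` E) * P G)%E.
Proof.
move=> mG XZ XZG E mE.
have mXZ : measurable_fun setT (fun w => (X w, Z w)) by exact: measurable_fun_pair.
have PG : P G \is a fin_num by exact: fin_num_measure.
have PG0 : 0 <= fine (P G) by rewrite fine_ge0.
rewrite -(fineK PG) muleC.
(* The two measures: the law of the pair under P restricted to [G], and P G times the law of the
   pair. *)
change (law (mrestr P mG) mXZ E = mscale (NngNum PG0) (law P mXZ) E).
apply: eq_measure_prod => //.
- move=> A B mA mB; rewrite /= /mscale.
  transitivity (P (X @^-1` A `&` Z @^-1` B `&` G)); first by [].
  by rewrite XZG// -XZ// muleC (fineK PG).
- by rewrite lawE/= /mrestr preimage_setT setTI ltey_eq PG.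
Qed.

Hypothesis XZ : forall A B, measurable A -> measurable B ->
  (P (X @^-1` A `&` Z @^-1` B) = P (X @^-1` A) * P (Z @^-1` B))%E.

(** Stands in for conditioning on [X]: a lower bound on the mean over [Z] with [X] frozen can be
    integrated over [X]. Upper bounds are obtained by applying it to opposites. *)
Lemma indep_le_Ex (Phi : S1 * S2 -> R) (psi : S1 -> R) (M N : R) :
  measurable_fun setT Phi -> (forall w w', `|Phi (X w, Z w')| <= M) ->
  measurable_fun setT psi -> (forall w, `|psi (X w)| <= N) ->
  (forall w, psi (X w) <= Ex P (fun w' => Phi (X w, Z w'))) ->
  Ex P (psi \o X) <= Ex P (fun w => Phi (X w, Z w)).
Proof.
move=> mPhi PhiM mpsi psiN psiPhi.
have mXZ : measurable_fun setT (fun w => (X w, Z w)) by exact: measurable_fun_pair.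
pose XxZ := fun p : T * T => (X p.1, Z p.2).
have mXxZ : measurable_fun setT XxZ.
  apply: measurable_fun_pair; apply: measurableT_comp => //.
have mPhi' : measurable_fun setT (EFin \o Phi) by exact/measurable_EFinP.
have bXZ : bounded_rv (fun w => Phi (X w, Z w)).
  by split; [exact: measurableT_comp|exists M => w; exact: PhiM].
have bXxZ : bounded_rv (Phi \o XxZ).
  by split; [exact: measurableT_comp|exists M => w; exact: PhiM].
have PPT : ((P \x P)%E setT < +oo)%E.
  rewrite -setXTT product_measure1E//.
  by rewrite ltey_eq fin_numM ?fin_num_measure.
have iXxZ := bounded_integrable PPT bXxZ.
(* By independence the joint law of (X, Z) is the image of P x P under [XxZ], so the expectation is
   an iterated integral. *)
have E1 : (\int[P]_w (Phi (X w, Z w))%:E = \int[P]_w \int[P]_w' (Phi (X w, Z w'))%:E)%E.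
  rewrite (integral12_prod_meas1 iXxZ) /=.
  transitivity (\int[pushforward P (fun w => (X w, Z w))]_s (EFin \o Phi) s)%E.
    by rewrite integral_pushforward// ?preimage_setT//; exact: (brv_integrable P bXZ).
  transitivity (\int[pushforward (P \x P)%E XxZ]_s (EFin \o Phi) s)%E; last first.
    by rewrite integral_pushforward// ?preimage_setT.
  apply: eq_measure_integral => E mE _.
  apply: eq_measure_prod => //.
  - move=> A B mA mB; rewrite /= /pushforward.
    transitivity (P (X @^-1` A `&` Z @^-1` B)); first by [].
    have mXA : measurable (X @^-1` A) by rewrite -[X in measurable X]setTI; exact: mX.
    have mZB : measurable (Z @^-1` B) by rewrite -[X in measurable X]setTI; exact: mZ.
    by rewrite XZ// -(product_measure1E P P mXA mZB).
  - by rewrite /= /pushforward preimage_setT ltey_eq fin_num_measure.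
have bpsi : bounded_rv (psi \o X).
  by split; [exact: measurableT_comp|exists N => w; exact: psiN].
rewrite -lee_fin (EFin_Ex P bXZ) (EFin_Ex P bpsi) E1.
apply: le_integral => //; first exact: brv_integrable.
- exact: (integrable_fubini_F iXxZ).
- move=> w _; rewrite /= -EFin_Ex ?lee_fin//.
  split; last by exists M => w'; exact: PhiM.
  by apply: (measurableT_comp mPhi); exact: measurable_fun_pair.
Qed.

End IndependentPair.

(** * Moments of the uniform direction *)

Section UniformSphere.
Context {dO} {Omega : measurableType dO} {R : realType} {d : nat}.
Local Notation vec := 'rV[R]_d.
Local Notation B := (rVB R d).
Local Notation S := (@unit_sphere R d).
Local Notation ball := (@unit_ball R d).
Variables (P : probability Omega R) (u : Omega -> vec).
Hypotheses (mu : forall A, borel_rV A -> measurable (u @^-1` A)).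
Hypothesis u_unif : uniform_on_sphere P u.

Lemma measurable_direction : measurable_fun setT (u : Omega -> B).
Proof. by move=> _ A mA; rewrite setTI; exact: mu. Qed.

Lemma measurable_unit_sphere : measurable (S : set B).
Proof.
rewrite (_ : S = @enorm R d @^-1` [set 1]).
  by rewrite -[X in measurable X]setTI; apply: measurable_enorm.
by [].
Qed.

Let coneTS : cone01 (setT `&` S) = cone01 (S `&` S).
Proof. by rewrite setTI setIid. Qed.

Let direction_setT : fine (lebesgue_rV (cone01 (setT `&` S))) /
  fine (lebesgue_rV ball) = 1.
Proof.
apply: EFin_inj; rewrite -u_unif; last exact: (@measurableT _ B).
by rewrite preimage_setT probability_setT.
Qed.

(** The cone formula gives the sphere and the whole space the same mass, because it only sees the
    part of a set on the sphere. *)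
Lemma direction_unit_ae : P (u @^-1` S) = 1%E.
Proof.
rewrite u_unif; last exact: measurable_unit_sphere.
by rewrite -coneTS direction_setT.
Qed.

(** The volume is never computed: if this real number were 0, division by it would give 0 and [u]
    would have total mass 0. As [fine] sends infinity to 0, finiteness is obtained as well. *)
Lemma ball_volume_neq0 : fine (lebesgue_rV ball) != 0.
Proof.
apply/eqP => v0; have := direction_setT; rewrite v0 invr0 mulr0 => /eqP.
by rewrite eq_sym oner_eq0.
Qed.

Lemma direction_rotation i j c s (A : set vec) :
  i != j -> c ^+ 2 + s ^+ 2 = 1 -> 1 + c != 0 -> measurable (A : set B) ->
  P (u @^-1` (rotation i j c s @^-1` A)) = P (u @^-1` A).
Proof.
move=> ij cs1 c1 mA.
have mrA : measurable (rotation i j c s @^-1` A : set B).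
  by rewrite -[X in measurable X]setTI; exact: measurable_rotation.
rewrite !u_unif//.
rewrite -(lebesgue_rV_rotation c s ij (measurable_cone01 mA)).
congr (fine (lebesgue_rV _) / _)%:E; rewrite !cone01E; apply/seteqP.
by split => v /=; rewrite enorm_rotation// rotationZ.
Qed.

Hypothesis u_unit : forall w, enorm (u w) = 1.

Lemma normr_dot_direction a w : `|dot a (u w)| <= enorm a.
Proof. by rewrite (le_trans (normr_dot_le _ _))// u_unit mulr1. Qed.

Lemma brv_dot_direction a : bounded_rv (fun w => dot a (u w)).
Proof.
split; last by exists (enorm a) => w; exact: normr_dot_direction.
apply: measurable_sum => i; apply: measurable_funM => //.
exact: (measurable_fun_rVP measurable_direction).
Qed.

Lemma brv_direction i : bounded_rv (fun w => u w 0 i).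
Proof.
have := brv_dot_direction (ebasis R i); congr bounded_rv; apply/funext => w.
by rewrite dotC dot_basis.
Qed.

Lemma measurable_dot (a : vec) : measurable_fun setT ((dot a : vec -> R) : B -> R).
Proof.
apply: measurable_sum => i; apply: measurable_funM => //; exact: measurable_coord.
Qed.

Definition dir_moment n a := Ex P (fun w => dot a (u w) ^+ n).

(** The rotation with parameters (c, -s) is the adjoint of that with (c, s), so it can be moved onto
    [u], whose law is invariant. *)
Lemma dir_moment_rotation n i j c s a :
  i != j -> c ^+ 2 + s ^+ 2 = 1 -> 1 + c != 0 ->
  dir_moment n (rotation i j c (- s) a) = dir_moment n a.
Proof.
move=> ij cs1 c1; have cs1' : c ^+ 2 + (- s) ^+ 2 = 1 by rewrite sqrrN.
have H v : dot (rotation i j c (- s) a) v = dot a (rotation i j c s v).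
  rewrite !rotationE// !(dotDl, dotDr, dotZl, dotZr) !dot_basis.
  by rewrite ![dot (ebasis _ _) v]dotC !dot_basis; ring.
rewrite /dir_moment; under eq_fun do rewrite H.
have mr : measurable_fun setT ((fun w => rotation i j c s (u w)) : Omega -> B).
  exact: (measurableT_comp (measurable_rotation i j c s) measurable_direction).
apply: (@eq_law_Ex _ _ _ _ _ B _ P P (fun w => rotation i j c s (u w)) u
  (fun v => dot a v ^+ n) mr measurable_direction).
- by move=> A mA; exact: direction_rotation.
- by apply: measurable_funX; exact: measurable_dot.
- have bX : bounded_rv (fun w => dot (rotation i j c (- s) a) (u w) ^+ n).
    by apply: brvX; exact: brv_dot_direction.
  by move: bX; congr bounded_rv; apply/funext => w; rewrite H.
- by apply: brvX; exact: brv_dot_direction.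
Qed.

(** Coordinates of [a] other than [i0] are rotated away one at a time, from the last downwards: [k]
    bounds those that may still be nonzero. The exponent is even, so the sign of the surviving
    coordinate does not matter. *)
Lemma dir_moment_basis n i0 a :
  dir_moment n.*2 a = enorm a ^+ n.*2 * dir_moment n.*2 (ebasis R i0).
Proof.
have [k] : exists k : nat, forall j : 'I_d, j != i0 -> (k <= j)%N -> a 0 j = 0.
  by exists d => j _; rewrite leqNgt ltn_ord.
elim: k a => [|k IH] a ak.
  have aE : a = a 0 i0 *: ebasis R i0.
    apply/rowP => j; rewrite !mxE eqxx/=; case: eqVneq => [->|ji]; first by rewrite mulr1.
    by rewrite mulr0 ak.
  rewrite {1}aE /dir_moment.
  under eq_fun do rewrite dotZl exprMn.
  rewrite ExZ; last by apply: brvX; exact: brv_dot_direction.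
  congr (_ * _); rewrite aE enormZ enorm_basis mulr1 mxE mxE !eqxx mulr1.
  by rewrite -!mul2n !exprM real_normK ?num_real.
have [kd|dk] := ltnP k d; last first.
  apply: IH => j ji kj.
  by have := leq_ltn_trans (leq_trans dk kj) (ltn_ord j); rewrite ltnn.
pose j := Ordinal kd.
have [ji|ji] := eqVneq j i0.
  apply: IH => l li kl; apply: ak => //; rewrite ltn_neqAle kl andbT.
  by apply: contra li => /eqP kl'; rewrite -ji; apply/eqP/val_inj.
have [aj0|aj0] := eqVneq (a 0 j) 0.
  apply: IH => l li kl; have [->//|lj] := eqVneq l j; apply: ak => //.
  rewrite ltn_neqAle kl andbT; apply: contra lj => /eqP kl'; exact/eqP/val_inj.
pose r2 := a 0 i0 ^+ 2 + a 0 j ^+ 2.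
have r20 : 0 < r2 by rewrite ltr_wpDl ?sqr_ge0// exprn_even_gt0.
pose r := Num.sqrt r2.
have r0 : 0 < r by rewrite sqrtr_gt0.
have rr : r ^+ 2 = r2 by rewrite sqr_sqrtr// ltW.
(* The rotation with parameters (c, -s) sends (a_i0, a_j) to (r, 0). Since a_j is not 0, neither is
   s, hence c is not -1. *)
pose c := a 0 i0 / r; pose s := a 0 j / r.
have cs1 : c ^+ 2 + s ^+ 2 = 1.
  by rewrite /c /s !expr_div_n -mulrDl -/r2 rr divff// gt_eqF.
have s0 : s != 0 by rewrite mulf_neq0 ?invr_eq0// gt_eqF.
have c1 : 1 + c != 0.
  apply: contra s0 => /eqP c1; rewrite -sqrf_eq0.
  have cN1 : c = -1 by lra.
  by apply/eqP; move: cs1; rewrite cN1; lra.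
have ij : i0 != j by rewrite eq_sym.
have cs1N : c ^+ 2 + (- s) ^+ 2 = 1 by rewrite sqrrN.
rewrite -(dir_moment_rotation _ _ ij cs1 c1) -(enorm_rotation ij cs1N c1 a).
  apply: IH => l li kl.
  rewrite rotationE// !mxE eqxx (negbTE li) /= mulr0 addr0.
  have [->|lj] := eqVneq l j; last first.
    rewrite mulr0 addr0 ak// ltn_neqAle kl andbT.
    by apply: contra lj => /eqP kl'; exact/eqP/val_inj.
  have : c * a 0 j - s * a 0 i0 = 0 by rewrite /c /s; ring.
  by rewrite ?eqxx /= ?mulr1; lra.

Qed.

Variable i0 : 'I_d.
Definition mom n := dir_moment n (ebasis R i0).

Lemma Ex_coord n i : Ex P (fun w => u w 0 i ^+ n.*2) = mom n.*2.
Proof.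
transitivity (dir_moment n.*2 (ebasis R i)).
  by congr Ex; apply/funext => w; rewrite dotC dot_basis.
by rewrite (dir_moment_basis n i0) enorm_basis expr1n mul1r.
Qed.

Lemma mom_ge0 n : 0 <= mom n.*2.
Proof.
by apply: Ex_ge0 => w; rewrite -mul2n exprM exprn_ge0// sqr_ge0.
Qed.

Lemma mom_le1 n : mom n.*2 <= 1.
Proof.
rewrite -[leRHS](Ex_cst P) -(Ex_coord _ i0); apply: le_Ex.
- by apply: brvX; exact: brv_direction.
- exact: brv_cst.
- move=> w; rewrite -mul2n exprM exprn_ile1 ?sqr_ge0//.
  rewrite -real_normK ?num_real// exprn_ile1//.
  by rewrite -(u_unit w) enorm_coord.
Qed.

Lemma sum_sqr_direction w : \sum_i u w 0 i ^+ 2 = 1.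
Proof. by rewrite -sqr_enorm u_unit expr1n. Qed.

Lemma mom2 : d%:R * mom 2 = 1.
Proof.
rewrite -[RHS](Ex_cst P) mulr_natl -[in LHS](card_ord d) -sumr_const.
under eq_bigr => i _ do rewrite -(Ex_coord 1 i).
rewrite -Ex_sum; last by move=> i; apply: brvX; exact: brv_direction.
by congr Ex; apply/funext => w; rewrite sum_sqr_direction.
Qed.

Lemma Ex_dot_sqr a : Ex P (fun w => dot a (u w) ^+ 2) = enorm a ^+ 2 / d%:R.
Proof.
rewrite [LHS](dir_moment_basis 1 i0 a) -/(mom 2); congr (_ * _).
have d0 : d%:R != 0 :> R by rewrite pnatr_eq0 -lt0n (leq_trans _ (ltn_ord i0)).
by apply: (mulfI d0); rewrite mom2 divff.
Qed.

(** Polarisation of [Ex_dot_sqr]: d times the covariance of the direction is the identity. *)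
Lemma Ex_dot_dot a b : Ex P (fun w => dot a (u w) * dot b (u w)) = dot a b / d%:R.
Proof.
have bd x := brv_dot_direction x.
have E2 : Ex P (fun w => dot (a + b) (u w) ^+ 2) =
    Ex P (fun w => dot a (u w) ^+ 2) + 2 * Ex P (fun w => dot a (u w) * dot b (u w))
    + Ex P (fun w => dot b (u w) ^+ 2).
  rewrite -ExZ; last exact: brvM.
  rewrite -ExD; [|exact: brvX|by apply: brvZ; exact: brvM].
  rewrite -ExD; [|by apply: brvD; [exact: brvX|apply: brvZ; exact: brvM]|exact: brvX].
  by congr Ex; apply/funext => w; rewrite dotDl; ring.
move: E2; rewrite !Ex_dot_sqr -!dotE dotDl !dotDr [dot b a]dotC.
by move=> E2; lra.
Qed.

(* Invariance gives E (u_i +- u_j)^N = 2^(N/2) m_N, so the even part of the binomial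
   expansion bounds m_N by mixed moments, which sum to m_(N-2) since |u| = 1. *)
Lemma mom_rec n K : 0 <= K -> (forall x y : R, (x + y) ^+ n.+2.*2 + (x - y) ^+ n.+2.*2 <=
    2 * (x ^+ n.+2.*2 + y ^+ n.+2.*2)
    + K * (x ^+ n.+1.*2 * y ^+ 2 + x ^+ 2 * y ^+ n.+1.*2)) ->
  (2 ^+ n.+2 - 2) * (d%:R - 1) * mom n.+2.*2 <= K * mom n.+1.*2.
Proof.
move=> K0 xyK; set N := n.+2.*2 in xyK *; set N' := n.+1.*2 in xyK *.
have d0 : 0 < d%:R :> R by rewrite ltr0n (leq_trans _ (ltn_ord i0)).
have bu i m : bounded_rv (fun w => u w 0 i ^+ m) by apply: brvX; exact: brv_direction.
pose q i j := Ex P (fun w => u w 0 i ^+ N' * u w 0 j ^+ 2).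
have bq i j : bounded_rv (fun w => u w 0 i ^+ N' * u w 0 j ^+ 2) by exact: brvM.
have q0 i j : 0 <= q i j.
  by apply: Ex_ge0 => w; rewrite mulr_ge0 ?sqr_ge0// /N' -mul2n exprM exprn_ge0 ?sqr_ge0.
have sumq i : \sum_j q i j = mom N'.
  rewrite -Ex_sum// -(Ex_coord _ i); congr Ex; apply/funext => w.
  by rewrite -mulr_sumr sum_sqr_direction mulr1.
have pm i j e : j != i -> e ^+ 2 = 1 ->
    dir_moment N (ebasis R i + e *: ebasis R j) = 2 ^+ n.+2 * mom N.
  move=> ji e1; rewrite (dir_moment_basis _ i0) -mul2n exprM -dotE.
  rewrite !(dotDl, dotDr, dotZl, dotZr) !dot_basis !mxE !eqxx.
  have ij : (i == j) = false by rewrite eq_sym (negbTE ji).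
  rewrite ij (negbTE ji) /= ?(mulr0, add0r, addr0, mulr1) -?expr2 ?e1.
  by rewrite mul2n (_ : 1 + 1 = 2 :> R).
have main i j : j != i -> 2 * (2 ^+ n.+2 - 2) * mom N <= K * (q i j + q j i).
  move=> ji.
  have b1 e : bounded_rv (fun w => dot (ebasis R i + e *: ebasis R j) (u w) ^+ N).
    by apply: brvX; exact: brv_dot_direction.
  have b2 := brvD (bq i j) (bq j i).
  have b3 := brvD (bu i N) (bu j N).
  have : dir_moment N (ebasis R i + 1 *: ebasis R j)
      + dir_moment N (ebasis R i + (- 1) *: ebasis R j) <=
      2 * (mom N + mom N) + K * (q i j + q j i).
    rewrite -{1}(Ex_coord _ i) -(Ex_coord _ j) -!ExD// -!ExZ// -ExD; do ?exact: brvZ.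
    apply: le_Ex; [exact: brvD|by apply: brvD; exact: brvZ|move=> w].
    rewrite !dotDl !dotZl ![dot (ebasis _ _) _]dotC !dot_basis mul1r mulN1r.
    by apply: le_trans (xyK _ _) _; rewrite (mulrC (_ ^+ 2)).
  by rewrite !pm ?expr1n ?sqrrN ?expr1n//; lra.
(* [main] is summed over all ordered pairs. The diagonal, where the left side is set to 0, is added
   on the right so that the mixed moments sum completely by [sumq]. *)
have : \sum_(i < d) \sum_(j < d) (2 * (2 ^+ n.+2 - 2) * mom N) * (j != i)%:R <=
       \sum_(i < d) \sum_(j < d) K * (q i j + q j i).
  apply: ler_sum => i _; apply: ler_sum => j _; case: eqVneq => [->|ji].
    by rewrite mulr0 mulr_ge0// addr_ge0.
  by rewrite mulr1 main.
have -> : \sum_(i < d) \sum_(j < d) K * (q i j + q j i) = 2 * K * (d%:R * mom N').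
  under eq_bigr do rewrite -mulr_sumr big_split/=.
  rewrite -mulr_sumr big_split/= [X in _ + X]exchange_big/=.
  by under eq_bigr do rewrite sumq; rewrite sumr_const card_ord -mulr_natl; ring.
have -> : \sum_(i < d) \sum_(j < d) (2 * (2 ^+ n.+2 - 2) * mom N) * (j != i)%:R =
    2 * d%:R * ((2 ^+ n.+2 - 2) * (d%:R - 1) * mom N).
  transitivity (\sum_(i < d) (2 * (2 ^+ n.+2 - 2) * mom N) * (d%:R - 1)).
    apply: eq_bigr => i _; rewrite -mulr_sumr; congr (_ * _).
    rewrite -[in RHS](card_ord d) -sum1_card natr_sum (bigD1 i)//= [in RHS](bigD1 i)//=.
    rewrite eqxx add0r addrC addrK; apply: eq_bigr => j ->; exact: erefl.
  by rewrite sumr_const card_ord -mulr_natl; ring.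
move=> h; rewrite -(ler_pM2l (x := 2 * d%:R)) ?mulr_gt0//; lra.
Qed.

(** The constants 6 and 30 are read off the even binomial expansions. For exponent 8 the middle term
    140 x^4 y^4 is at most 70 (x^6 y^2 + x^2 y^6), whence 56 + 70 = 126. For d >= 2 one has d - 1 >=
    d/2, so the recursions lose factors 6, 10 and 18, with product 1080. For d = 1 the factor d - 1
    vanishes and [mom_le1] is used instead. *)
Lemma mom8 : d%:R ^+ 4 * mom 8 <= 1080.
Proof.
have sq_ge (x y : R) k : 0 <= (x - y) ^+ 2 * (x ^+ k) ^+ 2 by rewrite mulr_ge0 ?sqr_ge0.
have h4 : (2 ^+ 2 - 2) * (d%:R - 1) * mom 4 <= 6 * mom 2.
  by apply: (@mom_rec 0) => // x y; rewrite le_eqVlt; apply/orP; left; apply/eqP => /=; ring.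
have h6 : (2 ^+ 3 - 2) * (d%:R - 1) * mom 6 <= 30 * mom 4.
  by apply: (@mom_rec 1) => // x y; rewrite le_eqVlt; apply/orP; left; apply/eqP => /=; ring.
have h8 : (2 ^+ 4 - 2) * (d%:R - 1) * mom 8 <= 126 * mom 6.
  apply: (@mom_rec 2) => // x y /=; rewrite -subr_ge0.
  have -> : forall z, z = 70 * (x * y * (x ^+ 2 - y ^+ 2)) ^+ 2 -> 0 <= z.
    by move=> z ->; rewrite mulr_ge0// sqr_ge0.
  by [].
  by ring.
have m2 := mom2; have m8 := mom_le1 4.
have [m40 m60 m80] : [/\ 0 <= mom 4, 0 <= mom 6 & 0 <= mom 8].
  by split; [exact: (mom_ge0 2)|exact: (mom_ge0 3)|exact: (mom_ge0 4)].
have [d1|d2] := leqP d 1.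
  have -> : d = 1%N by apply/eqP; rewrite eqn_leq d1 (leq_trans _ (ltn_ord i0)).
  by rewrite expr1n mul1r (le_trans m8)// ler1n.
set D : R := d%:R in h4 h6 h8 m2 *.
have D2 : 2 <= D by rewrite ler_nat.
have k8 : D * mom 8 <= 18 * mom 6 by nra.
have k6 : D * mom 6 <= 10 * mom 4 by nra.
have k4 : D * mom 4 <= 6 * mom 2 by nra.
have D0 : 0 <= D by lra.
have := ler_wpM2l (exprn_ge0 3 D0) k8.
have := ler_wpM2l (exprn_ge0 2 D0) k6.
have := ler_wpM2l D0 k4.
move=> l4 l6 l8.
have -> : D ^+ 4 * mom 8 = D ^+ 3 * (D * mom 8) by ring.
lra.
Qed.

Lemma Ex_dot8 a : Ex P (fun w => dot a (u w) ^+ 8) <= 1080 * enorm a ^+ 8 / d%:R ^+ 4.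
Proof.
have d0 : 0 < d%:R ^+ 4 :> R.
  by rewrite exprn_gt0// ltr0n (leq_trans _ (ltn_ord i0)).
have -> : Ex P (fun w => dot a (u w) ^+ 8) = enorm a ^+ 8 * mom 8.
  exact: (dir_moment_basis 4 i0 a).
rewrite ler_pdivlMr// [leRHS]mulrC -mulrA ler_wpM2l ?exprn_ge0 ?enorm_ge0//.
by rewrite mulrC mom8.
Qed.

End UniformSphere.

(** * The objective, its gradient and its smoothing *)

Section Smoothness.
Context {R : realType} {d : nat}.
Local Notation vec := 'rV[R]_d.
Implicit Types (h F : vec -> R) (g : vec -> vec) (x y v : vec).

Lemma ler_of_scaled (a b c : R) : (forall s, 0 < s -> a <= b + s * c) -> a <= b.
Proof.
move=> h; have [//|ba] := leP a b.
have c0 : 0 < `|c| + 1 by rewrite ltr_wpDl.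
have s0 : 0 < (a - b) / 2 / (`|c| + 1) by rewrite !divr_gt0// subr_gt0.
have := h _ s0; set s := _ / (`|c| + 1) => hs.
have : s * c <= (a - b) / 2.
  rewrite (le_trans (y := s * (`|c| + 1)))//; last by rewrite /s divfK// gt_eqF.
  by rewrite ler_wpM2l// ?ltW//; have := ler_norm c; lra.
by lra.
Qed.

(** Unlike differentiability, this two-sided expansion passes directly through the expectation over
    samples. The constant is L instead of L/2 because the expansion comes from the mean value
    theorem. *)
Definition quad_approx h g (L : R) :=
  forall x y, `|h y - h x - dot (g x) (y - x)| <= L * enorm (y - x) ^+ 2.

Lemma derive_dot_grad h x v : differentiable h x -> 'D_v h x = dot (grad h x) v.
Proof.
move=> dh; rewrite deriveE// {1}[v]row_sum_delta linear_sum/= /dot.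
by apply: eq_bigr => i _; rewrite linearZ/= mxE deriveE// mulrC.
Qed.

Lemma lipschitz_grad_quad_approx h (L : R) : (forall x, differentiable h x) ->
  (forall x y, enorm (grad h x - grad h y) <= L * enorm (x - y)) ->
  quad_approx h (grad h) L.
Proof.
move=> dh Lh x y; set v := y - x.
pose phi := fun t : R => h (x + t *: v).
have dphi t : is_derive t (1 : R) phi (dot (grad h (x + t *: v)) v).
  have E : (fun s : R => s^-1 *: ((phi \o shift t) (s *: (1 : R)) - phi t)) =
           (fun s : R => s^-1 *: ((h \o shift (x + t *: v)) (s *: v) - h (x + t *: v))).
    apply/funext => s; rewrite /phi /= /shift/= scalerDl addrCA -/phi.
    by rewrite [s *: 1]mulr1.
  have hv : derivable h (x + t *: v) v by exact: diff_derivable.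
  split; first by rewrite /derivable E.
  by rewrite /derive E -derive_dot_grad.
have [c c01 ->] : exists2 c, c \in `]0, 1[%R & h y - h x = dot (grad h (x + c *: v)) v.
  have phic : {within `[0, 1], continuous phi}.
    by apply: derivable_within_continuous => t _; exact: ex_derive.
  have [c c01 e] := MVT ltr01 (fun t _ => dphi t) phic.
  exists c => //; move: e; rewrite /phi scale1r scale0r addr0 subr0 mulr1 => <-.
  by congr (h _ - _); rewrite /v addrC subrK.
rewrite -dotBl; apply: le_trans (normr_dot_le _ _) _.
rewrite expr2 mulrA ler_wpM2r ?enorm_ge0//.
apply: le_trans (Lh _ _) _; rewrite addrC addKr enormZ.
have L0 : 0 <= L * enorm v.
  by have := Lh y x; rewrite -/v; apply: le_trans; exact: enorm_ge0.
move: c01; rewrite in_itv/= => /andP[c0 c1].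
by rewrite mulrCA (gtr0_norm c0) -[leRHS]mul1r ler_wpM2r// ltW.
Qed.

(** The difference quotient along a basis vector is within L |s| of the coordinate of [g]. This
    identifies the gradient of the expected objective without differentiating under the integral. *)
Lemma quad_approx_grad F g (L : R) : quad_approx F g L -> grad F = g.
Proof.
move=> FgL; apply/funext => x; apply/rowP => i; rewrite mxE.
apply/cvg_lim => //; apply/cvgrPdist_le => e e0.
near=> s.
have s0 : s != 0 by near: s; exact: nbhs_dnbhs_neq.
rewrite distrC; have := FgL x (s *: ebasis R i + x).
rewrite addrK dotZr dot_basis enormZ enorm_basis mulr1 real_normK ?num_real// => h.
rewrite /= /shift/=.
have -> : s^-1 *: (F (s *: ebasis R i + x) - F x) - g x 0 i =
          s^-1 * (F (s *: ebasis R i + x) - F x - s * g x 0 i).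
  by rewrite mulrBr mulKf.
rewrite normrM normfV ler_pdivrMl ?normr_gt0//.
apply: le_trans h _.
have -> : s ^+ 2 = `|s| * `|s| by rewrite -expr2 real_normK ?num_real.
rewrite mulrCA ler_wpM2l//.
have L0 : L <= `|L| + 1 by have := ler_norm L; lra.
apply: le_trans (ler_wpM2r (normr_ge0 s) L0) _.
have L1 : 0 < `|L| + 1 by rewrite ltr_wpDl.
rewrite -ler_pdivlMl//; near: s.
apply: dnbhs0_le; rewrite mulr_gt0 ?invr_gt0//.
Unshelve. all: by end_near.
Qed.

(** Comparing the two bounds along s v and letting s tend to 0 bounds <g x, v> by Lc |v|; then v is
    taken to be g x. *)
Lemma quad_approx_lipschitz h g (L Lc : R) : 0 <= Lc -> quad_approx h g L ->
  (forall x y, `|h x - h y| <= Lc * enorm (x - y)) -> forall x, enorm (g x) <= Lc.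
Proof.
move=> Lc0 hg hLc x.
have key v : dot (g x) v <= Lc * enorm v.
  apply: (@ler_of_scaled _ _ (L * enorm v ^+ 2)) => s s0.
  have := hg x (s *: v + x); have := hLc (s *: v + x) x.
  rewrite addrK dotZr enormZ (gtr0_norm s0) !ler_norml => /andP[_ h1] /andP[h2 _].
  rewrite -(ler_pM2l s0); move: h1 h2; rewrite exprMn => h1 h2.
  have -> : s * (Lc * enorm v + s * (L * enorm v ^+ 2)) =
    Lc * (s * enorm v) + L * (s ^+ 2 * enorm v ^+ 2) by ring.
  by lra.
have := key (g x); rewrite dotE expr2.
have := enorm_ge0 (g x); rewrite le_eqVlt => /orP[/eqP <- //|g0].
by rewrite ler_pM2r.
Qed.

End Smoothness.

(** * Joint measurability of functions Lipschitz in one variable *)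

Section Caratheodory.
Context {R : realType} {d : nat}.
Local Notation vec := 'rV[R]_d.
Local Notation B := (rVB R d).

Lemma enorm_rat_vec_dense (x : vec) (e : R) : 0 < e ->
  exists q, enorm (x - rat_vec q) < e.
Proof.
move=> e0; have d1 : 0 < d%:R + 1 :> R by rewrite ltr_wpDl.
have [q qx] := @rat_vec_dense R d x (e / (d%:R + 1)) ltac:(by rewrite divr_gt0).
exists q; apply: le_lt_trans (enorm_le_mx_norm _) _.
move: qx; rewrite mx_norm_ball/= /ball_ => h.
have [->|dn0] := eqVneq (d%:R : R) 0; first by rewrite mul0r.
have d0 : 0 < d%:R :> R by rewrite lt_def dn0 ler0n.
apply: lt_trans (_ : d%:R * (e / (d%:R + 1)) < _); first by rewrite ltr_pM2l.
by rewrite mulrCA -[ltRHS]mulr1 ltr_pM2l// ltr_pdivrMr// mul1r ltrDl.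
Qed.

(* McShane: a Lipschitz function is the infimum over rational q of h q + L |x - q|. *)
Lemma measurable_lipschitz_param dX (Xi : measurableType dX) (h : vec -> Xi -> R) (L : R) : 0 <= L ->
  (forall x, measurable_fun setT (h x)) ->
  (forall z x y, `|h x z - h y z| <= L * enorm (x - y)) ->
  measurable_fun setT ((fun p => h p.1 p.2) : B * Xi -> R).
Proof.
move=> L0 mh hL; apply: measurable_fun_ltP => r.
rewrite (_ : mkset _ = \bigcup_(q in [set: 'rV[rat]_d])
  [set p : B * Xi | h (rat_vec q) p.2 + L * enorm ((p.1 : vec) - rat_vec q) < r]).
  apply: countable_bigcupT_measurable => [|q]; first exact: countableP.
  apply: measurable_lt; apply: measurable_funD.
    exact: (measurableT_comp (mh _) measurable_snd).
  apply: measurable_funM => //.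
  apply: (measurableT_comp (@measurable_enorm R d)).
  apply: measurable_fun_rV => i; under eq_fun do rewrite !mxE.
  apply: measurable_funB => //.
  exact: (measurable_fun_rVP (@measurable_fst _ _ B Xi)).
apply/seteqP; split => [[x z] /= hr|[x z] /= [q _] /= hr].
  (* The point [q] is chosen so that 2 L |x - q| is below the gap r - h x z: L |x - q| is spent in
     moving h from x to q, and once more by the McShane term. *)
  have L1 : 0 < 2 * L + 1 by lra.
  have e0 : 0 < (r - h x z) / (2 * L + 1) by rewrite divr_gt0// subr_gt0.
  have [q qx] := enorm_rat_vec_dense x e0.
  exists q => //=; have := hL z x (rat_vec q); rewrite ler_norml => /andP[h1 _].
  move: qx; rewrite ltr_pdivlMr// => qx.
  have := enorm_ge0 (x - rat_vec q); nra.
by have := hL z x (rat_vec q); rewrite ler_norml => /andP[_ h1]; lra.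
Qed.

Lemma measurable_lipschitz (h : vec -> R) (L : R) : 0 <= L ->
  (forall x y, `|h x - h y| <= L * enorm (x - y)) -> measurable_fun setT (h : B -> R).
Proof.
move=> L0 hL.
pose h2 := fun (x : vec) (_ : measurableTypeR R) => h x.
have mh : measurable_fun setT ((fun p => h2 p.1 p.2) : B * measurableTypeR R -> R).
  apply: (measurable_lipschitz_param (h := h2) L0).
    by move=> x; exact: measurable_cst.
  by move=> z; exact: hL.
have m0 : measurable_fun setT ((fun=> 0) : B -> measurableTypeR R).
  exact: measurable_cst.
exact: (measurableT_comp mh (measurable_fun_pair (@measurable_id _ B setT) m0)).
Qed.

End Caratheodory.

(** * The expected objective and its gradient *)

Section Objective.
Context {dX} {Xi : measurableType dX} {R : realType} {d : nat}.
Local Notation vec := 'rV[R]_d.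
Local Notation B := (rVB R d).
Variables (Pxi : probability Xi R) (f : vec -> Xi -> R) (Lg Lc : R).
Hypotheses (Lg0 : 0 <= Lg) (Lc0 : 0 <= Lc).
Hypothesis f_int : forall x, Pxi.-integrable setT (fun z => (f x z)%:E).
Hypothesis f_diff : forall z x, differentiable (fun y => f y z) x.
Hypothesis f_Lg : forall z x y,
  enorm (grad (fun w => f w z) x - grad (fun w => f w z) y) <= Lg * enorm (x - y).
Hypothesis f_Lc : forall z x y, `|f x z - f y z| <= Lc * enorm (x - y).

Definition gradf x z := grad (fun w => f w z) x.
Definition fobj x := fine (\int[Pxi]_(z in setT) (f x z)%:E)%E.
Definition gobj x : vec := \row_i Ex Pxi (fun z => gradf x z 0 i).

Lemma f_quad z : quad_approx (fun x => f x z) (fun x => gradf x z) Lg.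
Proof. by apply: lipschitz_grad_quad_approx; [exact: f_diff|exact: f_Lg]. Qed.

Lemma enorm_gradf x z : enorm (gradf x z) <= Lc.
Proof. exact: (quad_approx_lipschitz Lc0 (f_quad z) (f_Lc z)). Qed.

Lemma measurable_sample x : measurable_fun setT (f x).
Proof. by apply/measurable_EFinP; exact: (measurable_int _ (f_int x)). Qed.

Lemma measurable_f : measurable_fun setT ((fun p => f p.1 p.2) : B * Xi -> R).
Proof. exact: (measurable_lipschitz_param Lc0 measurable_sample f_Lc). Qed.

Lemma measurable_f_comp dT (T : measurableType dT) (x : T -> vec) (z : T -> Xi) :
  measurable_fun setT (x : T -> B) -> measurable_fun setT z ->
  measurable_fun setT (fun t => f (x t) (z t)).
Proof.
by move=> mx mz; exact: (measurableT_comp measurable_f (measurable_fun_pair mx mz)).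
Qed.

(** The coordinate is the limit of difference quotients with steps 1/(n+1), which are measurable
    because [f] is jointly measurable; [f_quad] gives the convergence. *)
Lemma measurable_gradf dT (T : measurableType dT) (x : T -> vec) (z : T -> Xi) i :
  measurable_fun setT (x : T -> B) -> measurable_fun setT z ->
  measurable_fun setT (fun t => gradf (x t) (z t) 0 i).
Proof.
move=> mx mz.
apply: (@measurable_fun_cvg _ _ _ setT
  (fun n t => n.+1%:R * (f (x t + n.+1%:R^-1 *: ebasis R i) (z t) - f (x t) (z t)))).
  move=> n; apply: measurable_funM => //; apply: measurable_funB.
    by apply: measurable_f_comp => //; apply: measurable_shift.
  exact: measurable_f_comp.
have L1 : 0 < Lg + 1 by rewrite ltr_wpDl.
move=> t _; apply/cvgrPdist_le => e e0.
have eL : 0 < (Lg + 1)^-1 * e by rewrite mulr_gt0 ?invr_gt0.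
near=> n.
have n0 : 0 < n.+1%:R :> R by [].
have := f_quad (z t) (x t) (x t + n.+1%:R^-1 *: ebasis R i).
rewrite [x t + _]addrC addrK dotZr dot_basis enormZ enorm_basis mulr1.
set a := f _ _ - _; set b := gradf _ _ _ _ => h; rewrite distrC.
have -> : n.+1%:R * a - b = n.+1%:R * (a - n.+1%:R^-1 * b).
  by rewrite [RHS]mulrBr mulVKf// gt_eqF.
rewrite normrM gtr0_norm// -ler_pdivlMl//; apply: le_trans h _.
rewrite gtr0_norm ?invr_gt0// expr2 mulrCA ler_wpM2l ?invr_ge0//.
apply: (@le_trans _ _ ((Lg + 1) * n.+1%:R^-1)).
  by rewrite ler_wpM2r ?invr_ge0// lerDl.
rewrite -ler_pdivlMl// ltW//; near: n.
exact: (near_infty_natSinv_lt (PosNum eL)).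
Unshelve. all: by end_near.
Qed.

Lemma brv_gradf x i : bounded_rv (fun z => gradf x z 0 i).
Proof.
split; last by exists Lc => z; exact: le_trans (enorm_coord _ _) (enorm_gradf x z).
by apply: measurable_gradf => //; exact: (@measurable_cst _ _ _ B).
Qed.

Lemma dot_gobj x b : dot (gobj x) b = Ex Pxi (fun z => dot (gradf x z) b).
Proof.
rewrite /dot Ex_sum => [|i]; last first.
  by apply: brvM; [exact: brv_gradf|exact: brv_cst].
apply: eq_bigr => i _; rewrite mxE mulrC -ExZ; last exact: brv_gradf.
by congr Ex; apply/funext => z; rewrite mulrC.
Qed.

Lemma brv_dot_gradf x b : bounded_rv (fun z => dot (gradf x z) b).
Proof. by apply: brv_sum => i; apply: brvM; [exact: brv_gradf|exact: brv_cst]. Qed.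

Lemma fobjB x y : fobj y - fobj x = Ex Pxi (fun z => f y z - f x z).
Proof. by rewrite /Ex RintegralB//; exact: f_int. Qed.

Lemma brv_diff x y : bounded_rv (fun z => f y z - f x z).
Proof.
split; last by exists (Lc * enorm (y - x)) => z; exact: f_Lc.
by apply: measurable_funB; exact: measurable_sample.
Qed.

Lemma normr_Ex_le dT (T : measurableType dT) (P : probability T R) (X : T -> R) M :
  bounded_rv X -> (forall w, `|X w| <= M) -> `|Ex P X| <= M.
Proof.
move=> bX XM; rewrite ler_norml -(Ex_cst P M) -(ExN P (brv_cst M)); apply/andP; split.
  by apply: le_Ex => // [|w]; [exact: brv_cst|have := XM w; rewrite ler_norml => /andP[]].
by apply: le_Ex => // [|w]; [exact: brv_cst|have := XM w; rewrite ler_norml => /andP[]].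
Qed.

Lemma fobj_lipschitz x y : `|fobj x - fobj y| <= Lc * enorm (x - y).
Proof. by rewrite fobjB; apply: normr_Ex_le => // ; exact: brv_diff. Qed.

Lemma fobj_quad : quad_approx fobj gobj Lg.
Proof.
move=> x y; rewrite fobjB dot_gobj -ExB; [|exact: brv_diff|exact: brv_dot_gradf].
apply: normr_Ex_le => [|z]; last exact: f_quad.
by apply: brvB; [exact: brv_diff|exact: brv_dot_gradf].
Qed.

Lemma grad_fobj : grad fobj = gobj.
Proof. exact: quad_approx_grad fobj_quad. Qed.

Lemma enorm_gobj x : enorm (gobj x) <= Lc.
Proof. exact: (quad_approx_lipschitz Lc0 fobj_quad fobj_lipschitz). Qed.

(** Pairing the difference v with itself gives |v|^2 <= Lg |x - y| |v| under the expectation; then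
    |v| is cancelled. *)
Lemma gobj_lipschitz x y : enorm (gobj x - gobj y) <= Lg * enorm (x - y).
Proof.
set v := gobj x - gobj y.
have bv := brvB (brv_dot_gradf x v) (brv_dot_gradf y v).
have E : enorm v ^+ 2 = Ex Pxi (fun z => dot (gradf x z) v - dot (gradf y z) v).
  rewrite (ExB Pxi (brv_dot_gradf x v) (brv_dot_gradf y v)) -!dot_gobj -dotBl.
  by rewrite -dotE.
have : enorm v ^+ 2 <= Lg * enorm (x - y) * enorm v.
  rewrite E -(Ex_cst Pxi (Lg * _ * _)); apply: (le_Ex Pxi bv (brv_cst _)) => z.
  rewrite -dotBl; apply: le_trans (dot_le _ _) _.
  by rewrite ler_wpM2r ?enorm_ge0// f_Lg.
rewrite expr2; have := enorm_ge0 v; rewrite le_eqVlt => /orP[/eqP <- _|v0].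
  by rewrite mulr_ge0 ?enorm_ge0.
by rewrite ler_pM2r.
Qed.

Lemma measurable_fobj : measurable_fun setT (fobj : B -> R).
Proof. exact: (measurable_lipschitz Lc0 fobj_lipschitz). Qed.

Lemma measurable_gobj i : measurable_fun setT ((fun x => gobj x 0 i) : B -> R).
Proof.
apply: (measurable_lipschitz Lg0) => x y.
have := enorm_coord (gobj x - gobj y) i.
rewrite [(gobj x - gobj y) 0 i]mxE [(- gobj y) 0 i]mxE => h.
exact: le_trans h (gobj_lipschitz x y).
Qed.

End Objective.

(** * Distance between a Lipschitz function and its smoothing *)

Section Smoothing.
Context {R : realType} {d : nat}.
Local Notation vec := 'rV[R]_d.
Local Notation B := (rVB R d).
Local Notation mu := (@lebesgue_measure R).
Local Notation ball := (@unit_ball R d).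

(* Monotonicity holds without measurability, the integral being a difference of suprema
   over simple functions. *)
Lemma le_integral_nonmeasurable dT (T : measurableType dT)
    (m : {measure set T -> \bar R}) (g1 g2 : T -> \bar R) :
  (forall x, g1 x <= g2 x)%E -> (\int[m]_x g1 x <= \int[m]_x g2 x)%E.
Proof.
move=> g12; rewrite /integral !patch_setT; apply: leeB.
  apply: le_ereal_sup => _ [h /= hg <-]; exists h => // x.
  by apply: le_trans (hg x) _; rewrite !funeposE le_max2.
apply: le_ereal_sup => _ [h /= hg <-]; exists h => // x.
by apply: le_trans (hg x) _; rewrite !funenegE le_max2// leeN2.
Qed.

Lemma le_iint k (g1 g2 : vec -> \bar R) : (forall v, g1 v <= g2 v)%E ->
  (iint k g1 <= iint k g2)%E.
Proof.
elim: k g1 g2 => [|k IH] g1 g2 g12 /=; first exact: g12.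
by apply: le_integral_nonmeasurable => a; exact: IH.
Qed.

(** The scalar has either sign, as it will be F x - L r or F x + L r. *)
Lemma iintZl k (a : R) (g : vec -> \bar R) : measurable_fun setT (g : B -> \bar R) ->
  (forall v, 0 <= g v)%E -> (iint k (fun v => a%:E * g v) = a%:E * iint k g)%E.
Proof.
elim: k g => [//|k IH] g mg g0 /=.
have mg' (b : R) : measurable_fun setT ((fun y => g (y + b *: coord_vec R d k)%R) : B -> \bar R).
  apply: (measurableT_comp mg).
  exact: (@measurable_shift _ _ _ B (fun=> b) id).
under eq_integral do rewrite IH//.
have mh : measurable_fun setT (fun b : measurableTypeR R =>
    iint k (fun y => g (y + (b : R) *: coord_vec R d k)%R)).
  have ms : measurable_fun setT ((fun b : measurableTypeR R => (0 + (b : R) *: coord_vec R d k)%R)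
    : measurableTypeR R -> B) by exact: measurable_shift.
  have := measurableT_comp (measurable_iint k mg g0) ms.
  by congr measurable_fun; apply/funext => b /=; congr iint; apply/funext => y; rewrite add0r.
have h0 (b : R) : (0 <= iint k (fun y => g (y + b *: coord_vec R d k)%R))%E.
  by apply: iint_ge0 => v.
have [a0|a0] := leP 0 a; first by rewrite ge0_integralZl_EFin.
have -> : a = (- (- a))%R by rewrite opprK.
under eq_integral do rewrite EFinN mulNe.
rewrite integral_ge0N ?ge0_integralZl_EFin ?EFinN ?mulNe//.
- by rewrite oppr_ge0 ltW.
- by move=> b _; rewrite mule_ge0// lee_fin oppr_ge0 ltW.
Qed.

Lemma measurable_ball : measurable (ball : set B).
Proof.
rewrite (_ : ball = @enorm R d @^-1` `]-oo, 1]).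
  by rewrite -[X in measurable X]setTI; apply: measurable_enorm.
by apply/seteqP; split => v /=; rewrite in_itv.
Qed.

(** On the ball the shifted function lies between the constants F x - L r and F x + L r, whose
    integrals are known multiples of the volume; monotonicity of [iint] does the rest. *)
Lemma smoothed_close (F : vec -> R) (L r : R) x : 0 <= L -> 0 <= r ->
  fine (lebesgue_rV ball) != 0 ->
  (forall x y, `|F x - F y| <= L * enorm (x - y)) ->
  `|smoothed F r x - F x| <= L * r.
Proof.
move=> L0 r0 V0 FL; rewrite /smoothed /E_ball.
have VE : lebesgue_rV ball = (fine (lebesgue_rV ball))%:E.
  by case: (lebesgue_rV ball) V0 => //=; rewrite eqxx.
have Vpos : 0 < fine (lebesgue_rV ball).
  rewrite lt_def V0 fine_ge0// /lebesgue_rV; apply: iint_ge0 => v.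
  by rewrite lee_fin.
set V := fine (lebesgue_rV ball) in V0 VE Vpos *.
have cst a : iint d (fun v => (\1_ball v * a)%:E) = (a * V)%:E.
  rewrite EFinM -VE -iintZl.
  - by congr iint; apply/funext => v; rewrite EFinM muleC.
  - exact: (measurable_indic_EFin measurable_ball).
  - by move=> v; rewrite lee_fin.
have near v : ball v -> `|F (x + r *: v) - F x| <= L * r.
  move=> bv; apply: le_trans (FL _ _) _; rewrite [x + _]addrC addrK enormZ ger0_norm//.
  by rewrite ler_wpM2l// -[leRHS]mulr1 ler_wpM2l.
have : (iint d (fun v => (\1_ball v * (F x - L * r))%:E) <=
        iint d (fun v => (\1_ball v * F (x + r *: v))%:E))%E.
  apply: le_iint => v; rewrite lee_fin indicE.
  have [vb|] := boolP (v \in ball); last by rewrite !mul0r.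
  by rewrite !mul1r; move: (near v (set_mem vb)); rewrite ler_norml => /andP[]; lra.
have : (iint d (fun v => (\1_ball v * F (x + r *: v))%:E) <=
        iint d (fun v => (\1_ball v * (F x + L * r))%:E))%E.
  apply: le_iint => v; rewrite lee_fin indicE.
  have [vb|] := boolP (v \in ball); last by rewrite !mul0r.
  by rewrite !mul1r; move: (near v (set_mem vb)); rewrite ler_norml => /andP[]; lra.
(* The two finite bounds also exclude infinite values of the middle integral. *)
rewrite !cst; case: iint => [I| |]//=; rewrite !lee_fin => h1 h2.
rewrite ler_norml; apply/andP; split.
  by rewrite lerBrDr ler_pdivlMr// addrC.
by rewrite lerBlDr ler_pdivrMr// addrC.
Qed.

End Smoothing.

(** * Measurability and independence of the iterates *)

Section StateSpace.
Context {R : realType} {d : nat}.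
Local Notation vec := 'rV[R]_d.
Local Notation B := (rVB R d).

(** A copy of the record of iterates as a product of measurable spaces, so that a state can serve as
    a random element in the independence lemmas. *)
Definition state_space := ((B * B) * (B * B))%type.

Definition of_state (s : adamm_state R d) : state_space :=
  ((st_x s, st_m s), (st_v s, st_vh s)).

Definition to_state (p : state_space) : adamm_state R d :=
  AdammState p.1.1 p.1.2 p.2.1 p.2.2.

Lemma of_stateK s : to_state (of_state s) = s. Proof. by case: s. Qed.

Context {dT} {T : measurableType dT}.

Record measurable_state (S : T -> adamm_state R d) : Prop := MeasurableState {
  measurable_st_x : measurable_fun setT ((fun t => st_x (S t)) : T -> B);
  measurable_st_m : measurable_fun setT ((fun t => st_m (S t)) : T -> B);
  measurable_st_v : measurable_fun setT ((fun t => st_v (S t)) : T -> B);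
  measurable_st_vh : measurable_fun setT ((fun t => st_vh (S t)) : T -> B) }.

Lemma measurable_of_state (S : T -> adamm_state R d) : measurable_state S ->
  measurable_fun setT ((fun t => of_state (S t)) : T -> state_space).
Proof. by case=> *; apply: measurable_fun_pair; exact: measurable_fun_pair. Qed.

Lemma measurable_adamm_step (alpha beta1 beta2 : R) (S : T -> adamm_state R d)
    (g : T -> vec) : measurable_state S -> measurable_fun setT (g : T -> B) ->
  measurable_state (fun t => adamm_step alpha beta1 beta2 (g t) (S t)).
Proof.
case=> mx mm mv mh mg.
have mm' : measurable_fun setT
    ((fun t => st_m (adamm_step alpha beta1 beta2 (g t) (S t))) : T -> B).
  apply: measurable_fun_rV => i; under eq_fun do rewrite !mxE.
  by apply: measurable_funD; apply: measurable_funM => //; exact: measurable_fun_rVP.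
have mv' : measurable_fun setT
    ((fun t => st_v (adamm_step alpha beta1 beta2 (g t) (S t))) : T -> B).
  apply: measurable_fun_rV => i; under eq_fun do rewrite !mxE.
  apply: measurable_funD; apply: measurable_funM => //; first exact: measurable_fun_rVP.
  by apply: measurable_funX; exact: measurable_fun_rVP.
have mh' : measurable_fun setT
    ((fun t => st_vh (adamm_step alpha beta1 beta2 (g t) (S t))) : T -> B).
  apply: measurable_fun_rV => i; under eq_fun do rewrite mxE.
  apply: measurable_maxr; first exact: measurable_fun_rVP.
  exact: (measurable_fun_rVP mv' i).
split => //; apply: measurable_fun_rV => i; under eq_fun do rewrite 3!mxE.
apply: measurable_funB; first exact: measurable_fun_rVP.
apply: measurable_funM => //; under eq_fun do rewrite mxE.
apply: measurable_funM; last exact: (measurable_fun_rVP mm' i).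
exact: (measurableT_comp (measurable_powR _) (measurable_fun_rVP mh' i)).
Qed.

End StateSpace.

Lemma measurable_to_state {R : realType} {d : nat} :
  measurable_state (@to_state R d : state_space -> adamm_state R d).
Proof.
have m1 := @measurable_fst _ _ (rVB R d * rVB R d)%type (rVB R d * rVB R d)%type.
have m2 := @measurable_snd _ _ (rVB R d * rVB R d)%type (rVB R d * rVB R d)%type.
by split; apply: measurableT_comp.
Qed.

(** * Product formulas for finite intersections of generating events *)

Section Cylinders.
Context {dO} {Omega : measurableType dO} {R : realType} (P : probability Omega R).
Variable ev : rv_index -> set (set Omega).
Hypothesis ev_measurable : forall j A, ev j A -> measurable A.
Hypothesis ev_indep : mutually_independent P ev.

Definition cylinder (D : pred rv_index) (G : set Omega) :=
  exists J A, [/\ uniq J, {subset J <= D}, (forall j, j \in J -> ev j (A j)) &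
    G = \bigcap_(j in [set j | j \in J]) A j].

Lemma cylinderT D : cylinder D setT.
Proof.
exists [::], (fun=> setT); split => //.
by apply/seteqP; split.
Qed.

Lemma cylinder_measurable D G : cylinder D G -> measurable G.
Proof.
move=> [J [A [_ _ JA ->]]]; apply: fin_bigcap_measurable.
  exact: (finite_seq J).
by move=> j /JA /ev_measurable.
Qed.

Lemma cylinder_sub (D D' : pred rv_index) G : {subset D <= D'} -> cylinder D G -> cylinder D' G.
Proof.
by move=> DD' [J [A [uJ JD JA GE]]]; exists J, A; split => // j /JD; exact: DD'.
Qed.

(** Independence over [j :: J] splits off the factor of [X]; the remaining product is P G by
    independence over [J]. *)
Lemma cylinderI (D : pred rv_index) j X G : ~~ D j -> ev j X -> cylinder D G ->
  cylinder (predU1 j D) (X `&` G) /\ (P (X `&` G) = P X * P G)%E.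
Proof.
move=> jD jX [J [A [uJ JD JA GE]]].
have jJ : j \notin J by apply: contra jD => /JD.
pose A' := fun i => if i == j then X else A i.
have A'J i : i \in J -> A' i = A i.
  by rewrite /A'; case: eqP => // -> ; rewrite (negbTE jJ).
have XGE : X `&` G = \bigcap_(i in [set i | i \in j :: J]) A' i.
  rewrite GE; apply/seteqP; split => [w [Xw Gw] i /=|w Gw].
    rewrite inE => /predU1P[->|iJ]; first by rewrite /A' eqxx.
    by rewrite A'J//; exact: Gw.
  split; first by have := Gw j; rewrite /A' eqxx; apply; rewrite /= mem_head.
  by move=> i /= iJ; rewrite -A'J//; apply: Gw; rewrite /= inE iJ orbT.
have uJ' : uniq (j :: J) by rewrite /= jJ.
have JA' i : i \in j :: J -> ev i (A' i).
  rewrite inE => /predU1P[->|iJ]; first by rewrite /A' eqxx.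
  by rewrite A'J//; exact: JA.
have mX := ev_measurable jX.
have mG : measurable G by apply: (@cylinder_measurable D); exists J, A.
split.
  exists (j :: J), A'; split => // i; rewrite inE => /predU1P[->|/JD iD].
    by rewrite inE /= eqxx.
  by rewrite inE /=; apply/orP; right.
have := ev_indep uJ' JA'; rewrite -XGE big_cons {1}/A' eqxx.
have -> : \prod_(i <- J) fine (P (A' i)) = fine (P G).
  rewrite GE (ev_indep uJ JA) big_seq [RHS]big_seq.
  by apply: eq_bigr => i iJ; rewrite A'J.
move=> h; rewrite -(fineK (fin_num_measure P X mX)) -(fineK (fin_num_measure P G mG)).
rewrite -EFinM -h fineK//; apply: fin_num_measure; exact: measurableI.
Qed.

End Cylinders.

(** * Independence of the state from later randomness *)

Section Process.
Context {dO} {Omega : measurableType dO} {R : realType} (P : probability Omega R).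
Context {dX} {Xi : measurableType dX} {d : nat}.
Local Notation vec := 'rV[R]_d.
Local Notation B := (rVB R d).
Variables (f : vec -> Xi -> R) (xi : nat -> Omega -> Xi) (u : nat -> Omega -> vec).
Variable Ridx : Omega -> nat.
Hypothesis mf : measurable_fun setT ((fun p => f p.1 p.2) : B * Xi -> R).
Hypothesis mxi : forall t, measurable_fun setT (xi t).
Hypothesis mu : forall t, measurable_fun setT (u t : Omega -> B).
Hypothesis mR : forall k, measurable (Ridx @^-1` [set k]).
Hypothesis indep : mutually_independent P (generated_events xi u Ridx).
Variables (x1 vh0 : vec) (alpha beta1 : nat -> R) (beta2 r : R).

Definition run t w := zo_adamm f x1 vh0 alpha beta1 beta2 r (xi^~ w) (u^~ w) t.

Lemma measurable_zo_grad dT (T : measurableType dT) (x v : T -> vec) (z : T -> Xi) :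
  measurable_fun setT (x : T -> B) -> measurable_fun setT (v : T -> B) ->
  measurable_fun setT z ->
  measurable_fun setT ((fun t => zo_grad (fun y => f y (z t)) r (x t) (v t)) : T -> B).
Proof.
move=> mx mv mz; apply: measurable_fun_rV => i; under eq_fun do rewrite mxE.
apply: measurable_funM; last exact: measurable_fun_rVP.
apply: measurable_funM => //; apply: measurable_funB.
  have mxv : measurable_fun setT ((fun t => x t + r *: v t) : T -> B).
    apply: measurable_fun_rV => j; under eq_fun do rewrite !mxE.
    apply: measurable_funD; first exact: measurable_fun_rVP.
    by apply: measurable_funM => //; exact: measurable_fun_rVP.
  exact: (measurableT_comp mf (measurable_fun_pair mxv mz)).
exact: (measurableT_comp mf (measurable_fun_pair mx mz)).
Qed.

Lemma measurable_run t : measurable_state (run t).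
Proof.
elim: t => [|t IH]; first by split; exact: measurable_cst.
apply: measurable_adamm_step => //.
by apply: measurable_zo_grad => //; case: IH.
Qed.

Lemma generated_events_measurable j A : generated_events xi u Ridx j A -> measurable A.
Proof.
case: j => [[t|t]|] /=.
- by move=> [C mC <-]; rewrite -[X in measurable X]setTI; exact: mxi.
- by move=> [C mC <-]; rewrite -[X in measurable X]setTI; exact: mu.
- move=> [C _ <-].
  have -> : Ridx @^-1` C = \bigcup_(k in C) Ridx @^-1` [set k].
    apply/seteqP; split => [w Cw|w [k Ck] /= wk]; last by rewrite /= wk.
    by exists (Ridx w).
  by apply: bigcup_measurable => k _; exact: mR.
Qed.

(** Indices of what is drawn after the first [t] steps; the random index R counts as future at every
    time. *)
Definition future t : pred rv_index := fun j =>
  match j with Some (inl s) | Some (inr s) => (t < s)%N | None => true end.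

Local Notation cyl D := (cylinder (generated_events xi u Ridx) D).

(** All that step t + 1 depends on, except its direction. *)
Let pre t w : state_space * Xi := (of_state (run t w), xi t.+1 w).

Definition past_indep t := forall G E, cyl (future t) G -> measurable E ->
  P ((fun w => of_state (run t w)) @^-1` E `&` G) =
  (P ((fun w => of_state (run t w)) @^-1` E) * P G)%E.

Let m_st t : measurable_fun setT (fun w => of_state (run t w)).
Proof. by apply: measurable_of_state; exact: measurable_run. Qed.

Let ev_xi t C : measurable C -> generated_events xi u Ridx (Some (inl t)) (xi t @^-1` C).
Proof. by move=> mC; exists C. Qed.

Let ev_u t (C : set vec) : measurable (C : set B) ->
  generated_events xi u Ridx (Some (inr t)) (u t @^-1` C).
Proof. by move=> mC; exists C. Qed.

Let cylI := cylinderI generated_events_measurable indep.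

Let fut_u t G C : cyl (future t.+1) G -> measurable (C : set B) ->
  cyl (predU1 (Some (inr t.+1)) (future t.+1)) (u t.+1 @^-1` C `&` G) /\
  (P (u t.+1 @^-1` C `&` G) = P (u t.+1 @^-1` C) * P G)%E.
Proof. by move=> cG mC; apply: cylI => //=; [rewrite ltnn|exact: ev_u]. Qed.

Let fut_xi t G C : cyl (predU1 (Some (inr t.+1)) (future t.+1)) G -> measurable C ->
  cyl (future t) (xi t.+1 @^-1` C `&` G) /\
  (P (xi t.+1 @^-1` C `&` G) = P (xi t.+1 @^-1` C) * P G)%E.
Proof.
move=> cG mC; have [|c e] := cylI _ (ev_xi t.+1 mC) cG; first by rewrite /= ltnn.
split => //; apply: cylinder_sub c => -[[s|s]|] //; rewrite !inE /=.
  by move=> h; change (t < s)%N; move: h => /orP[/eqP[->] //|]; exact: ltnW.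
by move=> h; change (t < s)%N; move: h => /orP[/eqP[->] //|]; exact: ltnW.
Qed.

Lemma state_sample_indep t : past_indep t -> forall A C, measurable A -> measurable C ->
  P ((fun w => of_state (run t w)) @^-1` A `&` xi t.+1 @^-1` C) =
  (P ((fun w => of_state (run t w)) @^-1` A) * P (xi t.+1 @^-1` C))%E.
Proof.
move=> H A C mA mC.
have [c _] := @fut_xi t setT C (cylinderT _ _) mC.
by have := H _ A c mA; rewrite setIT.
Qed.

Let pre_cyl t : past_indep t -> forall G E,
  cyl (predU1 (Some (inr t.+1)) (future t.+1)) G -> measurable E ->
  P (pre t @^-1` E `&` G) = (P (pre t @^-1` E) * P G)%E.
Proof.
move=> H G E cG mE; apply: indep_pair_event => //.
- exact: (cylinder_measurable generated_events_measurable cG).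
- exact: state_sample_indep.
- move=> A C mA mC; have [c e] := fut_xi cG mC.
  by rewrite -setIA H// e muleA.
Qed.

Lemma state_sample_direction_indep t : past_indep t ->
  forall A (C : set B), measurable A -> measurable C ->
  P (pre t @^-1` A `&` u t.+1 @^-1` C) = (P (pre t @^-1` A) * P (u t.+1 @^-1` C))%E.
Proof.
move=> H A C mA mC; have [c _] := @fut_u t setT C (cylinderT _ _) mC.
by have := pre_cyl H c mA; rewrite setIT.
Qed.

(** The sample and then the direction of step t + 1 are taken out of the future and joined to the
    state by [indep_pair_event]; the next state is a measurable function of this triple. *)
Lemma past_indepP t : past_indep t.
Proof.
elim: t => [|t IH] G E cG mE.
  (* The initial state is constant, so its preimages are trivial events. *)
  have [E0|E0] := pselect (E (of_state (AdammState x1 0 0 vh0))).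
    have -> : (fun w => of_state (run 0 w)) @^-1` E = setT by apply/seteqP; split.
    by rewrite setTI probability_setT mul1e.
  have -> : (fun w => of_state (run 0 w)) @^-1` E = set0 by apply/seteqP; split.
  by rewrite set0I measure0 mul0e.
pose next (p : state_space * Xi * B) : adamm_state R d :=
  let s := to_state p.1.1 in
  adamm_step (alpha t.+1) (beta1 t.+1) beta2
    (zo_grad (fun x => f x p.1.2) r (st_x s) p.2) s.
have mnext : measurable_fun setT (fun p => of_state (next p)).
  apply: measurable_of_state.
  have a := @measurable_fst _ _ (@state_space R d * Xi)%type B.
  have b := @measurable_fst _ _ (@state_space R d) Xi.
  have b' := @measurable_snd _ _ (@state_space R d) Xi.
  have mS : measurable_state
      (fun p : state_space * Xi * B => to_state p.1.1 : adamm_state R d).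
    have [h1 h2 h3 h4] := @measurable_to_state R d.
    have m11 := measurableT_comp b a.
    by split; [exact: (measurableT_comp h1 m11)|exact: (measurableT_comp h2 m11)
      |exact: (measurableT_comp h3 m11)|exact: (measurableT_comp h4 m11)].
  apply: measurable_adamm_step => //; apply: measurable_zo_grad.
  - by case: mS.
  - exact: measurable_snd.
  - exact: (measurableT_comp b' a).
have runE : (fun w => of_state (run t.+1 w)) =
    (fun p => of_state (next p)) \o (fun w => (pre t w, u t.+1 w)).
  by apply/funext => w; rewrite /next /= of_stateK.
have mE' : measurable ((fun p => of_state (next p)) @^-1` E).
  by rewrite -[X in measurable X]setTI; exact: mnext.
rewrite runE !comp_preimage.
apply: (@indep_pair_event _ _ _ Omega (state_space * Xi)%type B) => //.
- exact: measurable_fun_pair.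
- exact: (cylinder_measurable generated_events_measurable cG).
- exact: state_sample_direction_indep.
- move=> A C mA mC; have [c e] := fut_u cG mC.
  by rewrite -setIA pre_cyl// e muleA.
Qed.

Lemma run_index_indep t C E : measurable E ->
  P ((fun w => of_state (run t w)) @^-1` E `&` Ridx @^-1` C) =
  (P ((fun w => of_state (run t w)) @^-1` E) * P (Ridx @^-1` C))%E.
Proof.
move=> mE; apply: past_indepP => //.
rewrite -[X in cyl _ X]setIT.
have [] // := @cylI pred0 None (Ridx @^-1` C) setT isT _ (cylinderT _ _).
  by exists C.
by move=> c _; apply: cylinder_sub c => -[[s|s]|]; rewrite !inE.
Qed.

End Process.

(** * Descent along the auxiliary iterates *)

Section GradientEstimate.
Context {dO} {Omega : measurableType dO} {R : realType} {d : nat}.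
Local Notation vec := 'rV[R]_d.
Local Notation B := (rVB R d).
Variables (P : probability Omega R) (u : Omega -> vec).
Hypotheses (mu : forall A, borel_rV A -> measurable (u @^-1` A)).
Hypothesis u_unif : uniform_on_sphere P u.
Hypothesis u_unit : forall w, enorm (u w) = 1.
Variables (h : vec -> R) (a x : vec) (Lg Lc r : R).
Hypotheses (r0 : 0 < r) (Lg0 : 0 <= Lg) (aLc : enorm a <= Lc).
Hypothesis ha : forall y, `|h y - h x - dot a (y - x)| <= Lg * enorm (y - x) ^+ 2.
Hypothesis bh : bounded_rv (fun w => h (x + r *: u w)).
Let g w := zo_grad h r x (u w).

(** The difference quotient along the direction: the estimate is d q u, and q is within Lg r of <a,
    u>. *)
Let q w := (h (x + r *: u w) - h x) / r.

Lemma zo_grad_coord w i : g w 0 i = d%:R * q w * u w 0 i.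
Proof. by rewrite /g /zo_grad mxE /q; congr (_ * _); rewrite mulrAC mulrA. Qed.

Let q_err w : `|q w - dot a (u w)| <= Lg * r.
Proof.
have := ha (x + r *: u w); rewrite [x + _]addrC addrK dotZr enormZ u_unit mulr1.
rewrite real_normK ?num_real// /q [r *: _ + x]addrC => e.
have -> : (h (x + r *: u w) - h x) / r - dot a (u w) =
    (h (x + r *: u w) - h x - r * dot a (u w)) / r.
  by rewrite [RHS]mulrBl (mulrC r) mulfK// gt_eqF.
rewrite normrM normfV (gtr0_norm r0) ler_pdivrMr//.
by rewrite -mulrA -expr2.
Qed.

Let bq : bounded_rv q.
Proof.
have := brvZ r^-1 (brvB bh (brv_cst (h x))); congr bounded_rv.
by apply/funext => w; rewrite mulrC.
Qed.

Lemma brv_zo_grad i : bounded_rv (fun w => g w 0 i).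
Proof.
under eq_fun do rewrite zo_grad_coord.
by apply: brvM; [exact: brvZ|exact: brv_direction].
Qed.

(** Here g_i^4 = d^4 q^4 u_i^4 with q^4 <= 8 (<a,u>^4 + e^4), e = Lg r. Splitting products into
    eighth powers and using [Ex_dot8] gives 4 * 1080 (Lc^8 + 1) from the main part and 4 (1080 + 1)
    Lg^4 from the error, the latter because d^2 e^4 <= Lg^4. *)
Lemma zo_grad_fourth_moment i : d%:R ^+ 2 * r ^+ 4 <= 1 ->
  Ex P (fun w => g w 0 i ^+ 4) <= 4320 * (Lc ^+ 8 + 1) + 4324 * Lg ^+ 4.
Proof.
move=> dr1; have d0 : 0 < d%:R :> R by rewrite ltr0n (leq_trans _ (ltn_ord i)).
set D : R := d%:R in dr1 d0 *.
have bs : bounded_rv (fun w => dot a (u w)) by exact: brv_dot_direction.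
have bu : bounded_rv (fun w => u w 0 i) by exact: brv_direction.
pose e := Lg * r.
have e0 : 0 <= e by rewrite mulr_ge0// ltW.
pose Y w := 4 * D ^+ 4 * (dot a (u w) ^+ 8 + u w 0 i ^+ 8)
  + 4 * D ^+ 4 * e ^+ 4 * (D ^+ 2 * u w 0 i ^+ 8 + (D ^+ 2)^-1).
have b1 : bounded_rv (fun w => 4 * D ^+ 4 * (dot a (u w) ^+ 8 + u w 0 i ^+ 8)).
  by apply: brvZ; apply: brvD; exact: brvX.
have b2' : bounded_rv (fun w => D ^+ 2 * u w 0 i ^+ 8 + (D ^+ 2)^-1).
  by apply: brvD; [apply: brvZ; exact: brvX|exact: brv_cst].
have b2 : bounded_rv (fun w =>
    4 * D ^+ 4 * e ^+ 4 * (D ^+ 2 * u w 0 i ^+ 8 + (D ^+ 2)^-1)) by exact: brvZ.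
have : Ex P (fun w => g w 0 i ^+ 4) <= Ex P Y.
  apply: le_Ex => [||w].
  - by apply: brvX; exact: brv_zo_grad.
  - exact: brvD.
  rewrite zo_grad_coord -/D /Y; move: (q_err w); rewrite -/e ler_norml => /andP[q1 q2].
  set s := dot a (u w) in q1 q2 *; set v := u w 0 i; set p := q w in q1 q2 *.
  have p4 : p ^+ 4 <= 8 * (s ^+ 4 + e ^+ 4).
    have : p ^+ 2 <= 2 * (s ^+ 2 + e ^+ 2).
      have : (p - s) ^+ 2 <= e ^+ 2 by nra.
      have := sqr_ge0 (p - 2 * s); nra.
    have := sqr_ge0 (s ^+ 2 - e ^+ 2); have := sqr_ge0 p.
    have := sqr_ge0 s; have := sqr_ge0 e; nra.
  have v4 : 0 <= v ^+ 4 by rewrite (_ : v ^+ 4 = (v ^+ 2) ^+ 2) ?sqr_ge0//; ring.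
  have D4 : 0 <= D ^+ 4 by rewrite exprn_ge0// ltW.
  have e4 : 0 <= e ^+ 4 by rewrite exprn_ge0.
  have sv : s ^+ 4 * v ^+ 4 <= (s ^+ 8 + v ^+ 8) / 2.
    by have := sqr_ge0 (s ^+ 4 - v ^+ 4); lra.
  (* The weight D^2 balances the two terms: v^8 has mean of order D^-4, so both are of order
     D^-2. *)
  have vD : v ^+ 4 <= (D ^+ 2 * v ^+ 8 + (D ^+ 2)^-1) / 2.
    have D2 : D ^+ 2 != 0 by rewrite expf_neq0// gt_eqF.
    have Eq : (D ^+ 2)^-1 * (D ^+ 2 * v ^+ 4 - 1) ^+ 2 =
        D ^+ 2 * v ^+ 8 + (D ^+ 2)^-1 - 2 * v ^+ 4 by field; rewrite gt_eqF.
    have : 0 <= (D ^+ 2)^-1 * (D ^+ 2 * v ^+ 4 - 1) ^+ 2.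
      by rewrite mulr_ge0 ?sqr_ge0// invr_ge0 sqr_ge0.
    by rewrite Eq; set z := (D ^+ 2)^-1; set w1 := D ^+ 2 * _; lra.
  have -> : (D * p * v) ^+ 4 = D ^+ 4 * (p ^+ 4 * v ^+ 4) by ring.
  have h1 : p ^+ 4 * v ^+ 4 <= 8 * (s ^+ 4 + e ^+ 4) * v ^+ 4 by rewrite ler_wpM2r.
  have h2 : e ^+ 4 * v ^+ 4 <= e ^+ 4 * ((D ^+ 2 * v ^+ 8 + (D ^+ 2)^-1) / 2).
    by rewrite ler_wpM2l.
  apply: le_trans (ler_wpM2l D4 (_ : _ <= 4 * (s ^+ 8 + v ^+ 8)
    + 4 * (e ^+ 4 * (D ^+ 2 * v ^+ 8 + (D ^+ 2)^-1)))) _; first lra.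
  by rewrite le_eqVlt; apply/orP; left; apply/eqP; ring.
move/le_trans; apply; rewrite /Y ExD// !ExZ//; last by apply: brvD; exact: brvX.
rewrite !ExD ?Ex_cst ?ExZ//; do ?[exact: brvX|exact: brv_cst|by apply: brvZ; exact: brvX].
have m8 := Ex_dot8 mu u_unif u_unit i a.
have n8 : Ex P (fun w => u w 0 i ^+ 8) <= 1080 / D ^+ 4.
  have := Ex_dot8 mu u_unif u_unit i (ebasis R i).
  rewrite enorm_basis expr1n mulr1; congr (_ <= _).
  by congr Ex; apply/funext => w; rewrite dotC dot_basis.
set E1 := Ex P _ in m8 *; set E2 := Ex P _ in n8 *.
have D4 : 0 < D ^+ 4 by rewrite exprn_gt0.
have aL8 : enorm a ^+ 8 <= Lc ^+ 8.
  by apply: lerXn2r => //; rewrite nnegrE ?(le_trans _ aLc) ?enorm_ge0.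
rewrite (ler_pdivlMr _ _ D4) in m8; rewrite (ler_pdivlMr _ _ D4) in n8.
have m8' : D ^+ 4 * E1 <= 1080 * Lc ^+ 8 by lra.
have n8' : D ^+ 4 * E2 <= 1080 by lra.
have De : D ^+ 2 * e ^+ 4 <= Lg ^+ 4.
  rewrite /e exprMn mulrCA -[leRHS]mulr1 ler_wpM2l// exprn_ge0//.
have De0 : 0 <= D ^+ 2 * e ^+ 4 by rewrite mulr_ge0 ?exprn_ge0// ltW.
have -> : 4 * D ^+ 4 * e ^+ 4 * (D ^+ 2 * E2 + (D ^+ 2)^-1) =
    4 * (D ^+ 2 * e ^+ 4) * (D ^+ 4 * E2 + 1).
  by field; rewrite gt_eqF.
have : (D ^+ 2 * e ^+ 4) * (D ^+ 4 * E2 + 1) <= Lg ^+ 4 * 1081.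
  apply: ler_pM => //; last by lra.
  rewrite addr_ge0// mulr_ge0 ?(ltW D4)//; apply: Ex_ge0 => w.
  by rewrite (_ : _ ^+ 8 = (u w 0 i ^+ 4) ^+ 2) ?sqr_ge0// -exprM.
lra.
Qed.

(** The main part d <b,u> <a,u> has mean <b,a>; replacing <a,u> by q costs at most d |b| Lg r
    pointwise. *)
Lemma dot_zo_grad_mean b : (0 < d)%N ->
  dot b a - d%:R * r * Lg * enorm b <= Ex P (fun w => dot b (g w)).
Proof.
move=> d0; have d0' : d%:R != 0 :> R by rewrite pnatr_eq0 -lt0n.
have bs v : bounded_rv (fun w => dot v (u w)) by exact: brv_dot_direction.
have -> : dot b a - d%:R * r * Lg * enorm b =
    Ex P (fun w => d%:R * (dot b (u w) * dot a (u w)) - d%:R * r * Lg * enorm b).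
  rewrite ExB ?Ex_cst ?ExZ//; do ?[exact: brv_cst|exact: brvM|by apply: brvZ; exact: brvM].
  by rewrite (Ex_dot_dot mu u_unif u_unit (Ordinal d0)) mulrCA mulfV// mulr1.
apply: le_Ex => [||w].
- by apply: brvB; [apply: brvZ; exact: brvM|exact: brv_cst].
- by apply: brv_sum => i; apply: brvM; [exact: brv_cst|exact: brv_zo_grad].
have -> : dot b (g w) = d%:R * (dot b (u w) * q w).
  have -> : g w = (d%:R * q w) *: u w by apply/rowP => i; rewrite zo_grad_coord mxE.
  by rewrite dotZr; ring.
have : `|dot b (u w) * (q w - dot a (u w))| <= enorm b * (Lg * r).
  by rewrite normrM ler_pM// normr_dot_direction.
rewrite ler_norml => /andP[h1 _].
have : 0 <= d%:R * (dot b (u w) * (q w - dot a (u w)) + enorm b * (Lg * r)).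
  by rewrite mulr_ge0//; lra.
lra.
Qed.

End GradientEstimate.

(** * The coordinate weights, diagonal entries of V^(-1/2) *)

Section Weights.
Context {R : realType} {d : nat}.
Local Notation vec := 'rV[R]_d.
Implicit Types (h g : vec).

Definition wgt h i : R := (Num.sqrt (h 0 i))^-1.

Lemma powR_Nhalf (a : R) : 0 <= a -> a `^ (- 2^-1) = (Num.sqrt a)^-1.
Proof. by move=> a0; rewrite powRN powR12_sqrt. Qed.

Lemma wnorm2E h g : (forall i, 0 <= h 0 i) -> wnorm2 h g = \sum_i wgt h i * g 0 i ^+ 2.
Proof.
move=> h0; rewrite /wnorm2 sqr_enorm; apply: eq_bigr => i _.
rewrite mxE exprMn /wgt -powR_Nhalf//; congr (_ * _).
by rewrite -powR_mulrn ?powR_ge0// -powRrM; congr powR; field.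
Qed.

Variable c : R.
Hypothesis c0 : 0 < c.

Lemma wgt_ge0 h i : 0 <= wgt h i.
Proof. by rewrite invr_ge0 sqrtr_ge0. Qed.

Lemma wgt_le h i : c ^+ 2 <= h 0 i -> wgt h i <= c^-1.
Proof.
move=> ch; have h0 : 0 < h 0 i by rewrite (lt_le_trans _ ch)// exprn_gt0.
rewrite lef_pV2 ?posrE ?sqrtr_gt0//.
by rewrite -(ger0_norm (ltW c0)) -sqrtr_sqr ler_sqrt// ltW.
Qed.

Lemma wgt_anti h h' i : c ^+ 2 <= h 0 i -> h 0 i <= h' 0 i -> wgt h' i <= wgt h i.
Proof.
move=> ch hh'; have h0 : 0 < h 0 i by rewrite (lt_le_trans _ ch)// exprn_gt0.
have h'0 := lt_le_trans h0 hh'.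
by rewrite lef_pV2 ?posrE ?sqrtr_gt0// ler_sqrt// ltW.
Qed.

End Weights.

Lemma le1D_expr4 {R : realType} (x : R) : x ^+ 2 <= 1 + x ^+ 4.
Proof.
have -> : x ^+ 4 = (x ^+ 2) ^+ 2 by rewrite -exprM.
have := sqr_ge0 (x ^+ 2 - 1); have := sqr_ge0 (x ^+ 2); have := sqr_ge0 x; nra.
Qed.

(** Below the level [e] the first term suffices; above it |x| <= x^4 / e^3, and D <= 1/c. *)
Lemma mul_le_threshold {R : realType} (c e D x : R) : 0 < c -> 0 < e -> 0 <= D <= c^-1 ->
  D * `|x| <= e * D + x ^+ 4 / (c * e ^+ 3).
Proof.
move=> c0 e0 /andP[D0 Dc]; have x4 : x ^+ 4 = `|x| ^+ 4.
  by rewrite (_ : 4 = 2 * 2)%N// !exprM real_normK ?num_real.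
rewrite x4; set y := `|x|; have y0 : 0 <= y by exact: normr_ge0.
have ce : 0 < c * e ^+ 3 by rewrite mulr_gt0 ?exprn_gt0.
have q0 : 0 <= y ^+ 4 / (c * e ^+ 3) by rewrite divr_ge0 ?exprn_ge0// ltW.
have [ye|ey] := leP y e.
  by apply: ler_wpDr => //; rewrite mulrC ler_wpM2r.
apply: ler_wpDl; first by rewrite mulr_ge0// ltW.
apply: le_trans (ler_wpM2r y0 Dc) _.
rewrite ler_pdivlMr// [c^-1 * y]mulrC -mulrA mulKf ?gt_eqF//.
rewrite [y ^+ 4]exprS ler_wpM2l// lerXn2r ?nnegrE ?(ltW e0)// ltW//.
Qed.

(** * One step, outcome by outcome *)

Section Step.
Context {R : realType} {d : nat}.
Local Notation vec := 'rV[R]_d.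
Variables (F : vec -> R) (G : vec -> vec) (Lg Lc c alpha beta beta2 : R).
Hypotheses (Lg0 : 0 <= Lg) (Lc0 : 0 <= Lc) (c0 : 0 < c) (a0 : 0 < alpha).
Hypotheses (b0 : 0 <= beta) (b1 : beta < 1).
Hypothesis FG : quad_approx F G Lg.
Hypothesis GLc : forall x, enorm (G x) <= Lc.
Hypothesis GLg : forall x y, enorm (G x - G y) <= Lg * enorm (x - y).

Let b := beta / (1 - beta).
Let b_ge0 : 0 <= b.
Proof. by rewrite divr_ge0// subr_ge0 ltW. Qed.

(* The auxiliary iterate [z_t = x_t + b (x_t - x_(t-1))], along which the momentum term
   disappears up to the variation of the weights. *)
Definition aux_point (s : adamm_state R d) : vec :=
  st_x s - (b * alpha) *: \row_i (wgt (st_vh s) i * st_m s 0 i).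

(** Weights and evaluation point both come from the state before the step, so this vector is frozen
    when the next sample and direction are averaged. *)
Definition aux_grad (s : adamm_state R d) : vec :=
  \row_i (wgt (st_vh s) i * G (aux_point s) 0 i).

(** In 1 + b, the 1 pays for the product of the weight decrease with g and the b for that with the
    momentum; Lc bounds the coordinates of the gradient. *)
Definition potential (e : R) (s : adamm_state R d) : R :=
  F (aux_point s) + alpha * Lc * (1 + b) * e * \sum_i wgt (st_vh s) i.

Variables (s : adamm_state R d) (g : vec).
Hypothesis vh_ge : forall i, c ^+ 2 <= st_vh s 0 i.
Let s' := adamm_step alpha beta beta2 g s.

Lemma adamm_step_vh i : st_vh s 0 i <= st_vh s' 0 i.
Proof. by rewrite mxE le_max lexx. Qed.

Let W i := wgt (st_vh s) i.
Let W' i := wgt (st_vh s') i.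
Let D i := W i - W' i.

Let vh'_ge i : c ^+ 2 <= st_vh s' 0 i.
Proof. exact: le_trans (vh_ge i) (adamm_step_vh i). Qed.

Let W_ge0 i : 0 <= W i. Proof. exact: wgt_ge0. Qed.
Let W'_ge0 i : 0 <= W' i. Proof. exact: wgt_ge0. Qed.
Let W_le i : W i <= c^-1. Proof. exact: wgt_le. Qed.
Let W'_le i : W' i <= c^-1. Proof. exact: wgt_le. Qed.
Let D_ge0 i : 0 <= D i.
Proof. by rewrite subr_ge0; apply: (wgt_anti c0) => //; exact: adamm_step_vh. Qed.
Let D_le i : D i <= c^-1.
Proof. by have := W_le i; have := W'_ge0 i; rewrite /D; lra. Qed.

Lemma adamm_step_x i :
  st_x s' 0 i = st_x s 0 i - alpha * (W' i * (beta * st_m s 0 i + (1 - beta) * g 0 i)).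
Proof.
transitivity (st_x s 0 i - alpha * (st_vh s' 0 i `^ (- 2^-1) * st_m s' 0 i)).
  by rewrite !mxE.
congr (_ - _ * (_ * _)); last by rewrite !mxE.
rewrite powR_Nhalf//; apply: le_trans (vh'_ge i); exact: sqr_ge0.
Qed.

Lemma aux_pointE t i :
  aux_point t 0 i = st_x t 0 i - b * alpha * (wgt (st_vh t) i * st_m t 0 i).
Proof. by rewrite !mxE. Qed.

Lemma adamm_step_m i : st_m s' 0 i = beta * st_m s 0 i + (1 - beta) * g 0 i.
Proof. by rewrite !mxE. Qed.

(** As 1 + b = 1/(1 - beta), the two occurrences of the new momentum add up to - alpha W' (g + b m),
    and the old one contributes alpha b W m. *)
Lemma aux_point_step i : aux_point s' 0 i - aux_point s 0 i =
  - alpha * (W i * g 0 i) + alpha * (D i * (g 0 i + b * st_m s 0 i)).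
Proof.
have bN : 1 - beta != 0 by rewrite gt_eqF// subr_gt0.
rewrite !aux_pointE adamm_step_x adamm_step_m -/(W i) -/(W' i) /D /b.
by move: (W i) (W' i) (st_x s 0 i) (st_m s 0 i) (g 0 i) => ? ? ? ? ?; field.
Qed.

Lemma aux_point_dist : enorm (aux_point s - st_x s) ^+ 2 <=
  (b * alpha / c) ^+ 2 * \sum_i st_m s 0 i ^+ 2.
Proof.
rewrite sqr_enorm mulr_sumr ler_sum// => i _.
have -> : (aux_point s - st_x s) 0 i = - (b * alpha * (W i * st_m s 0 i)).
  by rewrite [LHS]mxE [(- st_x s) 0 i]mxE aux_pointE /W; ring.
have Wc : W i ^+ 2 <= c^-1 ^+ 2 by rewrite lerXn2r ?nnegrE ?invr_ge0// ltW.
have := ler_wpM2l (sqr_ge0 (b * alpha * st_m s 0 i)) Wc.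
by congr (_ <= _); ring.
Qed.

Lemma potential_step e : 0 < e ->
  potential e s' <= potential e s - alpha * dot (aux_grad s) g
    + alpha * Lc / (c * e ^+ 3) * \sum_i (g 0 i ^+ 4 + b * st_m s 0 i ^+ 4)
    + 2 * Lg * alpha ^+ 2 / c ^+ 2 * \sum_i (g 0 i ^+ 2 + b ^+ 2 * st_m s 0 i ^+ 2).
Proof.
move=> e0; set z := aux_point s; set z' := aux_point s'.
have h1 : F z' <= F z + dot (G z) (z' - z) + Lg * enorm (z' - z) ^+ 2.
  by have := FG z z'; rewrite ler_norml => /andP[_]; lra.
have zi i : (z' - z) 0 i =
    - alpha * (W i * g 0 i) + alpha * (D i * (g 0 i + b * st_m s 0 i)).
  by rewrite [LHS]mxE [(- z) 0 i]mxE -aux_point_step.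
have Gi i : `|G z 0 i| <= Lc by exact: le_trans (enorm_coord _ _) (GLc z).
have h2 : dot (G z) (z' - z) <= - alpha * dot (aux_grad s) g
    + \sum_i (alpha * Lc * ((1 + b) * e * D i
        + (g 0 i ^+ 4 + b * st_m s 0 i ^+ 4) / (c * e ^+ 3))).
  rewrite /dot mulr_sumr -big_split/=; apply: ler_sum => i _.
  rewrite zi [aux_grad s 0 i]mxE -/(W i) -/z.
  have DDc : 0 <= D i <= c^-1 by rewrite D_ge0 D_le.
  have k1 := mul_le_threshold (g 0 i) c0 e0 DDc.
  have k2 := ler_wpM2l b_ge0 (mul_le_threshold (st_m s 0 i) c0 e0 DDc).
  have k3 : G z 0 i * (D i * (g 0 i + b * st_m s 0 i)) <=
      Lc * (D i * `|g 0 i| + b * (D i * `|st_m s 0 i|)).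
    apply: le_trans (ler_norm _) _; rewrite normrM ler_pM//.
    rewrite normrM (ger0_norm (D_ge0 i)) mulrCA -mulrDr ler_wpM2l//.
    by apply: le_trans (ler_normD _ _) _; rewrite normrM (ger0_norm b_ge0).
  have k4 := ler_wpM2l Lc0 (lerD k1 k2).
  have := ler_wpM2l (ltW a0) (le_trans k3 k4).
  set q := (c * e ^+ 3)^-1; lra.
have h3 : enorm (z' - z) ^+ 2 <=
    2 * alpha ^+ 2 / c ^+ 2 * \sum_i (g 0 i ^+ 2 + b ^+ 2 * st_m s 0 i ^+ 2).
  rewrite sqr_enorm mulr_sumr; apply: ler_sum => i _; rewrite zi.
  (* Regrouped so that both coefficients, W' and D, lie between 0 and 1/c. *)
  have -> : - alpha * (W i * g 0 i) + alpha * (D i * (g 0 i + b * st_m s 0 i)) =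
    alpha * (- (W' i * g 0 i) + D i * (b * st_m s 0 i)) by rewrite /D; ring.
  rewrite exprMn; set p := W' i * _; set q := D i * _.
  have : (- p + q) ^+ 2 <= 2 * (p ^+ 2 + q ^+ 2) by have := sqr_ge0 (p + q); lra.
  have cc (x y : R) : 0 <= x <= c^-1 -> (x * y) ^+ 2 <= y ^+ 2 / c ^+ 2.
    move=> /andP[x0 xc]; rewrite exprMn mulrC ler_wpM2l ?sqr_ge0//.
    by rewrite -exprVn lerXn2r// nnegrE// invr_ge0 ltW.
  have p2 : p ^+ 2 <= g 0 i ^+ 2 / c ^+ 2 by apply: cc; rewrite W'_ge0 W'_le.
  have q2 : q ^+ 2 <= (b * st_m s 0 i) ^+ 2 / c ^+ 2 by apply: cc; rewrite D_ge0 D_le.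
  move=> pq; have := ler_wpM2l (sqr_ge0 alpha) (le_trans pq (ler_wpM2l (ler0n R 2) (lerD p2 q2))).
  move/le_trans; apply; rewrite le_eqVlt; apply/orP; left; apply/eqP; ring.
have h4 := ler_wpM2l Lg0 h3.
(* The sum of the weights drops by exactly the sum of the D_i, which cancels the part of [h2] linear
   in D. *)
have SWD : \sum_i wgt (st_vh s) i = \sum_i wgt (st_vh s') i + \sum_i D i.
  by rewrite -big_split/=; apply: eq_bigr => i _; rewrite /D addrC subrK.
move: h2; rewrite -mulr_sumr big_split/= -mulr_sumr -mulr_suml.
rewrite /potential -/z -/z' SWD; move: h1 h4.
move: (\sum_i wgt _ i) (\sum_i D i) (dot (aux_grad s) g) (dot (G z) _) => SW SD dd dG.
move: (\sum_i (_ + b * _)) (\sum_i (_ + b ^+ 2 * _)) => S4 S2.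
move: (enorm _ ^+ 2) (F z) (F z') => nz Fz Fz'.
set q := (c * e ^+ 3)^-1; set q2 := (c ^+ 2)^-1 => h1 h4 h2.
have h14 := le_trans h1 (lerD (lerD (lexx Fz) h2) h4).
have aux : alpha * Lc * (1 + b) * e * (SW + SD) =
  alpha * Lc * (1 + b) * e * SW + alpha * Lc * (1 + b) * e * SD by ring.
rewrite aux; apply: le_trans (lerD h14 (lexx _)) _.
by rewrite le_eqVlt; apply/orP; left; apply/eqP; ring.
Qed.

(** In the inner product weighted by W, <G z, G x> is half of |G z|^2 + |G x|^2 - |G z - G x|^2. The
    G x half is kept, the G z half absorbs the bias e |aux_grad| by Young's inequality, and the
    difference is at most Lg times the distance from z to x, a multiple of the momentum. *)
Lemma aux_grad_dot_ge (e : R) : 0 <= e ->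
  2^-1 * \sum_i W i * G (st_x s) 0 i ^+ 2
  - Lg ^+ 2 * (b * alpha) ^+ 2 / (2 * c ^+ 3) * \sum_i st_m s 0 i ^+ 2
  - e ^+ 2 / (2 * c) <= dot (aux_grad s) (G (st_x s)) - e * enorm (aux_grad s).
Proof.
move=> e0; set z := aux_point s; set x := st_x s.
have cV : 0 <= c^-1 by rewrite invr_ge0 ltW.
set A := \sum_i W i * G x 0 i ^+ 2; set AZ := \sum_i W i * G z 0 i ^+ 2.
set AD := \sum_i W i * (G z - G x) 0 i ^+ 2.
have E : dot (aux_grad s) (G x) = 2^-1 * AZ + 2^-1 * A - 2^-1 * AD.
  rewrite /dot !mulr_sumr -big_split -sumrB/=; apply: eq_bigr => i _.
  rewrite [aux_grad s 0 i]mxE -/z -/(W i) [(G z - G x) 0 i]mxE [(- G x) 0 i]mxE.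
  by field.
have AD1 : AD <= c^-1 * (Lg ^+ 2 * ((b * alpha / c) ^+ 2 * \sum_i st_m s 0 i ^+ 2)).
  apply: (@le_trans _ _ (c^-1 * enorm (G z - G x) ^+ 2)).
    by rewrite sqr_enorm mulr_sumr ler_sum// => i _; rewrite ler_wpM2r ?sqr_ge0.
  rewrite ler_wpM2l//; apply: (@le_trans _ _ (Lg ^+ 2 * enorm (z - x) ^+ 2)).
    by rewrite -exprMn lerXn2r ?nnegrE ?mulr_ge0 ?enorm_ge0.
  by rewrite ler_wpM2l ?sqr_ge0// aux_point_dist.
have nb : enorm (aux_grad s) ^+ 2 <= c^-1 * AZ.
  rewrite sqr_enorm mulr_sumr ler_sum// => i _; rewrite [aux_grad s 0 i]mxE -/z -/(W i).
  have := ler_wpM2r (mulr_ge0 (W_ge0 i) (sqr_ge0 (G z 0 i))) (W_le i).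
  by congr (_ <= _); ring.
have am : e * enorm (aux_grad s) <= c / 2 * enorm (aux_grad s) ^+ 2 + e ^+ 2 / (2 * c).
  set y := enorm _; have : 0 <= (2 * c)^-1 * (c * y - e) ^+ 2.
    by rewrite mulr_ge0 ?sqr_ge0// invr_ge0 mulr_ge0// ltW.
  have -> : (2 * c)^-1 * (c * y - e) ^+ 2 = c / 2 * y ^+ 2 + e ^+ 2 / (2 * c) - e * y.
    by field; rewrite gt_eqF.
  by rewrite subr_ge0.
have nb' : c / 2 * enorm (aux_grad s) ^+ 2 <= 2^-1 * AZ.
  have c2 : 0 <= c / 2 by rewrite divr_ge0// ltW.
  apply: le_trans (ler_wpM2l c2 nb) _.
  by rewrite le_eqVlt; apply/orP; left; apply/eqP; field; rewrite gt_eqF.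
rewrite E; set M := \sum_i st_m s 0 i ^+ 2 in AD1 *.
have -> : Lg ^+ 2 * (b * alpha) ^+ 2 / (2 * c ^+ 3) * M =
  2^-1 * (c^-1 * (Lg ^+ 2 * ((b * alpha / c) ^+ 2 * M))).
  by field; rewrite gt_eqF.
set t := e ^+ 2 / (2 * c) in am *; set y := e * _ in am *; lra.
Qed.

End Step.

Section AuxMeasurable.
Context {R : realType} {d : nat} {dT} {T : measurableType dT}.
Local Notation vec := 'rV[R]_d.
Local Notation B := (rVB R d).

Lemma measurable_wgt (h : T -> vec) i : measurable_fun setT (h : T -> B) ->
  measurable_fun setT (fun t => wgt (h t) i).
Proof.
move=> mh; rewrite /wgt.
under eq_fun do rewrite -powR_inv1 ?sqrtr_ge0//.
apply: (measurableT_comp (@measurable_powR R (-1))).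
apply: (measurableT_comp (continuous_measurable_fun (@sqrt_continuous R))).
exact: (measurable_fun_rVP mh i).
Qed.

Lemma measurable_aux_point (alpha beta : R) (S : T -> adamm_state R d) :
  measurable_state S -> measurable_fun setT ((fun t => aux_point alpha beta (S t)) : T -> B).
Proof.
case=> mx mm _ mh; apply: measurable_fun_rV => i.
under eq_fun do rewrite aux_pointE.
apply: measurable_funB; first exact: (measurable_fun_rVP mx i).
apply: measurable_funM => //; apply: measurable_funM; first exact: measurable_wgt.
exact: (measurable_fun_rVP mm i).
Qed.

Lemma measurable_aux_grad (G : vec -> vec) (alpha beta : R) (S : T -> adamm_state R d) :
  (forall i, measurable_fun setT ((fun x => G x 0 i) : B -> R)) -> measurable_state S ->
  measurable_fun setT ((fun t => aux_grad G alpha beta (S t)) : T -> B).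
Proof.
move=> mG mS; apply: measurable_fun_rV => i; under eq_fun do rewrite mxE.
apply: measurable_funM; first by apply: measurable_wgt; case: mS.
exact: (measurableT_comp (mG i) (measurable_aux_point alpha beta mS)).
Qed.

Lemma measurable_dot2 (a b : T -> vec) : measurable_fun setT (a : T -> B) ->
  measurable_fun setT (b : T -> B) -> measurable_fun setT (fun t => dot (a t) (b t)).
Proof.
move=> ma mb; apply: measurable_sum => i.
by apply: measurable_funM; [exact: (measurable_fun_rVP ma)|exact: (measurable_fun_rVP mb)].
Qed.

End AuxMeasurable.

Lemma enorm_aux_grad_le {R : realType} {d : nat} (G : 'rV[R]_d -> 'rV[R]_d)
    (Lc c alpha beta : R) s : 0 < c ->
  (forall x, enorm (G x) <= Lc) -> (forall i, c ^+ 2 <= st_vh s 0 i) ->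
  enorm (aux_grad G alpha beta s) <= c^-1 * Lc.
Proof.
move=> c0 GLc hs; apply: (@le_trans _ _ (c^-1 * enorm (G (aux_point alpha beta s)))).
  have cV : 0 < c^-1 by rewrite invr_gt0.
  rewrite -(@ler_pXn2r _ 2)// ?nnegrE ?mulr_ge0 ?enorm_ge0// ?(ltW cV)//.
  rewrite exprMn !sqr_enorm mulr_sumr ler_sum// => i _.
  rewrite mxE exprMn ler_wpM2r ?sqr_ge0// lerXn2r ?nnegrE ?wgt_ge0 ?(ltW cV)//.
  exact: wgt_le.
by rewrite ler_wpM2l// invr_ge0 ltW.
Qed.

Lemma convex_expr4 {R : realType} (b m g : R) : 0 <= b -> b < 1 ->
  (b * m + (1 - b) * g) ^+ 4 <= b * m ^+ 4 + (1 - b) * g ^+ 4.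
Proof.
move=> b0 b1.
have sq (x y : R) : (b * x + (1 - b) * y) ^+ 2 <= b * x ^+ 2 + (1 - b) * y ^+ 2.
  rewrite -subr_ge0.
  have -> : b * x ^+ 2 + (1 - b) * y ^+ 2 - (b * x + (1 - b) * y) ^+ 2 =
    b * (1 - b) * (x - y) ^+ 2 by ring.
  by rewrite mulr_ge0 ?sqr_ge0// mulr_ge0//; lra.
have e4 (x : R) : x ^+ 4 = (x ^+ 2) ^+ 2 by rewrite -exprM.
rewrite !e4; apply: le_trans (sq (m ^+ 2) (g ^+ 2)).
have b1' : 0 <= 1 - b by lra.
have h1 : 0 <= b * m ^+ 2 + (1 - b) * g ^+ 2 by rewrite addr_ge0// mulr_ge0// sqr_ge0.
by apply: lerXn2r (sq m g); rewrite nnegrE// sqr_ge0.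
Qed.

(** * Expectation of one step, and telescoping *)

Section ExpectedDescent.
Context {dO} {Omega : measurableType dO} {R : realType} (P : probability Omega R).
Context {dX} {Xi : measurableType dX} {d : nat} (Pxi : probability Xi R).
Local Notation vec := 'rV[R]_d.
Local Notation B := (rVB R d).
Variables (f : vec -> Xi -> R) (xi : nat -> Omega -> Xi) (u : nat -> Omega -> vec).
Variables (Ridx : Omega -> nat) (Lg Lc c alpha beta beta2 r : R) (x1 vh0 : vec).
Hypotheses (d0 : (0 < d)%N) (Lg0 : 0 <= Lg) (Lc0 : 0 <= Lc) (c0 : 0 < c).
Hypotheses (a0 : 0 < alpha) (b0 : 0 <= beta) (b1 : beta < 1) (r0 : 0 < r).
Hypothesis f_int : forall x, Pxi.-integrable setT (fun z => (f x z)%:E).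
Hypothesis f_diff : forall z x, differentiable (fun y => f y z) x.
Hypothesis f_Lg : forall z x y,
  enorm (grad (fun w => f w z) x - grad (fun w => f w z) y) <= Lg * enorm (x - y).
Hypothesis f_Lc : forall z x y, `|f x z - f y z| <= Lc * enorm (x - y).
Hypothesis mxi : forall t, measurable_fun setT (xi t).
Hypothesis xi_law : forall t A, measurable A -> P (xi t @^-1` A) = Pxi A.
Hypothesis mu : forall t A, borel_rV A -> measurable (u t @^-1` A).
Hypothesis u_unif : forall t, uniform_on_sphere P (u t).
Hypothesis u_unit : forall t w, enorm (u t w) = 1.
Hypothesis mR : forall k, measurable (Ridx @^-1` [set k]).
Hypothesis indep : mutually_independent P (generated_events xi u Ridx).
Hypothesis vh0_ge : forall i, c ^+ 2 <= vh0 0 i.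
Hypothesis dr1 : d%:R ^+ 2 * r ^+ 4 <= 1.

Let F := fobj Pxi f.
Let G := gobj Pxi f.
Let S t w := run f xi u x1 vh0 (fun=> alpha) (fun=> beta) beta2 r t w.
Let g t w := zo_grad (fun x => f x (xi t.+1 w)) r (st_x (S t w)) (u t.+1 w).
Let b := beta / (1 - beta).
Variable K4 : R.
Hypothesis K4E : K4 = 4320 * (Lc ^+ 8 + 1) + 4324 * Lg ^+ 4.

Let SE t w : S t.+1 w = adamm_step alpha beta beta2 (g t w) (S t w).
Proof. by []. Qed.

Let m_u t : measurable_fun setT (u t : Omega -> B).
Proof. by apply: measurable_direction; exact: mu. Qed.

Let mf := measurable_f Lc0 f_int f_Lc.

Let mS t : measurable_state (S t).
Proof. exact: measurable_run. Qed.

Lemma run_vh_ge t w i : c ^+ 2 <= st_vh (S t w) 0 i.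
Proof.
elim: t => [|t IH]; first exact: vh0_ge.
by apply: le_trans IH _; rewrite SE; exact: adamm_step_vh.
Qed.

(** This bound of order d only serves integrability; the rate rests on the fourth moments. *)
Lemma enorm_zo_grad_le z x v : enorm v = 1 ->
  enorm (zo_grad (fun y => f y z) r x v) <= d%:R * Lc.
Proof.
move=> v1; rewrite enormZ v1 mulr1 !normrM normfV (gtr0_norm r0) ger0_norm//.
have h1 : `|f (x + r *: v) z - f x z| <= Lc * r.
  apply: le_trans (f_Lc _ _ _) _.
  by rewrite [x + _]addrC addrK enormZ v1 mulr1 gtr0_norm.
by rewrite -mulrA ler_wpM2l// mulrC ler_pdivrMr.
Qed.

Let bg t i : bounded_rv (fun w => g t w 0 i).
Proof.
split; last by exists (d%:R * Lc) => w; exact: le_trans (enorm_coord _ _) (enorm_zo_grad_le _ _ _).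
apply: (measurable_fun_rVP (f := g t)).
by apply: measurable_zo_grad => //; case: (mS t).
Qed.

Let bm t i : bounded_rv (fun w => st_m (S t w) 0 i).
Proof.
elim: t => [|t IH].
  by under eq_fun do rewrite mxE; exact: brv_cst.
by under eq_fun do rewrite SE adamm_step_m; apply: brvD; exact: brvZ.
Qed.

Let bW t i : bounded_rv (fun w => wgt (st_vh (S t w)) i).
Proof.
split; first by apply: measurable_wgt; case: (mS t).
exists c^-1 => w; rewrite ger0_norm ?wgt_ge0//; apply: wgt_le => //.
exact: run_vh_ge.
Qed.

Let bx t i : bounded_rv (fun w => st_x (S t w) 0 i).
Proof.
elim: t => [|t IH]; first exact: brv_cst.
have -> : (fun w => st_x (S t.+1 w) 0 i) = (fun w => st_x (S t w) 0 i -
    alpha * (wgt (st_vh (S t.+1 w)) i * (beta * st_m (S t w) 0 i + (1 - beta) * g t w 0 i))).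
  by apply/funext => w; exact: (adamm_step_x alpha beta beta2 (g t w) (run_vh_ge t w)).
by apply: brvB => //; apply: brvZ; apply: brvM => //; apply: brvD; exact: brvZ.
Qed.

Let bF t : bounded_rv (fun w => F (aux_point alpha beta (S t w))).
Proof.
have bZ i : bounded_rv (fun w => aux_point alpha beta (S t w) 0 i).
  under eq_fun do rewrite aux_pointE.
  by apply: brvB => //; apply: brvZ; exact: brvM.
have [_ [M ZM]] : bounded_rv (fun w => enorm (aux_point alpha beta (S t w)) ^+ 2).
  under eq_fun do rewrite sqr_enorm.
  by apply: brv_sum => i; exact: brvX.
split.
  apply: (measurableT_comp (measurable_fobj Lc0 f_int f_Lc)).
  exact: (measurable_aux_point alpha beta (mS t)).
exists (`|F 0| + Lc * (1 + M)) => w.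
have := fobj_lipschitz f_int f_Lc (aux_point alpha beta (S t w)) 0.
rewrite subr0 -/F => h; rewrite -[F _](subrK (F 0)) addrC.
apply: le_trans (ler_normD _ _) _; rewrite lerD2l.
apply: le_trans h _; rewrite ler_wpM2l//.
have := ZM w; rewrite ger0_norm ?sqr_ge0//; set y := enorm _ => yM.
by have := sqr_ge0 (y - 1); have := sqr_ge0 y; lra.
Qed.

Let bpot e t : bounded_rv (fun w => potential F Lc alpha beta e (S t w)).
Proof. by apply: brvD => //; apply: brvZ; exact: brv_sum. Qed.

Let SXi := (@state_space R d * Xi)%type.
Let pre t w : SXi := (of_state (S t w), xi t.+1 w).

Let mpre t : measurable_fun setT (pre t).
Proof. by apply: measurable_fun_pair => //; apply: measurable_of_state. Qed.

Let past t := past_indepP mf mxi m_u mR indep x1 vh0 (fun=> alpha) (fun=> beta) beta2 r (t := t).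

Let pre_u t A (C : set B) : measurable A -> measurable C ->
  P (pre t @^-1` A `&` u t.+1 @^-1` C) = (P (pre t @^-1` A) * P (u t.+1 @^-1` C))%E.
Proof. exact: (state_sample_direction_indep mf mxi m_u mR indep (@past t)). Qed.

Let state_xi t A C : measurable A -> measurable C ->
  P ((fun w => of_state (S t w)) @^-1` A `&` xi t.+1 @^-1` C) =
  (P ((fun w => of_state (S t w)) @^-1` A) * P (xi t.+1 @^-1` C))%E.
Proof. exact: (state_sample_indep mxi m_u mR indep (@past t)). Qed.

Let mstate : measurable_state (fun p : SXi * B => to_state p.1.1).
Proof.
have a := @measurable_fst _ _ SXi B.
have b' := @measurable_fst _ _ (@state_space R d) Xi.
have m11 := measurableT_comp b' a.
have [h1 h2 h3 h4] := @measurable_to_state R d.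
by split; [exact: (measurableT_comp h1 m11)|exact: (measurableT_comp h2 m11)
  |exact: (measurableT_comp h3 m11)|exact: (measurableT_comp h4 m11)].
Qed.

Let mstate1 : measurable_state (fun p : SXi => to_state p.1).
Proof.
have m11 := @measurable_fst _ _ (@state_space R d) Xi.
have [h1 h2 h3 h4] := @measurable_to_state R d.
by split; [exact: (measurableT_comp h1 m11)|exact: (measurableT_comp h2 m11)
  |exact: (measurableT_comp h3 m11)|exact: (measurableT_comp h4 m11)].
Qed.

Let est (p : SXi * B) : vec :=
  zo_grad (fun x => f x p.1.2) r (st_x (to_state p.1.1)) p.2.

Let mest : measurable_fun setT (est : SXi * B -> B).
Proof.
apply: measurable_zo_grad => //.
- by case: mstate.
- exact: (measurableT_comp (@measurable_snd _ _ (@state_space R d) Xi)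
    (@measurable_fst _ _ SXi B)).
Qed.

Let b_val x z t : bounded_rv (fun w => f (x + r *: u t w) z).
Proof.
have m1 : measurable_fun setT ((fun w => x + r *: u t w) : Omega -> B).
  apply: measurable_fun_rV => j; under eq_fun do rewrite !mxE.
  apply: measurable_funD => //; apply: measurable_funM => //.
  exact: (measurable_fun_rVP (m_u t)).
split.
  exact: (measurable_f_comp Lc0 f_int f_Lc m1 (@measurable_cst _ _ _ _ _ z)).
exists (`|f x z| + Lc * r) => w; rewrite -[f _ z](subrK (f x z)) addrC.
apply: le_trans (ler_normD _ _) _; rewrite lerD2l.
apply: le_trans (f_Lc _ _ _) _.
by rewrite [x + _]addrC addrK enormZ u_unit mulr1 gtr0_norm.
Qed.

(** State and sample are frozen and only the direction is averaged. The signs are reversed because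
    [indep_le_Ex] gives lower bounds. *)
Lemma Ex_grad_fourth t i : Ex P (fun w => g t w 0 i ^+ 4) <= K4.
Proof.
pose Phi (p : SXi * B) := - (est p 0 i ^+ 4).
have : Ex P ((fun=> - K4) \o pre t) <= Ex P (fun w => Phi (pre t w, u t.+1 w)).
  apply: (@indep_le_Ex _ _ _ _ SXi B _ P (pre t) (u t.+1) (mpre t) (m_u _) (@pre_u t)
    Phi (fun=> - K4) ((d%:R * Lc) ^+ 4) `|- K4|) => //.
  - apply: measurable_funN; apply: measurable_funX; exact: (measurable_fun_rVP mest).
  - move=> w w'; rewrite normrN normrX lerXn2r ?nnegrE ?mulr_ge0//.
    by apply: le_trans (enorm_coord _ _) _; exact: (enorm_zo_grad_le _ _ (u_unit _ _)).
  - move=> w; rewrite ExN; last first.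
      apply: brvX.
      exact: (brv_zo_grad (mu t.+1) (u_unit _) (h := f^~ (xi t.+1 w)) (b_val _ _ _) i).
    rewrite lerN2 K4E; exact: (zo_grad_fourth_moment (mu t.+1) (u_unif _) (u_unit _)
      (h := f^~ (xi t.+1 w)) r0 Lg0 (enorm_gradf Lc0 f_diff f_Lg f_Lc _ _) (f_quad f_diff f_Lg _ _) (b_val _ _ _)).
have -> : Ex P (fun w => Phi (pre t w, u t.+1 w)) = Ex P (fun w => - (g t w 0 i ^+ 4)) by [].
by rewrite (ExN P (brvX 4 (bg t i))) [leLHS](Ex_cst P (- K4)) lerN2.
Qed.

Let K4_ge0 : 0 <= K4.
Proof. by have := exprn_ge0 8 Lc0; have := exprn_ge0 4 Lg0; rewrite K4E; lra. Qed.

(** The momentum is a convex combination of 0 and past estimates, so convexity of the fourth power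
    preserves the bound. *)
Lemma Ex_moment_fourth t i : Ex P (fun w => st_m (S t w) 0 i ^+ 4) <= K4.
Proof.
elim: t => [|t IH].
  by under eq_fun do rewrite mxE expr0n; rewrite Ex_cst.
apply: (@le_trans _ _ (Ex P (fun w => beta * st_m (S t w) 0 i ^+ 4
    + (1 - beta) * g t w 0 i ^+ 4))).
  apply: le_Ex => [||w].
  - exact: brvX.
  - by apply: brvD; apply: brvZ; exact: brvX.
  - by rewrite SE adamm_step_m convex_expr4.
have bm4 := brvX 4 (bm t i); have bg4 := brvX 4 (bg t i).
rewrite ExD ?ExZ//; do ?exact: brvZ.
have h2 := Ex_grad_fourth t i; have b1' : 0 <= 1 - beta by rewrite subr_ge0 ltW.
have := ler_wpM2l b0 IH; have := ler_wpM2l b1' h2; lra.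
Qed.

Let e := d%:R * r * Lg.

(** Two averages in turn: over the direction with state and sample frozen, leaving the sample
    gradient and the bias [e]; then over the sample with the state frozen, leaving the gradient of
    the objective. *)
Lemma Ex_dot_grad_ge t :
  Ex P (fun w => dot (aux_grad G alpha beta (S t w)) (G (st_x (S t w)))
    - e * enorm (aux_grad G alpha beta (S t w))) <=
  Ex P (fun w => dot (aux_grad G alpha beta (S t w)) (g t w)).
Proof.
pose ag s := aux_grad G alpha beta s.
have GLc x : enorm (G x) <= Lc by exact: (enorm_gobj Lg0 Lc0 f_int f_diff f_Lg f_Lc).
have mG i : measurable_fun setT ((fun x => G x 0 i) : B -> R).
  exact: (measurable_gobj Lg0 Lc0 f_int f_diff f_Lg f_Lc).
have agL w : enorm (ag (S t w)) <= c^-1 * Lc.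
  by apply: enorm_aux_grad_le => // i; exact: run_vh_ge.
have cL0 : 0 <= c^-1 * Lc by rewrite mulr_ge0// invr_ge0 ltW.
have e0 : 0 <= e by rewrite !mulr_ge0// ltW.
have eb w : `|e * enorm (ag (S t w))| <= e * (c^-1 * Lc).
  by rewrite normrM (ger0_norm e0) (ger0_norm (enorm_ge0 _)); exact: ler_wpM2l.
have mag : measurable_fun setT ((fun p : SXi => ag (to_state p.1)) : SXi -> B).
  exact: measurable_aux_grad.
pose psi (p : SXi) :=
  dot (ag (to_state p.1)) (gradf f (st_x (to_state p.1)) p.2) - e * enorm (ag (to_state p.1)).
have mpsi : measurable_fun setT psi.
  apply: measurable_funB.
    apply: measurable_dot2 => //; apply: measurable_fun_rV => i.
    apply: (measurable_gradf Lg0 Lc0 f_int f_diff f_Lg f_Lc); first by case: mstate1.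
    exact: measurable_snd.
  by apply: measurable_funM => //; exact: (measurableT_comp (@measurable_enorm R d) mag).
have psiN w z : `|psi (of_state (S t w), z)| <= c^-1 * Lc * Lc + e * (c^-1 * Lc).
  rewrite /psi /= of_stateK; apply: le_trans (ler_normB _ _) _; apply: lerD.
    apply: le_trans (normr_dot_le _ _) _; apply: ler_pM => //; rewrite ?enorm_ge0//.
    exact: (enorm_gradf Lc0 f_diff f_Lg f_Lc).
  exact: eb.
pose Phi (p : SXi * B) := dot (ag (to_state p.1.1)) (est p).
apply: (@le_trans _ _ (Ex P (psi \o pre t))); last first.
  apply: le_trans (_ : _ <= Ex P (fun w => Phi (pre t w, u t.+1 w))) _; last first.
    by rewrite /Phi/=; under eq_fun do rewrite of_stateK.
  apply: (@indep_le_Ex _ _ _ _ SXi B _ P (pre t) (u t.+1) (mpre t) (m_u _) (@pre_u t)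
    Phi psi (c^-1 * Lc * (d%:R * Lc)) (c^-1 * Lc * Lc + e * (c^-1 * Lc))) => //.
  - by apply: measurable_dot2 => //; exact: measurable_aux_grad.
  - move=> w w'; apply: le_trans (normr_dot_le _ _) _.
    rewrite /= of_stateK; apply: ler_pM; rewrite ?enorm_ge0//.
    exact: (enorm_zo_grad_le _ _ (u_unit _ _)).
  - by move=> w; exact: psiN.
  - move=> w; exact: (dot_zo_grad_mean (mu t.+1) (u_unif _) (u_unit _)
      (h := f^~ (xi t.+1 w)) r0 (f_quad f_diff f_Lg _ _) (b_val _ _ _)
      (ag (to_state (of_state (S t w)))) d0).
pose psi2 (p : @state_space R d) := dot (ag (to_state p)) (G (st_x (to_state p)))
  - e * enorm (ag (to_state p)).
have mst := @measurable_to_state R d.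
have mag2 : measurable_fun setT ((fun p : state_space => ag (to_state p)) : state_space -> B).
  exact: measurable_aux_grad.
have -> : (fun w => dot (aux_grad G alpha beta (S t w)) (G (st_x (S t w)))
    - e * enorm (aux_grad G alpha beta (S t w))) = psi2 \o (fun w => of_state (S t w)).
  by apply/funext => w; rewrite /psi2 /comp of_stateK.
apply: (@indep_le_Ex _ _ _ _ (@state_space R d) Xi _ P (fun w => of_state (S t w)) (xi t.+1)
    (measurable_of_state (mS t)) (mxi _) (@state_xi t)
    psi psi2 (c^-1 * Lc * Lc + e * (c^-1 * Lc)) (c^-1 * Lc * Lc + e * (c^-1 * Lc))).
- exact: mpsi.
- by move=> w w'; exact: psiN.
- apply: measurable_funB.
    apply: measurable_dot2 => //; apply: measurable_fun_rV => i.
    by apply: (measurableT_comp (mG i)); case: mst.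
  by apply: measurable_funM => //; exact: (measurableT_comp (@measurable_enorm R d) mag2).
- move=> w; rewrite /psi2 of_stateK; apply: le_trans (ler_normB _ _) _; apply: lerD.
    by apply: le_trans (normr_dot_le _ _) _; apply: ler_pM => //; rewrite ?enorm_ge0.
  exact: eb.
move=> w; rewrite /psi2 /psi /= of_stateK; set s := S t w.
have bxi : bounded_rv (fun w' => dot (ag s) (gradf f (st_x s) (xi t.+1 w'))).
  have [m1 [M h1]] := brv_dot_gradf Lg0 Lc0 f_int f_diff f_Lg f_Lc (st_x s) (ag s).
  split; last by exists M => w'; rewrite dotC.
  have := measurableT_comp m1 (mxi t.+1).
  by congr measurable_fun; apply/funext => w'; rewrite /= dotC.
rewrite ExB ?Ex_cst//; last exact: brv_cst.
rewrite lerD2r dotC (dot_gobj Lg0 Lc0 f_int f_diff f_Lg f_Lc) le_eqVlt; apply/orP; left.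
apply/eqP/esym.
pose h z := dot (gradf f (st_x s) z) (ag s).
have bh := brv_dot_gradf Lg0 Lc0 f_int f_diff f_Lg f_Lc (st_x s) (ag s).
transitivity (Ex P (h \o xi t.+1)).
  by congr Ex; apply/funext => w'; rewrite /h /= dotC.
apply: (@eq_law_Ex _ _ _ _ _ Xi _ P Pxi (xi t.+1) id h) => //.
- by move=> A mA; rewrite xi_law.
- by case: bh.
- by move: bxi; congr bounded_rv; apply/funext => w'; rewrite /h /= dotC.
Qed.

(** The weights are those before step t + 1, so this depends only on the state and is independent of
    R. *)
Definition wgrad2 t w := \sum_i wgt (st_vh (S t w)) i * G (st_x (S t w)) 0 i ^+ 2.

Let GLc x : enorm (G x) <= Lc.
Proof. exact: (enorm_gobj Lg0 Lc0 f_int f_diff f_Lg f_Lc). Qed.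

Let mG i : measurable_fun setT ((fun x => G x 0 i) : B -> R).
Proof. exact: (measurable_gobj Lg0 Lc0 f_int f_diff f_Lg f_Lc). Qed.

Let bG (z : Omega -> vec) i : measurable_fun setT (z : Omega -> B) ->
  bounded_rv (fun w => G (z w) 0 i).
Proof.
move=> mz; split; first exact: (measurableT_comp (mG i) mz).
by exists Lc => w; apply: le_trans (enorm_coord _ _) (GLc _).
Qed.

Let bGx t i : bounded_rv (fun w => G (st_x (S t w)) 0 i).
Proof. by apply: bG; case: (mS t). Qed.

Let bag t i : bounded_rv (fun w => aux_grad G alpha beta (S t w) 0 i).
Proof.
under eq_fun do rewrite mxE; apply: brvM; first exact: bW.
exact: (bG i (measurable_aux_point alpha beta (mS t))).
Qed.

Lemma brv_wgrad2 t : bounded_rv (wgrad2 t).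
Proof. by apply: brv_sum => i; apply: brvM; [exact: bW|exact: brvX (bGx t i)]. Qed.

Let K := 1 + K4.

Let Ex_sqr_le (X : Omega -> R) : bounded_rv X -> Ex P (fun w => X w ^+ 4) <= K4 ->
  Ex P (fun w => X w ^+ 2) <= K.
Proof.
move=> bX X4; apply: (@le_trans _ _ (Ex P (fun w => 1 + X w ^+ 4))).
  by apply: le_Ex => [||w]; [exact: brvX|exact: brvD (brv_cst _) (brvX 4 bX)|exact: le1D_expr4].
by rewrite (ExD P (brv_cst _) (brvX 4 bX)) Ex_cst /K lerD2l.
Qed.

Let D : R := d%:R.

(** Per unit of alpha, in order: the distance from z to x, the bias of the estimate, the fourth
    moments above the level eta, and the second-order term of the expansion. *)
Definition step_err (eta : R) := Lg ^+ 2 * (b * alpha) ^+ 2 / (2 * c ^+ 3) * (D * K)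
  + e ^+ 2 / (2 * c) + Lc / (c * eta ^+ 3) * (D * ((1 + b) * K))
  + 2 * Lg * alpha / c ^+ 2 * (D * ((1 + b ^+ 2) * K)).

Let b_ge0 : 0 <= b.
Proof. by rewrite divr_ge0// subr_ge0 ltW. Qed.

Let sum_le (X : 'I_d -> Omega -> R) M : (forall i, bounded_rv (X i)) ->
  (forall i, Ex P (X i) <= M) -> Ex P (fun w => \sum_i X i w) <= D * M.
Proof.
move=> bX XM; rewrite Ex_sum//; apply: le_trans (ler_sum _ (fun i _ => XM i)) _.
by rewrite sumr_const card_ord -mulr_natl.
Qed.

Lemma Ex_dot_grad_lower t :
  2^-1 * Ex P (wgrad2 t) - Lg ^+ 2 * (b * alpha) ^+ 2 / (2 * c ^+ 3) * (D * K)
    - e ^+ 2 / (2 * c)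
  <= Ex P (fun w => dot (aux_grad G alpha beta (S t w)) (g t w)).
Proof.
apply: le_trans (Ex_dot_grad_ge t).
set k1 := Lg ^+ 2 * (b * alpha) ^+ 2 / (2 * c ^+ 3); set k2 := e ^+ 2 / (2 * c).
have k10 : 0 <= k1.
  apply: divr_ge0; first exact: mulr_ge0 (sqr_ge0 _) (sqr_ge0 _).
  by rewrite mulr_ge0// exprn_ge0// ltW.
have bm2 : bounded_rv (fun w => \sum_i st_m (S t w) 0 i ^+ 2).
  by apply: brv_sum => i; exact: brvX.
have bA := brvZ 2^-1 (brv_wgrad2 t).
have b1A := brvB bA (brvZ k1 bm2).
have h : Ex P (fun w => 2^-1 * wgrad2 t w - k1 * (\sum_i st_m (S t w) 0 i ^+ 2) - k2) <=
    Ex P (fun w => dot (aux_grad G alpha beta (S t w)) (G (st_x (S t w)))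
    - e * enorm (aux_grad G alpha beta (S t w))).
  apply: le_Ex => [||w].
  - exact: brvB b1A (brv_cst _).
  - apply: brvB.
      by apply: brv_sum => i; apply: brvM; [exact: bag|exact: bGx].
    apply: brvZ; split.
      exact: (measurableT_comp (@measurable_enorm R d) (measurable_aux_grad alpha beta mG (mS t))).
    exists (c^-1 * Lc) => w; rewrite ger0_norm ?enorm_ge0//.
    by apply: enorm_aux_grad_le => // i; exact: run_vh_ge.
  - apply: aux_grad_dot_ge => //.
    + by move=> x y; exact: (gobj_lipschitz Lg0 Lc0 f_int f_diff f_Lg f_Lc).
    + by move=> i; exact: run_vh_ge.
    + by rewrite mulr_ge0// mulr_ge0// ltW.
apply: le_trans h; rewrite (ExB P b1A (brv_cst _)) Ex_cst (ExB P bA (brvZ k1 bm2)).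
rewrite (ExZ P _ (brv_wgrad2 t)) (ExZ P _ bm2) lerD2r lerD2l lerN2 ler_wpM2l//.
apply: sum_le => i; first exact: brvX.
by apply: Ex_sqr_le => //; exact: Ex_moment_fourth.
Qed.

Lemma Ex_potential_step eta t : 0 < eta ->
  Ex P (fun w => potential F Lc alpha beta eta (S t.+1 w)) <=
  Ex P (fun w => potential F Lc alpha beta eta (S t w))
  - alpha * (2^-1 * Ex P (wgrad2 t)) + alpha * step_err eta.
Proof.
move=> eta0; set pot := potential F Lc alpha beta eta.
set k1 := alpha * Lc / (c * eta ^+ 3); set k2 := 2 * Lg * alpha ^+ 2 / c ^+ 2.
pose Y1 w := dot (aux_grad G alpha beta (S t w)) (g t w).
pose Y2 w := \sum_i (g t w 0 i ^+ 4 + b * st_m (S t w) 0 i ^+ 4).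
pose Y3 w := \sum_i (g t w 0 i ^+ 2 + b ^+ 2 * st_m (S t w) 0 i ^+ 2).
have bY1 : bounded_rv Y1 by apply: brv_sum => i; apply: brvM; [exact: bag|exact: bg].
have b4 i := brvD (brvX 4 (bg t i)) (brvZ b (brvX 4 (bm t i))).
have b2 i := brvD (brvX 2 (bg t i)) (brvZ (b ^+ 2) (brvX 2 (bm t i))).
have bY2 : bounded_rv Y2 by exact: brv_sum.
have bY3 : bounded_rv Y3 by exact: brv_sum.
have bY12 := brvB (bpot eta t) (brvZ alpha bY1).
have bY123 := brvD bY12 (brvZ k1 bY2).
have h : Ex P (fun w => pot (S t.+1 w)) <=
    Ex P (fun w => pot (S t w) - alpha * Y1 w + k1 * Y2 w + k2 * Y3 w).
  apply: le_Ex => [||w].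
  - exact: bpot.
  - exact: brvD bY123 (brvZ k2 bY3).
  - exact: (potential_step beta2 Lg0 Lc0 c0 a0 b0 b1
      (fobj_quad Lg0 Lc0 f_int f_diff f_Lg f_Lc) GLc (g t w) (run_vh_ge t w) eta0).
apply: le_trans h _.
rewrite (ExD P bY123 (brvZ k2 bY3)) (ExD P bY12 (brvZ k1 bY2)).
rewrite (ExB P (bpot eta t) (brvZ alpha bY1)) !ExZ//.
have h1 := Ex_dot_grad_lower t; rewrite -/Y1 in h1.
have h2 : Ex P Y2 <= D * ((1 + b) * K).
  apply: sum_le => i; first exact: b4.
  rewrite (ExD P (brvX 4 (bg t i)) (brvZ b (brvX 4 (bm t i)))) (ExZ P b (brvX 4 (bm t i))).
  have := Ex_grad_fourth t i; have := ler_wpM2l b_ge0 (Ex_moment_fourth t i).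
  by rewrite /K mulrDl mul1r => q1 q2; rewrite lerD//; [rewrite ler_wpDl|rewrite mulrDr mulr1 ler_wpDl].
have h3 : Ex P Y3 <= D * ((1 + b ^+ 2) * K).
  apply: sum_le => i; first exact: b2.
  rewrite (ExD P (brvX 2 (bg t i)) (brvZ (b ^+ 2) (brvX 2 (bm t i)))).
  rewrite (ExZ P (b ^+ 2) (brvX 2 (bm t i))) mulrDl mul1r; apply: lerD.
    exact: Ex_sqr_le (bg t i) (Ex_grad_fourth t i).
  by rewrite ler_wpM2l ?sqr_ge0//; exact: Ex_sqr_le (bm t i) (Ex_moment_fourth t i).
have k10 : 0 <= k1.
  by rewrite divr_ge0 ?mulr_ge0 ?exprn_ge0// ltW.
have k20 : 0 <= k2.
  apply: divr_ge0 (sqr_ge0 _); apply: mulr_ge0 (sqr_ge0 _).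
  exact: mulr_ge0 (ler0n _ _) Lg0.
have p1 := ler_wpM2l (ltW a0) h1.
have p2 := ler_wpM2l k10 h2; have p3 := ler_wpM2l k20 h3.
have -> : alpha * step_err eta =
  alpha * (Lg ^+ 2 * (b * alpha) ^+ 2 / (2 * c ^+ 3) * (D * K)) + alpha * (e ^+ 2 / (2 * c))
  + k1 * (D * ((1 + b) * K)) + k2 * (D * ((1 + b ^+ 2) * K)).
  rewrite /step_err /k1 /k2; set q1 := (2 * c ^+ 3)^-1; set q2 := (c * _)^-1.
  by set q3 := (2 * c)^-1; set q4 := (c ^+ 2)^-1; ring.
move: p1 p2 p3; rewrite !mulrBr.
move: (Ex P Y1) (Ex P Y2) (Ex P Y3) (Ex P (wgrad2 t)) (Ex P _) => E1 E2 E3 EA EP.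
set x1' := alpha * (_ * (D * K)); set x2 := alpha * (e ^+ 2 / _).
set x3 := k1 * (D * _); set x4 := k2 * (D * _).
set y1 := alpha * E1; set y2 := k1 * E2; set y3 := k2 * E3; set y0 := alpha * (2^-1 * _).
by move=> p1 p2 p3; lra.
Qed.

(** The potential telescopes, and the gap bound is applied at the random last auxiliary point. *)
Lemma sum_Ex_wgrad2 eta Df' T : 0 < eta -> (forall x, F x1 - F x <= Df') ->
  alpha * (2^-1 * \sum_(t < T) Ex P (wgrad2 t)) <=
  Df' + alpha * Lc * (1 + b) * eta * (D * c^-1) + T%:R * (alpha * step_err eta).
Proof.
move=> eta0 FD; set pot := potential F Lc alpha beta eta.
have tel : alpha * (2^-1 * \sum_(t < T) Ex P (wgrad2 t)) <=
    Ex P (fun w => pot (S 0 w)) - Ex P (fun w => pot (S T w))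
    + T%:R * (alpha * step_err eta).
  have := fun n => Ex_potential_step n eta0; rewrite -/pot.
  move: (alpha * step_err eta) => x h.
  elim: T => [|n IH]; first by rewrite big_ord0 !mulr0 mul0r subrr addr0.
  rewrite big_ord_recr/= -[n.+1%:R]natr1; move: IH (h n); move: (\sum_(t < n) _) => SA.
  move: (Ex P (fun w => pot (S 0 w))) (Ex P (fun w => pot (S n w)))
    (Ex P (fun w => pot (S n.+1 w))) (Ex P (wgrad2 n)) => E0 E1 E2 A.
  rewrite [2^-1 * (SA + A)]mulrDr [alpha * (_ + _)]mulrDr mulrDl mul1r.
  move: (alpha * (2^-1 * SA)) (alpha * (2^-1 * A)) (n%:R * x) => p q s IH h'.
  by lra.
apply: le_trans tel _; rewrite lerD2r -(ExB P (bpot eta 0) (bpot eta T)).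
rewrite -(Ex_cst P (Df' + _)); apply: le_Ex => [||w].
    exact: brvB (bpot eta 0) (bpot eta T).
  exact: brv_cst.
(* The initial momentum is zero, so the auxiliary point starts at [x1]. *)
have -> : potential F Lc alpha beta eta (S 0 w) = F x1 + alpha * Lc * (1 + b) * eta * \sum_i wgt vh0 i.
  rewrite /potential; congr (F _ + _).
  by apply/rowP => i; rewrite aux_pointE /= mxE !mulr0 subr0.
have k0 : 0 <= alpha * Lc * (1 + b) * eta.
  by rewrite !mulr_ge0 ?addr_ge0// ltW.
have h1 : \sum_i wgt vh0 i <= D * c^-1.
  apply: (@le_trans _ _ (\sum_(i < d) c^-1)); last by rewrite sumr_const card_ord -mulr_natl.
  by apply: ler_sum => i _; apply: wgt_le.
have h2 : 0 <= \sum_i wgt (st_vh (S T w)) i by apply: sumr_ge0 => i _; exact: wgt_ge0.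
have := ler_wpM2l k0 h1; have := mulr_ge0 k0 h2; have := FD (aux_point alpha beta (S T w)).
rewrite /potential -/b; set k := alpha * _ * _ * _.
set y1 := k * _; set y2 := k * _; set y3 := k * _.
lra.
Qed.

(** State t + 1 carries the weights paired with the iterate held in state t; weights only decrease,
    so the earlier ones give an upper bound. *)
Lemma wnorm2_le_wgrad2 t w :
  wnorm2 (st_vh (S t.+1 w)) (G (st_x (S t w))) <= wgrad2 t w.
Proof.
have c2 : 0 <= c ^+ 2 by exact: sqr_ge0.
rewrite wnorm2E => [|i]; last exact: le_trans c2 (run_vh_ge _ _ _).
apply: ler_sum => i _; rewrite ler_wpM2r ?sqr_ge0//.
apply: (wgt_anti c0); first exact: run_vh_ge.
by rewrite SE; exact: adamm_step_vh.
Qed.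

Lemma wgrad2_ge0 t w : 0 <= wgrad2 t w.
Proof. by apply: sumr_ge0 => i _; rewrite mulr_ge0 ?wgt_ge0 ?sqr_ge0. Qed.

Lemma measurable_index : measurable_fun setT Ridx.
Proof.
move=> _ C _; rewrite setTI; have -> : Ridx @^-1` C = \bigcup_(k in C) Ridx @^-1` [set k].
  by apply/seteqP; split => [w Cw|w [k Ck] /= wk]; [exists (Ridx w)|rewrite /= wk].
by apply: bigcup_measurable => k _; exact: mR.
Qed.

Lemma brv_index k : bounded_rv (fun w => (Ridx w == k)%:R : R).
Proof.
split; last by exists 1 => w; rewrite ger0_norm ?ler0n// lern1 leq_b1.
have mi : measurable_fun setT (\1_(Ridx @^-1` [set k]) : Omega -> R).
  exact: measurable_indic.
rewrite (_ : (fun w => _) = \1_(Ridx @^-1` [set k]))//; apply/funext => w.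
by rewrite indicE; congr (nat_of_bool _)%:R; apply/eqP/idP => [/mem_set|/set_mem].
Qed.

Lemma Ex_index k : Ex P (fun w => (Ridx w == k)%:R) = fine (P (Ridx @^-1` [set k])).
Proof.
apply: EFin_inj; rewrite EFin_Ex; last exact: brv_index.
rewrite fineK ?fin_num_measure// -[in RHS](setIT (_ @^-1` _)) -(integral_indic _ measurableT (mR k)).
apply: eq_integral => w _; rewrite indicE; congr (_%:R)%:E; congr nat_of_bool.
by apply/eqP/idP => [/mem_set|/set_mem].
Qed.

Lemma Ex_wgrad2_index t k : Ex P (fun w => wgrad2 t w * (Ridx w == k)%:R) <=
  Ex P (wgrad2 t) * fine (P (Ridx @^-1` [set k])).
Proof.
have [_ [M AM]] := brv_wgrad2 t.
pose A (s : @state_space R d) :=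
  \sum_i wgt (st_vh (to_state s)) i * G (st_x (to_state s)) 0 i ^+ 2.
have AE w : A (of_state (S t w)) = wgrad2 t w by rewrite /A /wgrad2 of_stateK.
have mA : measurable_fun setT A.
  have [h1 _ _ h4] := @measurable_to_state R d.
  apply: measurable_sum => i; apply: measurable_funM; first exact: measurable_wgt.
  by apply: measurable_funX; exact: (measurableT_comp (mG i) h1).
pose q := fine (P (Ridx @^-1` [set k])).
pose Phi (p : @state_space R d * nat) := - (A p.1 * (p.2 == k)%:R).
have mPhi : measurable_fun setT Phi.
  apply: measurable_funN; apply: measurable_funM.
    exact: (measurableT_comp mA measurable_fst).
  have mk : measurable_fun setT (fun n : nat => (n == k)%:R : R) by [].
  exact: (measurableT_comp mk measurable_snd).
have XZ C1 C2 : measurable C1 -> measurable C2 ->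
    P ((fun w => of_state (S t w)) @^-1` C1 `&` Ridx @^-1` C2) =
    (P ((fun w => of_state (S t w)) @^-1` C1) * P (Ridx @^-1` C2))%E.
  by move=> mC1 _; exact: (run_index_indep mf mxi m_u mR indep).
have := @indep_le_Ex _ _ _ _ (@state_space R d) nat _ P (fun w => of_state (S t w)) Ridx
  (measurable_of_state (mS t)) measurable_index XZ Phi (fun s => - (A s * q)) M (M * q) mPhi.
have bq := brv_index k.
have q0 : 0 <= q by rewrite fine_ge0.
have h : Ex P (fun w => - (wgrad2 t w * q)) <=
    Ex P (fun w => - (wgrad2 t w * (Ridx w == k)%:R)) ->
    Ex P (fun w => wgrad2 t w * (Ridx w == k)%:R) <= Ex P (wgrad2 t) * q.
  rewrite (ExN P (brvM (brv_wgrad2 t) (brv_cst q))).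
  rewrite (ExN P (brvM (brv_wgrad2 t) bq)) lerN2 => h; apply: le_trans h _.
  by rewrite [leRHS]mulrC -(ExZ P q (brv_wgrad2 t)); under eq_fun do rewrite mulrC.
move=> H; apply: h.
have -> : (fun w => - (wgrad2 t w * q)) = (fun s => - (A s * q)) \o (fun w => of_state (S t w)).
  by apply/funext => w; rewrite /= AE.
have -> : (fun w => - (wgrad2 t w * (Ridx w == k)%:R)) =
    (fun w => Phi (of_state (S t w), Ridx w)).
  by apply/funext => w; rewrite /Phi /= AE.
apply: H.
- move=> w w'; rewrite /Phi /= AE normrN normrM; apply: le_trans (_ : _ <= M * 1) _.
    apply: ler_pM => //; by rewrite ger0_norm ?ler0n// lern1 leq_b1.
  by rewrite mulr1.
- by apply: measurable_funN; apply: measurable_funM.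
- by move=> w; rewrite AE normrN normrM (ger0_norm q0) ler_wpM2r.
- move=> w; rewrite /Phi /= AE.
  rewrite (ExN P (brvZ (wgrad2 t w) bq)) (ExZ P _ bq) Ex_index//.
Qed.

End ExpectedDescent.

(** * The rate at a random index *)

Section Rate.
Context {R : realType}.
Implicit Types Lg Lc c b K Df a y : R.

(** In order: the initial gap, with 2 Lc for passing from the smoothed objective to f; the initial
    weights in the potential; then the four terms of [step_err]. *)
Definition rate_const Lg Lc c b K Df :=
  2 * (Df + 2 * Lc) + 2 * (Lc * (1 + b) / c) + Lg ^+ 2 * b ^+ 2 * K / c ^+ 3
  + Lg ^+ 2 / c + 2 * (Lc * ((1 + b) * K) / c) + 4 * (Lg * ((1 + b ^+ 2) * K) / c ^+ 2).

(* With a = sqrt d, y = T^(-1/4) and s the sum over t <= T, so alpha = mu = y^2 / a and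
   eta = y^-1. *)
Lemma rate_arith Lg Lc c b K Df a y s : 0 <= Lg -> 0 <= Lc -> 0 < c -> 0 <= b -> 0 <= K ->
  0 <= Df -> 1 <= a -> 0 < y -> y <= 1 ->
  y ^+ 2 / a * (2^-1 * s) <= Df + 2 * Lc + y ^+ 2 / a * Lc * (1 + b) * y^-1 * (a ^+ 2 * c^-1)
    + (y ^+ 4)^-1 * (y ^+ 2 / a * (Lg ^+ 2 * (b * (y ^+ 2 / a)) ^+ 2 / (2 * c ^+ 3) * (a ^+ 2 * K)
      + (a ^+ 2 * (y ^+ 2 / a) * Lg) ^+ 2 / (2 * c)
      + Lc / (c * y^-1 ^+ 3) * (a ^+ 2 * ((1 + b) * K))
      + 2 * Lg * (y ^+ 2 / a) / c ^+ 2 * (a ^+ 2 * ((1 + b ^+ 2) * K)))) ->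
  s * y ^+ 4 <= rate_const Lg Lc c b K Df * (a * y ^+ 2 + a ^+ 3 * y ^+ 4).
Proof.
move=> Lg0 Lc0 c0 b0 K0 D0 a1 y0 y1 h.
have a0 : 0 < a by exact: lt_le_trans a1.
have yn : y != 0 by rewrite gt_eqF.
have an : a != 0 by rewrite gt_eqF.
have cn : c != 0 by rewrite gt_eqF.
(* The factor 2 a y^2 is 2 / (alpha T), which turns the left side into the average over t. *)
have k0 : 0 <= 2 * a * y ^+ 2 by rewrite mulr_ge0 ?sqr_ge0// mulr_ge0// ltW.
have {h} h := ler_wpM2l k0 h.
have e1 : 2 * a * y ^+ 2 * (y ^+ 2 / a * (2^-1 * s)) = s * y ^+ 4 by field.
rewrite e1 in h; apply: le_trans h _.
set M := a * y ^+ 2 + a ^+ 3 * y ^+ 4.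
have ay2 : 0 <= a * y ^+ 2 by rewrite mulr_ge0 ?sqr_ge0// ltW.
have y2 : 0 <= y ^+ 2 by exact: sqr_ge0.
have y4 : 0 <= y ^+ 4 by rewrite exprn_ge0// ltW.
have a3 : 0 <= a ^+ 3 * y ^+ 4 by rewrite mulr_ge0// exprn_ge0// ltW.
have m1 : a * y ^+ 2 <= M by rewrite /M lerDl.
(* The geometric mean of the two terms of the rate. It comes from the potential, linear in eta, and
   from the fourth moments, of order eta^-3, which the choice eta = y^-1 makes equal in order. *)
have m2 : a ^+ 2 * y ^+ 3 <= M.
  have := mulr_ge0 ay2 (sqr_ge0 (1 - a * y)).
  have -> : a * y ^+ 2 * (1 - a * y) ^+ 2 = M - 2 * (a ^+ 2 * y ^+ 3) by rewrite /M; ring.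
  have : 0 <= a ^+ 2 * y ^+ 3 by rewrite mulr_ge0 ?sqr_ge0// exprn_ge0// ltW.
  move: (a ^+ 2 * y ^+ 3) => q; lra.
have m3 : y ^+ 4 <= M.
  apply: le_trans m1; rewrite (_ : y ^+ 4 = y ^+ 2 * y ^+ 2); last by ring.
  apply: ler_pM => //; apply: le_trans a1; rewrite expr_le1// ltW//.
have m4 : a ^+ 2 * y ^+ 4 <= M.
  apply: (@le_trans _ _ (a ^+ 3 * y ^+ 4)); last by rewrite /M lerDr.
  by rewrite ler_wpM2r// ler_weXn2l.
have b1 : 0 <= 1 + b by lra.
have cV : 0 <= c^-1 by rewrite invr_ge0 ltW.
have q1 : 0 <= 2 * (Df + 2 * Lc) by lra.
have q2 : 0 <= 2 * (Lc * (1 + b) / c) by rewrite mulr_ge0// !mulr_ge0.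
have q3 : 0 <= Lg ^+ 2 * b ^+ 2 * K / c ^+ 3.
  by rewrite -exprVn !mulr_ge0 ?exprn_ge0.
have q4 : 0 <= Lg ^+ 2 / c by rewrite !mulr_ge0 ?sqr_ge0.
have q5 : 0 <= 2 * (Lc * ((1 + b) * K) / c) by rewrite mulr_ge0// !mulr_ge0.
have q6 : 0 <= 4 * (Lg * ((1 + b ^+ 2) * K) / c ^+ 2).
  by rewrite mulr_ge0// -exprVn !mulr_ge0 ?exprn_ge0// addr_ge0 ?sqr_ge0.
have := ler_wpM2l q1 m1; have := ler_wpM2l q2 m2; have := ler_wpM2l q3 m3.
have := ler_wpM2l q4 m4; have := ler_wpM2l q5 m2; have := ler_wpM2l q6 m1.
have -> : 2 * a * y ^+ 2 *
  (Df + 2 * Lc + y ^+ 2 / a * Lc * (1 + b) * y^-1 * (a ^+ 2 * c^-1) + (y ^+ 4)^-1 *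
   (y ^+ 2 / a *
    (Lg ^+ 2 * (b * (y ^+ 2 / a)) ^+ 2 / (2 * c ^+ 3) * (a ^+ 2 * K)
     + (a ^+ 2 * (y ^+ 2 / a) * Lg) ^+ 2 / (2 * c) + Lc / (c * y^-1 ^+ 3) * (a ^+ 2 * ((1 + b) * K))
     + 2 * Lg * (y ^+ 2 / a) / c ^+ 2 * (a ^+ 2 * ((1 + b ^+ 2) * K))))) =
  2 * (Df + 2 * Lc) * (a * y ^+ 2) + 2 * (Lc * (1 + b) / c) * (a ^+ 2 * y ^+ 3)
  + Lg ^+ 2 * b ^+ 2 * K / c ^+ 3 * y ^+ 4 + Lg ^+ 2 / c * (a ^+ 2 * y ^+ 4)
  + 2 * (Lc * ((1 + b) * K) / c) * (a ^+ 2 * y ^+ 3)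
  + 4 * (Lg * ((1 + b ^+ 2) * K) / c ^+ 2) * (a * y ^+ 2).
  by field; rewrite yn an cn.
move=> r1 r2 r3 r4 r5 r6; rewrite /rate_const 5![(_ + _) * M]mulrDl.
by rewrite !lerD.
Qed.

End Rate.

(** The function [g1] is arbitrary, so it is compared everywhere with [g2] raised to +oo on the null
    set. *)
Lemma le_integral_off_null {R : realType} {dT} {T : measurableType dT} (m : measure T R)
    (N : set T) (g1 g2 : T -> \bar R) :
  measurable N -> m N = 0%E -> measurable_fun setT g2 -> (forall x, 0 <= g2 x)%E ->
  (forall x, ~ N x -> (g1 x <= g2 x)%E) ->
  (\int[m]_x g1 x <= \int[m]_x g2 x)%E.
Proof.
move=> mN N0 mg2 g20 g12.
pose g3 x := if x \in N then +oo%E else g2 x.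
apply: (@le_trans _ _ (\int[m]_x g3 x)%E).
  apply: le_integral_nonmeasurable => x; rewrite /g3; case: ifPn => [_|xN]; first exact: leey.
  by apply: g12 => /mem_set; exact/negP.
have mg3 : measurable_fun setT g3.
  apply: measurable_fun_ifT => //.
  by apply: (measurable_fun_bool true); rewrite setTI (_ : _ @^-1` _ = N)//;
    apply/seteqP; split => x /=; [move/set_mem|move/mem_set].
have g30 x : (0 <= g3 x)%E by rewrite /g3; case: ifP.
rewrite (ge0_negligible_integral mN measurableT mg3)//.
rewrite (eq_integral g2); last by move=> x /set_mem [_ xN]; rewrite /g3 memNset.
by apply: ge0_subset_integral => //; exact: measurableD.
Qed.

Lemma index_range_null {R : realType} {dO} {Omega : measurableType dO} (P : probability Omega R)
    (Ridx : Omega -> nat) (T : nat) : (0 < T)%N ->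
  (forall k, measurable (Ridx @^-1` [set k])) ->
  (forall k, (1 <= k <= T)%N -> P (Ridx @^-1` [set k]) = (T%:R^-1)%:E) ->
  P [set w | ~~ (1 <= Ridx w <= T)%N] = 0%E.
Proof.
move=> T0 mR PR; pose F k := Ridx @^-1` [set k.+1].
have FE : \big[setU/set0]_(k < T) F k = [set w | (1 <= Ridx w <= T)%N].
  rewrite -bigcup_mkord; apply/seteqP; split => [w [k kT wk]|w /=]; first by rewrite /= wk.
  by case wk : (Ridx w) => [//|k] kT; exists k.
rewrite (_ : [set w | _] = ~` \big[setU/set0]_(k < T) F k); last first.
  by rewrite FE; apply/seteqP; split => w /= /negP.
have mF : measurable (\big[setU/set0]_(k < T) F k).
  by apply: bigsetU_measurable => k _; exact: mR.
rewrite probability_setC//.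
rewrite (measure_semi_additive_ord P (F := fun k : 'I_T => F k))//; last first.
- by move=> i j _ _ [w [wi wj]]; apply: val_inj; have := etrans (esym wi) wj => -[].
- by move=> k; exact: mR.
rewrite (eq_bigr (fun=> (T%:R^-1)%:E)); last by move=> k _; apply: PR; rewrite /= ltn_ord.
rewrite sumEFin sumr_const card_ord -[T%:R^-1 *+ T]mulr_natl mulfV ?subee//.
by rewrite pnatr_eq0 -lt0n.
Qed.

(** Off the null set where R leaves 1..T, X is at most the sum of A_k 1_(R = k+1). The shift is
    there because the iterate number k + 1 sits in the state after k steps. *)
Lemma integral_random_index {R : realType} {dO} {Omega : measurableType dO}
    (P : probability Omega R) (Ridx : Omega -> nat) (T : nat) (A : nat -> Omega -> R)
    (E : set Omega) (X : Omega -> R) : (0 < T)%N ->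
  (forall k, measurable (Ridx @^-1` [set k])) ->
  (forall k, (1 <= k <= T)%N -> P (Ridx @^-1` [set k]) = (T%:R^-1)%:E) ->
  (forall k, bounded_rv (A k)) -> (forall k w, 0 <= A k w) ->
  (forall k, Ex P (fun w => A k w * (Ridx w == k.+1)%:R) <=
    Ex P (A k) * fine (P (Ridx @^-1` [set k.+1]))) ->
  (forall k w, E w -> (k < T)%N -> Ridx w = k.+1 -> X w <= A k w) ->
  (\int[P]_(w in E) (X w)%:E <= (T%:R^-1 * \sum_(k < T) Ex P (A k))%:E)%E.
Proof.
move=> T0 mR PR bA A0 EA XA.
pose Y w := \sum_(k < T) A k w * (Ridx w == k.+1)%:R.
have bAR k : bounded_rv (fun w => A k w * (Ridx w == k.+1)%:R).
  by apply: brvM => //; exact: brv_index.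
have bY : bounded_rv Y by exact: brv_sum.
have AR0 k w : 0 <= A k w * (Ridx w == k.+1)%:R by rewrite mulr_ge0.
have Y0 w : 0 <= Y w by exact: sumr_ge0.
have mN : measurable [set w | ~~ (1 <= Ridx w <= T)%N].
  rewrite -[X in measurable X]setTI.
  exact: (measurable_index mR measurableT (Y := [set n | ~~ (1 <= n <= T)%N])).
rewrite integral_mkcond.
apply: (@le_trans _ _ (\int[P]_w (Y w)%:E)%E).
  apply: (le_integral_off_null mN) => [||w|w /= /negP].
  - exact: index_range_null.
  - by apply/measurable_EFinP; case: bY.
  - by rewrite lee_fin.
  rewrite negbK => wT; rewrite patchE; case: ifPn => [/set_mem Ew|_]; last by rewrite lee_fin.
  move: wT; case wk : (Ridx w) => [//|k] /= kT; rewrite lee_fin.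
  apply: le_trans (XA k w Ew kT wk) _; rewrite /Y (bigD1 (Ordinal kT))//= wk eqxx mulr1.
  by rewrite lerDl; apply: sumr_ge0 => i _; rewrite -wk.
rewrite -EFin_Ex// lee_fin /Y Ex_sum// mulr_sumr; apply: ler_sum => k _.
apply: le_trans (EA k) _; rewrite PR; first by rewrite mulrC.
by rewrite /= ltn_ord.
Qed.

(** * Directions normalised at every outcome *)

Section ToSphere.
Context {R : realType} {d : nat} (i0 : 'I_d).
Local Notation vec := 'rV[R]_d.
Local Notation B := (rVB R d).

(** The basis vector is a default value used with probability 0; it makes the bounds demanded by
    [bounded_rv] hold at every outcome. *)
Definition to_sphere (v : vec) : vec := if enorm v == 1 then v else ebasis R i0.

Lemma enorm_to_sphere v : enorm (to_sphere v) = 1.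
Proof. by rewrite /to_sphere; case: ifPn => [/eqP|_] //; exact: enorm_basis. Qed.

Lemma borel_to_sphere A : borel_rV A -> borel_rV (to_sphere @^-1` A).
Proof.
have mh : measurable_fun setT (to_sphere : B -> B).
  apply: measurable_fun_ifT => //.
  apply: (measurable_fun_bool true); rewrite setTI (_ : _ @^-1` _ = @unit_sphere R d).
    exact: measurable_unit_sphere.
  by apply/seteqP; split => v /= /eqP.
by move=> mA; have := mh measurableT A mA; rewrite setTI.
Qed.

Context {dO} {Omega : measurableType dO} (P : probability Omega R).

(** The uniform law only sees the part of a set on the sphere, where [to_sphere] is the identity. *)
Lemma uniform_to_sphere (u : Omega -> vec) :
  uniform_on_sphere P u -> uniform_on_sphere P (to_sphere \o u).
Proof.
move=> h A mA; rewrite comp_preimage h; last exact: borel_to_sphere.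
congr (_%:E); congr (fine (lebesgue_rV (cone01 _)) / _).
by apply/seteqP; split => v /= -[Av v1]; split=> //; move: Av; rewrite /to_sphere v1 eqxx.
Qed.

Context {dX} {Xi : measurableType dX}.

Lemma mutually_independent_to_sphere (xi : nat -> Omega -> Xi) (u : nat -> Omega -> vec)
    (Ridx : Omega -> nat) : mutually_independent P (generated_events xi u Ridx) ->
  mutually_independent P (generated_events xi (fun t => to_sphere \o u t) Ridx).
Proof.
move=> h J uJ A hA; apply: h => // -[[t|t]|] /hA //= [C mC <-].
by exists (to_sphere @^-1` C) => //; exact: borel_to_sphere.
Qed.

End ToSphere.

Lemma zo_adamm_ext {R : realType} {d : nat} (Xi : Type) (f : 'rV[R]_d -> Xi -> R) x1 vh0 alpha
    beta1 beta2 mu xi u u' t : (forall k, (1 <= k <= t)%N -> u k = u' k) ->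
  zo_adamm f x1 vh0 alpha beta1 beta2 mu xi u t = zo_adamm f x1 vh0 alpha beta1 beta2 mu xi u' t.
Proof.
elim: t => //= t IH uu; rewrite IH ?uu ?leqnn// => k /andP[k1 kt].
by apply: uu; rewrite k1 ltnW.
Qed.

Section AllUnit.
Context {R : realType} {d : nat} {dO} {Omega : measurableType dO} (P : probability Omega R).
Variables (u : nat -> Omega -> 'rV[R]_d) (T : nat).
Hypothesis mu : forall t A, borel_rV A -> measurable (u t @^-1` A).
Hypothesis u_unif : forall t, uniform_on_sphere P (u t).

Definition all_unit := [set w | forall t, (1 <= t <= T)%N -> enorm (u t w) = 1].

Lemma all_unit_directions : depends_only_on_directions u T all_unit.
Proof.
move=> w w' uu; split => h t tT.
  by rewrite -uu//; exact: h.
by rewrite uu//; exact: h.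
Qed.

Let all_unitE : all_unit = \bigcap_(t in [set t | (1 <= t <= T)%N]) u t @^-1` (@unit_sphere R d).
Proof. by []. Qed.

Lemma measurable_all_unit : measurable all_unit.
Proof.
rewrite all_unitE; apply: bigcap_measurableType => t _; apply: mu.
exact: measurable_unit_sphere.
Qed.

Lemma all_unit_ae : P all_unit = 1%E.
Proof.
have mS t : measurable (u t @^-1` (@unit_sphere R d)) by apply: mu; exact: measurable_unit_sphere.
rewrite -[all_unit]setCK (probability_setC P (measurableC measurable_all_unit)).
suff -> : P (~` all_unit) = 0%E by rewrite sube0.
apply: measure_negligible; first exact: measurableC measurable_all_unit.
apply: (@negligibleS _ _ _ _ (\bigcup_t ~` (u t @^-1` (@unit_sphere R d)))).
  rewrite all_unitE setC_bigcap; apply: bigcup_subset => //.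
apply: negligible_bigcup => t; apply/negligibleP; first exact: measurableC.
by have := probability_setC P (mS t); rewrite (direction_unit_ae (u_unif t)) subee.
Qed.

End AllUnit.

(** * The rate for exactly normalised directions *)

Section Convergence.
Context {dO} {Omega : measurableType dO} {R : realType} (P : probability Omega R).
Context {dX} {Xi : measurableType dX} {d : nat} (Pxi : probability Xi R).
Local Notation vec := 'rV[R]_d.
Variables (f : vec -> Xi -> R) (xi : nat -> Omega -> Xi) (u : nat -> Omega -> vec).
Variables (Ridx : Omega -> nat) (Lg Lc c beta beta2 Df : R) (x1 vh0 : vec) (T : nat).
Hypotheses (d0 : (0 < d)%N) (T0 : (0 < T)%N) (Lg0 : 0 <= Lg) (Lc0 : 0 <= Lc) (c0 : 0 < c).
Hypotheses (b0 : 0 <= beta) (b1 : beta < 1).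
Hypothesis f_int : forall x, Pxi.-integrable setT (fun z => (f x z)%:E).
Hypothesis f_diff : forall z x, differentiable (fun y => f y z) x.
Hypothesis f_Lg : forall z x y,
  enorm (grad (fun w => f w z) x - grad (fun w => f w z) y) <= Lg * enorm (x - y).
Hypothesis f_Lc : forall z x y, `|f x z - f y z| <= Lc * enorm (x - y).
Hypothesis mxi : forall t, measurable_fun setT (xi t).
Hypothesis xi_law : forall t A, measurable A -> P (xi t @^-1` A) = Pxi A.
Hypothesis mu : forall t A, borel_rV A -> measurable (u t @^-1` A).
Hypothesis u_unif : forall t, uniform_on_sphere P (u t).
Hypothesis u_unit : forall t w, enorm (u t w) = 1.
Hypothesis mR : forall k, measurable (Ridx @^-1` [set k]).
Hypothesis R_unif : forall k, (1 <= k <= T)%N -> P (Ridx @^-1` [set k]) = (T%:R^-1)%:E.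
Hypothesis indep : mutually_independent P (generated_events xi u Ridx).
Hypothesis vh0_ge : forall i, c ^+ 2 <= vh0 0 i.
Let r := (Num.sqrt (T%:R * d%:R))^-1 : R.
Hypothesis FD : forall x, smoothed (fobj Pxi f) r x1 - smoothed (fobj Pxi f) r x <= Df.

Definition adamm_const : R := rate_const Lg Lc c (beta / (1 - beta))
  (1 + (4320 * (Lc ^+ 8 + 1) + 4324 * Lg ^+ 4)) Df.

Let A t w := wgrad2 Pxi f xi u r beta beta2 r x1 vh0 t w.

Lemma average_wgrad2 : T%:R^-1 * \sum_(k < T) Ex P (A k) <=
  adamm_const * (Num.sqrt d%:R / Num.sqrt T%:R + d%:R * Num.sqrt d%:R / T%:R).
Proof.
have [K4 K4E] : exists K4, K4 = 4320 * (Lc ^+ 8 + 1) + 4324 * Lg ^+ 4 by eexists.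
have K40 : 0 <= 1 + K4.
  by have := exprn_ge0 8 Lc0; have := exprn_ge0 4 Lg0; rewrite K4E; lra.
rewrite /adamm_const -K4E.
have b' : 0 <= beta / (1 - beta) by rewrite divr_ge0// subr_ge0 ltW.
pose a : R := Num.sqrt d%:R; pose y : R := (Num.sqrt (Num.sqrt T%:R))^-1.
have sqrt_ge1 (x : R) : 1 <= x -> 1 <= Num.sqrt x.
  by move=> x1'; rewrite -[leLHS]sqrtr1 ler_wsqrtr.
have a1 : 1 <= a by apply: sqrt_ge1; rewrite ler1n.
have y0 : 0 < y by rewrite invr_gt0 !sqrtr_gt0 ltr0n.
have y1 : y <= 1.
  rewrite invf_le1; last by rewrite !sqrtr_gt0 ltr0n.
  by apply: (sqrt_ge1 _ (sqrt_ge1 _ _)); rewrite ler1n.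
have a0 : 0 < a by exact: lt_le_trans a1.
have dE : d%:R = a ^+ 2 by rewrite sqr_sqrtr// ler0n.
have y2E : y ^+ 2 = (Num.sqrt T%:R)^-1 by rewrite /y exprVn sqr_sqrtr// sqrtr_ge0.
have y4E : y ^+ 4 = T%:R^-1.
  by rewrite (_ : 4 = 2 * 2)%N// exprM y2E exprVn sqr_sqrtr// ler0n.
have TE : T%:R = (y ^+ 4)^-1 by rewrite y4E invrK.
have rE : r = y ^+ 2 / a by rewrite /r sqrtrM ?ler0n// invfM y2E.
have r0 : 0 < r by rewrite rE divr_gt0// exprn_gt0.
have r1 : r <= 1.
  by rewrite rE ler_pdivrMr// mul1r (le_trans _ a1)// expr_le1// ltW.
have dr1 : d%:R ^+ 2 * r ^+ 4 <= 1.
  have -> : d%:R ^+ 2 * r ^+ 4 = y ^+ 8.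
    by rewrite dE rE; field; rewrite gt_eqF.
  by rewrite expr_le1// ltW.
(* Passing from the smoothed objective to f costs Lc r <= Lc at each of the two points. *)
have FD' x : fobj Pxi f x1 - fobj Pxi f x <= Df + 2 * Lc.
  have cl z := smoothed_close z Lc0 (ltW r0) (ball_volume_neq0 (u_unif 0)) (fobj_lipschitz f_int f_Lc).
  have := cl x1; have := cl x; have := FD x.
  have : Lc * r <= Lc by rewrite ler_piMr.
  rewrite !ler_norml; move: (smoothed _ _ _) (smoothed _ _ _) (Lc * r) => s1 s2 q.
  by move=> ? ? /andP[? ?] /andP[? ?]; lra.
have := sum_Ex_wgrad2 beta2 d0 Lg0 Lc0 c0 r0 b0 b1 r0 f_int f_diff f_Lg f_Lc mxi xi_law mu u_unif
  u_unit mR indep vh0_ge dr1 K4E (eta := y^-1) T _ FD'.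
rewrite invr_gt0 => /(_ y0); rewrite /step_err.
rewrite /A; move: (\sum_(k < T) _) => s.
have -> : Num.sqrt d%:R / Num.sqrt T%:R + d%:R * Num.sqrt d%:R / T%:R = a * y ^+ 2 + a ^+ 3 * y ^+ 4.
  by rewrite -y2E -y4E -/a dE -exprSr.
rewrite [T%:R^-1 * s]mulrC -y4E dE TE rE => h.
apply: rate_arith h => //.
by have := FD x1; rewrite subrr.
Qed.

End Convergence.

Lemma lipschitz_const_ge0 {R : realType} {d : nat} (i0 : 'I_d) (L a : R) :
  0 <= a -> a <= L * enorm (ebasis R i0 - 0) -> 0 <= L.
Proof. by move=> a0; rewrite subr0 enorm_basis mulr1; exact: le_trans. Qed.

Theorem theorem1 (R : realType) (Lg Lc c Df beta1 beta2 : R) :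
  0 < c -> 0 < beta1 <= 1 -> 0 < beta2 <= 1 -> beta1 / beta2 < 1 ->
  exists C : R,
  forall (d T : nat), (0 < d)%N -> (0 < T)%N -> (3 <= maxn d T)%N ->
  forall (dX : measure_display) (Xi : measurableType dX) (Pxi : probability Xi R)
         (f : 'rV[R]_d -> Xi -> R),
  (* the objective f(x) = E_xi [f(x; xi)] is well defined *)
  (forall x, Pxi.-integrable setT (fun z => (f x z)%:E)) ->
  (* (A1): each f(.; xi) is differentiable with L_g-Lipschitz gradient *)
  (forall z x, differentiable (fun y => f y z) x) ->
  (forall z x y, enorm (grad (fun w => f w z) x - grad (fun w => f w z) y) <= Lg * enorm (x - y)) ->
  (* (A3): each f(.; xi) is L_c-Lipschitz *)
  (forall z x y, `|f x z - f y z| <= Lc * enorm (x - y)) ->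
  forall (dO : measure_display) (Omega : measurableType dO) (P : probability Omega R)
         (xi : nat -> Omega -> Xi) (u : nat -> Omega -> 'rV[R]_d) (Ridx : Omega -> nat),
  (* samples xi_t with the law of xi *)
  (forall t, measurable_fun setT (xi t)) ->
  (forall t B, measurable B -> P (xi t @^-1` B) = Pxi B) ->
  (* directions u_t uniform on the unit sphere *)
  (forall t B, borel_rV B -> measurable (u t @^-1` B)) ->
  (forall t, uniform_on_sphere P (u t)) ->
  (* R uniform on {1, ..., T} *)
  (forall k, measurable (Ridx @^-1` [set k])) ->
  (forall k, (1 <= k <= T)%N -> P (Ridx @^-1` [set k]) = (T%:R^-1)%:E) ->
  (* all samples, directions and R are mutually independent *)
  mutually_independent P (generated_events xi u Ridx) ->
  forall (x1 vh0 : 'rV[R]_d),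
  (forall i, c <= Num.sqrt (vh0 0 i)) ->
  let fobj := fun x => fine (\int[Pxi]_(z in setT) (f x z)%:E) in
  let mu := (Num.sqrt (T%:R * d%:R))^-1 in
  let alpha := (Num.sqrt (T%:R * d%:R))^-1 in
  (forall x, smoothed fobj mu x1 - smoothed fobj mu x <= Df) ->
  let run := fun w => zo_adamm f x1 vh0 (fun _ => alpha) (fun _ => beta1) beta2 mu
                         (fun t => xi t w) (fun t => u t w) in
  (* || Vhat_R^{-1/4} grad f(x_R) ||^2 *)
  let X := fun w => wnorm2 (st_vh (run w (Ridx w)))
                           (grad fobj (st_x (run w (Ridx w).-1))) in
  exists E : set Omega,
    measurable E /\ depends_only_on_directions u T E /\
    (P E >= (1 - (T%:R * Num.sqrt d%:R)^-1)%:E)%E /\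
    (* E[ X | E ] <= C (sqrt d / sqrt T + d^1.5 / T), i.e. E[X 1_E] <= bound * P(E) *)
    (\int[P]_(w in E) (X w)%:E <=
       (C * (Num.sqrt d%:R / Num.sqrt T%:R + d%:R * Num.sqrt d%:R / T%:R))%:E * P E)%E.
Proof.
move=> c0 /andP[b10 b11] /andP[b20 b21] b12.
have b1 : beta1 < 1.
  by apply: lt_le_trans b21; move: b12; rewrite ltr_pdivrMr// mul1r.
exists (adamm_const Lg Lc c beta1 Df) => d T d0 T0 _ dX Xi Pxi f f_int f_diff f_Lg f_Lc.
move=> dO Omega P xi u Ridx mxi xi_law mu u_unif mR R_unif indep x1 vh0 vh0_ge F r alpha FD S X.
(* An outcome supplies a sample at which the Lipschitz bounds force Lc and Lg to be nonnegative. *)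
have [w0 _] : [set: Omega] !=set0.
  apply/set0P/eqP => O0; have := probability_setT P.
  by rewrite O0 measure0 => /eqP; rewrite eq_sym onee_eq0.
pose i0 := Ordinal d0.
have Lc0 : 0 <= Lc by exact: (lipschitz_const_ge0 (i0 := i0) (normr_ge0 _) (f_Lc (xi 0%N w0) _ _)).
have Lg0 : 0 <= Lg by exact: (lipschitz_const_ge0 (i0 := i0) (enorm_ge0 _) (f_Lg (xi 0%N w0) _ _)).
(* The square root of a negative number is 0, so the lower bound c > 0 on the root excludes negative
   entries. *)
have vh0_sq i : c ^+ 2 <= vh0 0 i.
  have h := vh0_ge i; have v0 : 0 <= vh0 0 i.
    by rewrite leNgt; apply/negP => /ltW/ler0_sqrtr v0; move: h; rewrite v0 leNgt c0.
  by rewrite -[leRHS]sqr_sqrtr// lerXn2r// nnegrE ?sqrtr_ge0// ltW.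
pose u' t := to_sphere i0 \o u t.
have mu' t A : borel_rV A -> measurable (u' t @^-1` A).
  by move=> mA; rewrite /u' comp_preimage; apply: mu; exact: borel_to_sphere.
have u'_unif t : uniform_on_sphere P (u' t) by exact: uniform_to_sphere.
have u'_unit t w : enorm (u' t w) = 1 by exact: enorm_to_sphere.
have indep' : mutually_independent P (generated_events xi u' Ridx).
  exact: mutually_independent_to_sphere.
have PE := all_unit_ae T mu u_unif.
exists (all_unit u T); split; first exact: measurable_all_unit.
split; first exact: all_unit_directions.
split.
  by rewrite PE lee_fin lerBlDr lerDl invr_ge0 mulr_ge0 ?ler0n ?sqrtr_ge0.
rewrite PE mule1; apply: le_trans (_ : _ <= (T%:R^-1 * \sum_(k < T)
    Ex P (wgrad2 Pxi f xi u' r beta1 beta2 r x1 vh0 k))%:E)%E _; last first.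
  rewrite lee_fin.
  exact: (average_wgrad2 beta2 d0 T0 Lg0 Lc0 c0 (ltW b10) b1 f_int f_diff f_Lg f_Lc mxi xi_law
    mu' u'_unif u'_unit mR indep' vh0_sq FD).
apply: integral_random_index => // [k|k w|k|k w Ew kT wk].
- exact: (brv_wgrad2 r beta1 beta2 r x1 Lg0 Lc0 c0 f_int f_diff f_Lg f_Lc mxi mu' vh0_sq).
- exact: wgrad2_ge0.
- exact: (Ex_wgrad2_index r beta1 beta2 r x1 Lg0 Lc0 c0 f_int f_diff f_Lg f_Lc mxi mu' mR indep' vh0_sq).
(* On the event the first T directions are already normalised, so both runs agree up to time T. *)
have uu n : (n <= T)%N -> S w n = zo_adamm f x1 vh0 (fun=> r) (fun=> beta1) beta2 r
    (fun t => xi t w) (fun t => u' t w) n.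
  move=> nT; apply: zo_adamm_ext => j /andP[j1 jn].
  by rewrite /u' /= /to_sphere Ew ?eqxx// j1 (leq_trans jn).
rewrite /X wk [k.+1.-1]/= !uu//; last exact: ltnW.
have -> : grad F = gobj Pxi f by exact: (grad_fobj Lg0 Lc0 f_int f_diff f_Lg f_Lc).
exact: (wnorm2_le_wgrad2 Pxi f xi u' r beta1 beta2 r x1 c0 vh0_sq k w).
Qed.
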